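(* Consider a surface $S\subset \mathbb P^3$ of degree $n\geq 4$ with, as its only singularity, a quasi-ordinary triple point $p$, whose minimal resolution $f: S'\longrightarrow S$ is such that the exceptional divisor $C$ over $p$ is a plane cubic with three nodes, i.e., it is a plane cubic consisting of three lines not in a pencil. Then $[S]$ is in the closure of the Severi variety $V^{\mathbb P^3, |\mathcal O_{\mathbb P^3}(n)|}_{7}$.
   Context: We work over $\mathbb C$. A node is an ordinary double point. For $\delta\geq 1$, $V^{\mathbb P^3, |\mathcal O_{\mathbb P^3}(n)|}_\delta\subset |\mathcal O_{\mathbb P^3}(n)|$ is the Severi variety: the locally closed subvariety parametrizing surfaces of degree $n$ in $\mathbb P^3$ with exactly $\delta$ nodes and no other singularity; $[S]$ is the point of $|\mathcal O_{\mathbb P^3}(n)|$ corresponding to $S$. Let $S$ be a reduced surface with a point $p$ of multiplicity $m$, and let $f:S'\to S$ be the minimal desingularization of $S$ at $p$, with exceptional divisor $C$ over $p$, a plane curve of degree $m$. The point $p$ is a quasi-ordinary multiple point if $C$ is reduced and nodal and $S'$ is obtained from $S$ by blowing up only once at $p$. A quasi-ordinary triple point is the case $m=3$. *)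

(* Defs.v *)
From mathcomp Require Import all_boot all_order all_algebra.
From mathcomp Require Import mpoly.

Set Implicit Arguments.
Unset Strict Implicit.
Unset Printing Implicit Defensive.

Import GRing.Theory.
Local Open Scope ring_scope.

(* A hypersurface of degree d in P^n is given by a nonzero d-homogeneous
   polynomial in n.+1 variables, defined up to a nonzero scalar.  A point of P^n
   is given by a nonzero row vector, two vectors being the same point when they
   span the same line, i.e. when (u == v)%MS. *)

Section Singularities.
Context {K : numClosedFieldType}.

Definition hypersurface n d (F : {mpoly K[n.+1]}) : Prop :=
  F \is d.-homog /\ F != 0.

Definition reduced n (F : {mpoly K[n]}) : Prop :=
  forall A B : {mpoly K[n]}, F = A ^+ 2 * B -> (msize A <= 1)%N.

(* Jacobian criterion; used both for affine equations and, at v != 0, for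
   homogeneous equations of projective hypersurfaces. *)
Definition singular_at n (f : {mpoly K[n]}) (v : 'rV[K]_n) : Prop :=
  f.@[v 0] = 0 /\ forall i, (f^`M(i)).@[v 0] = 0.

Definition hessian n (f : {mpoly K[n]}) (v : 'rV[K]_n) : 'M[K]_n :=
  \matrix_(i, j) ((f^`M(i))^`M(j)).@[v 0].

(* The rows of an invertible M give affine coordinates x on P^n centered at the
   point row 0 M: the chart is x |-> [M_0 + \sum_j x_j M_(j+1)]. *)
Definition frame_at n (p : 'rV[K]_n.+1) (M : 'M[K]_n.+1) : Prop :=
  M \in unitmx /\ row 0 M = p.

Definition local_eq n (F : {mpoly K[n.+1]}) (M : 'M[K]_n.+1) : {mpoly K[n]} :=
  F \mPo [tuple (M 0 k)%:MP + \sum_(j < n) M (lift ord0 j) k *: 'X_j | k < n.+1].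

(* Ordinary double point: nondegenerate critical point of a local equation. *)
Definition node n (F : {mpoly K[n.+1]}) (p : 'rV[K]_n.+1) : Prop :=
  exists M, [/\ frame_at p M, singular_at (local_eq F M) 0
              & hessian (local_eq F M) 0 \in unitmx].

Definition nodal n (F : {mpoly K[n.+1]}) : Prop :=
  forall q, q != 0 -> singular_at F q -> node F q.

(* Exactly delta nodes and no other singularity. *)
Definition has_nodes n delta (F : {mpoly K[n.+1]}) : Prop :=
  exists P : 'I_delta -> 'rV[K]_n.+1,
    [/\ forall i, P i != 0,
        forall i j, i != j -> ~~ (P i == P j)%MS,
        forall i, node F (P i)
      & forall q, q != 0 -> singular_at F q -> exists i, (q == P i)%MS].

Definition severi n d delta (F : {mpoly K[n.+1]}) : Prop :=
  hypersurface d F /\ has_nodes delta F.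

End Singularities.

Section BlowUp.
Context {K : numClosedFieldType}.

(* f has multiplicity m at the origin. *)
Definition multiplicity n (f : {mpoly K[n]}) (m : nat) : Prop :=
  (forall a : 'X_{1..n}, (mdeg a < m)%N -> f@_a = 0) /\
  (exists a : 'X_{1..n}, mdeg a = m /\ f@_a != 0).

(* i-th affine chart of the blow-up of A^n at the origin: x_i |-> x_i and
   x_j |-> x_i x_j for j != i; the exceptional hyperplane is x_i = 0, and its
   affine coordinates (x_j)_(j != i) are those of the chart y_i = 1 of P^(n-1). *)
Definition blowup_chart n (i : 'I_n) : n.-tuple {mpoly K[n]} :=
  [tuple if j == i then 'X_i else 'X_i * 'X_j | j < n].

Definition strict_transform n (m : nat) (f : {mpoly K[n]}) (i : 'I_n)
    (g : {mpoly K[n]}) : Prop :=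
  f \mPo blowup_chart i = 'X_i ^+ m * g.

Definition specialize n (i : 'I_n) (c : K) (g : {mpoly K[n]}) : {mpoly K[n]} :=
  g \mPo [tuple if j == i then c%:MP else 'X_j | j < n].

(* The blow-up at the origin of f = 0 (of multiplicity m there) is smooth along
   its exceptional divisor. *)
Definition blowup_smooth n (m : nat) (f : {mpoly K[n]}) : Prop :=
  forall i, exists2 g, strict_transform m f i g &
    forall v : 'rV[K]_n, v 0 i = 0 -> ~ singular_at g v.

(* C, a form in the homogeneous coordinates of the exceptional P^(n-1), is the
   equation of the exceptional divisor of the blow-up of f = 0. *)
Definition exceptional_divisor n (m : nat) (f C : {mpoly K[n]}) : Prop :=
  C \is m.-homog /\
  forall i, exists2 g, strict_transform m f i g &
    specialize i 0 g = specialize i 1 C.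

(* The surface F has at p a quasi-ordinary multiple point of multiplicity m,
   with exceptional curve C. *)
Definition quasi_ordinary (F : {mpoly K[4]}) (p : 'rV[K]_4) (m : nat)
    (C : {mpoly K[3]}) : Prop :=
  reduced F /\
  exists M, let f := local_eq F M in
    [/\ frame_at p M, multiplicity f m, blowup_smooth m f,
        exceptional_divisor m f C
      & reduced C /\ nodal C].

(* C consists of three lines with no common point. *)
Definition three_lines_not_in_pencil (C : {mpoly K[3]}) : Prop :=
  exists l : 'I_3 -> {mpoly K[3]},
    [/\ forall i, hypersurface 1 (l i),
        C = \prod_i l i
      & forall q : 'rV[K]_3, q != 0 -> exists i, (l i).@[q 0] != 0].

End BlowUp.

Section Closure.
Context {K : numClosedFieldType}.

(* Zariski closure in P^(N-1), for sets given by nonzero representatives. *)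
Definition zariski_closure N (A : 'rV[K]_N -> Prop) (x : 'rV[K]_N) : Prop :=
  forall d (H : {mpoly K[N]}), H \is d.-homog ->
    (forall y, A y -> H.@[y 0] = 0) -> H.@[x 0] = 0.

(* The monomials of degree d in n variables. *)
Definition monomials n d : pred 'X_{1..n < d.+1} := [pred a | mdeg (bmnm a) == d].
Arguments monomials : clear implicits.

(* Homogeneous coordinates on the linear system |O_(P^(n-1))(d)|. *)
Definition coefs n d (F : {mpoly K[n]}) : 'rV[K]_#|monomials n d| :=
  \row_k F@_(enum_val k : 'X_{1..n < d.+1}).

Definition in_closure n d (V : {mpoly K[n.+1]} -> Prop)
    (F : {mpoly K[n.+1]}) : Prop :=
  zariski_closure (fun y => exists2 G, V G & y = coefs d G) (coefs d F).

End Closure.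

(* Main.v *)
Require Import Defs.
From HB Require Import structures.
From mathcomp Require Import all_boot all_order all_algebra.
From mathcomp Require Import boolp classical_sets functions filter reals complex mpoly.
From mathcomp Require Import ring lra ring_quotient.

(* After a linear change of coordinates fixing the triple point, the affine
   equation is a multiple of f = -2xyz + f4 + f5, with f4 a quartic form taking
   the value 1 at the three coordinate points (this is what smoothness of the
   blow-up at the nodes of C means) and f5 of order at least 5.  Consider
     g = f + e^2 (x^2 + y^2 + z^2) - e^6 - 2 e (phi_x + phi_y + phi_z) + ...
   At the scale e^2 this tends to the Cayley cubic
     -2xyz + x^2 + y^2 + z^2 - 1,
   whose four nodes are the sign vectors of product 1, and along the x-axis it
   is x^2 (x - e)^2 + ..., which produces a node at distance about e on each of
   the three axes: 4 + 3 = 7.  The terms left out are small and linear in 28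
   parameters, and the 28 linear conditions for g to be singular at seven
   prescribed points are nonsingular modulo e.

   All this happens over a valuation ring O with residue field the complex
   numbers: sequences that converge along a free ultrafilter, modulo equality
   almost everywhere, with specialization map the limit.  Any singular point of
   g specializes to p, hence is infinitesimal, and comparing its coordinates
   with e it is found to specialize, after rescaling, to one of the seven
   points; nondegeneracy of the Hessian there makes it unique.  Since O is an
   ultraproduct, almost every term of a sequence representing g has exactly
   seven nodes, and these terms converge to F. *)

Set Implicit Arguments.
Unset Strict Implicit.
Unset Printing Implicit Defensive.
Import Order.TTheory GRing.Theory Num.Theory.
Local Open Scope ring_scope.

(** * Multivariate polynomials *)

(** The obstacle is to keep exact control of seven nodes with a perturbation of degree at most 4,
    since n may be 4, and then to exclude every other singular point, including those at scales
    between e^2 and e. On an axis xyz vanishes, so the leading term is the x^4 of f4. The Cayley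
    cubic at scale e^2 already imposes e^2 x^2, and -2 e x^3 is what completes these two to a
    square; this is the origin of the terms phi. The 28 parameters split as 16 + 12. The twelve
    polynomials used at the axes are built to be singular at the four Cayley nodes, so the linear
    system is block triangular: the parameters [u] are fixed by the Cayley nodes whatever [w] is,
    and [w] is then fixed by the axis nodes. Both scales, and all others, are treated by one
    rescaled equation with parameters s and s1 subject to s s1 = e^2. Divisibility in O replaces
    estimates: a critical point at an unknown scale s is studied after division by the largest of e,
    s, s1. The Hessian determinants at the nodes are infinitesimal, but being nonzero in O is all
    that the passage to the terms of a sequence requires. *)

Lemma mpoly_gen_ind n (R : comNzRingType) (P : {mpoly R[n]} -> Prop) :
  (forall c, P c%:MP) -> (forall i, P 'X_i) ->
  (forall p q, P p -> P q -> P (p + q)) ->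
  (forall p q, P p -> P q -> P (p * q)) -> forall p, P p.
Proof.
move=> PC PX PD PM p; rewrite [p]mpolyE.
apply: (big_ind P) => [|//|m _]; first by rewrite -mpolyC0.
rewrite -mul_mpolyC; apply: (PM) => //; rewrite mpolyXE_id.
apply: (big_ind P) => [|*|i _]; [by rewrite -mpolyC1|exact: PM|].
elim: (m i) => [|k IH]; first by rewrite expr0 -mpolyC1.
by rewrite exprS; apply: PM.
Qed.

Section Morphisms.
Variables (n : nat) (R S : comNzRingType) (f : {rmorphism R -> S}).

Lemma map_mpolyXU i : map_mpoly f ('X_i : {mpoly R[n]}) = 'X_i.
Proof. exact: map_mpolyX. Qed.

Lemma map_mpolyCr (c : R) : map_mpoly f (c%:MP : {mpoly R[n]}) = (f c)%:MP.
Proof. exact: map_mpolyC. Qed.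

Lemma map_meval (p : {mpoly R[n]}) (v : 'I_n -> R) :
  (map_mpoly f p).@[f \o v] = f p.@[v].
Proof.
elim/mpoly_gen_ind: p => [c|i|p q IHp IHq|p q IHp IHq].
- by rewrite map_mpolyC !mevalC.
- by rewrite map_mpolyXU !mevalXU.
- by rewrite rmorphD !mevalD rmorphD IHp IHq.
- by rewrite rmorphM !mevalM rmorphM IHp IHq.
Qed.

Lemma map_mderiv (p : {mpoly R[n]}) i :
  (map_mpoly f p)^`M(i) = map_mpoly f p^`M(i).
Proof.
apply/mpolyP => m.
by rewrite mcoeff_deriv !mcoeff_map_mpoly mcoeff_deriv raddfMn.
Qed.

End Morphisms.

Lemma comp_mpoly_tnth n k (R : comNzRingType) (t : n.-tuple {mpoly R[k]}) i :
  'X_i \mPo t = tnth t i.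
Proof. by rewrite comp_mpolyXU -tnth_nth. Qed.

Lemma map_comp_mpoly n k (R S : comNzRingType) (f : {rmorphism R -> S})
  (p : {mpoly R[n]}) (t : n.-tuple {mpoly R[k]}) :
  map_mpoly f (p \mPo t)
  = map_mpoly f p \mPo [tuple map_mpoly f (tnth t i) | i < n].
Proof.
elim/mpoly_gen_ind: p => [c|i|p q IHp IHq|p q IHp IHq].
- by rewrite comp_mpolyC !map_mpolyC comp_mpolyC.
- by rewrite map_mpolyXU !comp_mpoly_tnth tnth_mktuple.
- by rewrite !rmorphD /= IHp IHq.
- by rewrite !rmorphM /= IHp IHq.
Qed.

Lemma comp_mpolyA n k l (R : comNzRingType)
  (p : {mpoly R[n]}) (t : n.-tuple {mpoly R[k]}) (u : k.-tuple {mpoly R[l]}) :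
  (p \mPo t) \mPo u = p \mPo [tuple tnth t i \mPo u | i < n].
Proof.
elim/mpoly_gen_ind: p => [c|i|p q IHp IHq|p q IHp IHq].
- by rewrite !comp_mpolyC.
- by rewrite !comp_mpoly_tnth tnth_mktuple.
- by rewrite !comp_mpolyD IHp IHq.
- by rewrite !rmorphM /= IHp IHq.
Qed.

Lemma mderivXU n (R : comNzRingType) (i j : 'I_n) :
  ('X_i : {mpoly R[n]})^`M(j) = (i == j)%:R.
Proof.
rewrite mderivX mnm1E; case: eqVneq => [->|_]; last by rewrite scale0r.
by rewrite -{1}[U_(j)%MM]add0m addmK scale1r mpolyX0.
Qed.

Lemma mderiv_comp n k (R : comNzRingType) (p : {mpoly R[n]})
    (t : n.-tuple {mpoly R[k]}) i :
  (p \mPo t)^`M(i) = \sum_j (p^`M(j) \mPo t) * (tnth t j)^`M(i).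
Proof.
elim/mpoly_gen_ind: p => [c|a|p q IHp IHq|p q IHp IHq].
- rewrite comp_mpolyC mderivC big1 // => j _.
  by rewrite mderivC comp_mpoly0 mul0r.
- rewrite comp_mpoly_tnth (bigD1 a) //= mderivXU eqxx rmorph1 mul1r big1 ?addr0 //.
  by move=> j ja; rewrite mderivXU eq_sym (negPf ja) rmorph0 mul0r.
- rewrite comp_mpolyD mderivD IHp IHq -big_split /=; apply: eq_bigr => j _.
  by rewrite mderivD comp_mpolyD mulrDl.
- rewrite rmorphM /= mderivM IHp IHq mulr_suml mulr_sumr -big_split /=.
  apply: eq_bigr => j _; rewrite mderivM comp_mpolyD !rmorphM /=; ring.
Qed.

Lemma meval_homog n (R : comNzRingType) d (p : {mpoly R[n]}) c v :
  p \is d.-homog -> p.@[fun i => c * v i] = c ^+ d * p.@[v].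
Proof.
move=> /dhomogP hp; rewrite !mevalE mulr_sumr big_seq [RHS]big_seq.
apply: eq_bigr => m mp; have <- : mdeg m = d by exact: hp.
rewrite mulrCA; congr (_ * _); rewrite mdegE -prodrXr -big_split /=.
by apply: eq_bigr => i _; rewrite exprMn.
Qed.

Lemma euler_homog n (R : comNzRingType) d (p : {mpoly R[n]}) v :
  p \is d.-homog -> \sum_i v i * p^`M(i).@[v] = d%:R * p.@[v].
Proof.
move=> /dhomogP hp; rewrite [p]mpolyE (raddf_sum (meval v)) /= mulr_sumr.
under eq_bigr => i _ do
  rewrite (raddf_sum (mderiv i)) (raddf_sum (meval v)) mulr_sumr.
rewrite exchange_big /= big_seq [RHS]big_seq; apply: eq_bigr => m mp.
have <- : mdeg m = d by exact: hp.
rewrite mdegE natr_sum mulr_suml; apply: eq_bigr => i _.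
rewrite mderivZ !mevalZ mderivX mevalZ [LHS]mulrCA [RHS]mulrCA.
congr (_ * _); rewrite mulrCA; case: (posnP (m i)) => [->|mi]; first by rewrite !mul0r.
congr (_ * _); rewrite -(mevalXU v i) -mevalM -mpolyXD addmC submK //.
by rewrite lep1mP -lt0n.
Qed.

(** The identity p(u) q(u) - p(v) q(v) = (p(u) - p(v)) q(u) + p(v) (q(u) - q(v)) carries the
    quotients [m] through products. Applied to first derivatives at two critical points, it yields
    an exact linear system for their difference, whose matrix specializes to a Hessian. *)
Lemma taylor1 n (R S : comNzRingType) (f : {rmorphism R -> S})
    (p : {mpoly R[n]}) (u v : 'I_n -> R) :
  (forall i, f (u i) = f (v i)) ->
  exists2 m : 'I_n -> R, p.@[u] - p.@[v] = \sum_i (u i - v i) * m i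
    & forall i, f (m i) = f (p^`M(i).@[v]).
Proof.
move=> fuv; elim/mpoly_gen_ind: p => [c|a|p q [mp Dp Hp] [mq Dq Hq]|
                                      p q [mp Dp Hp] [mq Dq Hq]].
- exists (fun=> 0) => [|i]; last by rewrite mderivC meval0.
  by rewrite !mevalC subrr big1 // => i _; rewrite mulr0.
- exists (fun i => (a == i)%:R) => [|i]; last first.
    by rewrite mderivXU !rmorph_nat.
  rewrite !mevalXU (bigD1 a) //= eqxx mulr1 big1 ?addr0 // => i ia.
  by rewrite eq_sym (negPf ia) mulr0.
- exists (fun i => mp i + mq i) => [|i]; last first.
    by rewrite mderivD mevalD !rmorphD Hp Hq.
  rewrite !mevalD opprD addrACA Dp Dq -big_split /=.
  by apply: eq_bigr => i _; rewrite mulrDr.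
- exists (fun i => mp i * q.@[u] + p.@[v] * mq i) => [|i]; last first.
    rewrite mderivM mevalD !mevalM !rmorphD !rmorphM Hp Hq; congr (_ * _ + _).
    rewrite -!map_meval; apply: meval_eq => j; exact: fuv.
  rewrite !mevalM.
  have ->: p.@[u] * q.@[u] - p.@[v] * q.@[v]
     = (p.@[u] - p.@[v]) * q.@[u] + p.@[v] * (q.@[u] - q.@[v]) by ring.
  rewrite Dp Dq mulr_suml mulr_sumr -big_split /=; apply: eq_bigr => i _; ring.
Qed.

(** * The model polynomials *)

Notation o0 := (@Ordinal 3 0 isT).
Notation o1 := (@Ordinal 3 1 isT).
Notation o2 := (@Ordinal 3 2 isT).

Lemma I3P (a : 'I_3) : [\/ a = o0, a = o1 | a = o2].
Proof.
by case: a => [[|[|[|//]]] ?]; [apply: Or31|apply: Or32|apply: Or33]; apply: val_inj.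
Qed.

Lemma sum3 (V : nmodType) (h : 'I_3 -> V) : \sum_i h i = h o0 + h o1 + h o2.
Proof.
rewrite !big_ord_recl big_ord0 addr0 addrA.
by congr (h _ + h _ + h _); apply: val_inj.
Qed.

Lemma prod3 (R : comNzRingType) (h : 'I_3 -> R) : \prod_i h i = h o0 * h o1 * h o2.
Proof.
rewrite !big_ord_recl big_ord0 mulr1 mulrA.
by congr (h _ * h _ * h _); apply: val_inj.
Qed.

Lemma i3E : ((o0 == o1) = false) * ((o0 == o2) = false) * ((o1 == o0) = false) *
  ((o1 == o2) = false) * ((o2 == o0) = false) * ((o2 == o1) = false).
Proof. by []. Qed.

(** The remaining index when [a] and [b] differ; on the diagonal the value is arbitrary. *)
Definition third (a b : 'I_3) : 'I_3 :=
  if (a == o0) || (b == o0) then (if (a == o1) || (b == o1) then o2 else o1)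
  else o0.

Lemma mderiv1 n (R : nzRingType) (d : 'I_n) : (1 : {mpoly R[n]})^`M(d) = 0.
Proof. by rewrite -mpolyC1 mderivC. Qed.

Lemma comp_mpolyM n k (R : comNzRingType) (t : n.-tuple {mpoly R[k]}) :
  {morph comp_mpoly t : p q / p * q}.
Proof. exact: rmorphM. Qed.

Section Models.
Variable R : comNzRingType.
Local Notation poly3 := {mpoly R[3]}.
Implicit Types (s e : R) (a b : 'I_3).

Definition sumsq : poly3 := \sum_a 'X_a * 'X_a.
Definition cofac a : poly3 := \prod_b (if b == a then 1 else 'X_b).
Definition xyz : poly3 := \prod_a 'X_a.

(* Surface with nodes at s * sgn o, where sgn is defined below. *)
Definition cay s : poly3 := - (xyz *+ 2) + s%:MP * sumsq - (s * s * s)%:MP.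

(* phi and quart are the monomials X_a ^ 3 and X_a ^ 3 * X_b, corrected by lower
   ones so as to be singular at the nodes of cay s. *)
Definition phi s a : poly3 :=
  ('X_a * 'X_a * 'X_a) *+ 2 - 'X_a * sumsq + s%:MP * cofac a *+ 2
  - (s * s)%:MP * 'X_a.

Definition quart s a b : poly3 :=
  ('X_a * 'X_a - (s * s)%:MP) *
  (if b == a then 'X_a * 'X_a - (s * s)%:MP
   else 'X_a * 'X_b - s%:MP * 'X_(third a b)).

(* The 16 monomials used to interpolate values and gradients at the nodes of
   cay s, weighted so that herm_scale holds. *)
Definition herm (u : option 'I_3 -> option 'I_3 -> R) s : poly3 :=
  (s * s * s * u None None)%:MP +
  \sum_a ((s * s * u (Some a) None)%:MP * 'X_a +
          (s * u None (Some a))%:MP * ('X_a * 'X_a) +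
          (s * u (Some a) (Some a))%:MP * cofac a +
          \sum_b (if b == a then 0
                  else (u (Some a) (Some b))%:MP * ('X_a * ('X_b * 'X_b)))).

(** The value sits at [None] and the partial derivatives at [Some d], so that the four conditions
    for a singular point form one family and the interpolation problems are square linear
    systems. *)
Definition jet (p : poly3) (v : 'I_3 -> R) (o : option 'I_3) : R :=
  if o is Some d then p^`M(d).@[v] else p.@[v].

Lemma jetD p q v o : jet (p + q) v o = jet p v o + jet q v o.
Proof. by case: o => [d|] /=; rewrite ?mderivD mevalD. Qed.

Lemma jetN p v o : jet (- p) v o = - jet p v o.
Proof. by case: o => [d|] /=; rewrite ?mderivN mevalN. Qed.

Lemma jetMn p k v o : jet (p *+ k) v o = jet p v o *+ k.
Proof. by case: o => [d|] /=; rewrite ?mderivMn mevalMn. Qed.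

Lemma jetCM c p v o : jet (c%:MP * p) v o = c * jet p v o.
Proof. by case: o => [d|] /=; rewrite ?mderiv_mulC mevalM mevalC. Qed.

Lemma jet_sum (I : finType) (F : I -> poly3) v o :
  jet (\sum_i F i) v o = \sum_i jet (F i) v o.
Proof.
by case: o => [d|] /=; rewrite ?(raddf_sum (mderiv d)) (raddf_sum (meval v)).
Qed.

Lemma jet_eq p v1 v2 o : v1 =1 v2 -> jet p v1 o = jet p v2 o.
Proof. by move=> ev; case: o => [d|] /=; apply: meval_eq. Qed.

Definition scale_by s : 3.-tuple poly3 := [tuple s%:MP * 'X_a | a < 3].

Lemma scale_byX s a : 'X_a \mPo scale_by s = s%:MP * 'X_a.
Proof. by rewrite comp_mpoly_tnth tnth_mktuple. Qed.

Lemma scale_by_eval p s v : (p \mPo scale_by s).@[v] = p.@[fun a => s * v a].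
Proof.
rewrite comp_mpoly_meval; apply: meval_eq => a.
by rewrite tnth_mktuple mevalM mevalC mevalXU.
Qed.

Lemma scale_by_deriv p s d :
  (p \mPo scale_by s)^`M(d) = s%:MP * (p^`M(d) \mPo scale_by s).
Proof.
rewrite mderiv_comp (bigD1 d) //= tnth_mktuple mderiv_mulC mderivXU eqxx mulr1.
rewrite mulrC big1 ?addr0 // => a ad.
by rewrite tnth_mktuple mderiv_mulC mderivXU (negPf ad) !mulr0.
Qed.

Definition compE := (scale_byX, comp_mpolyC, comp_mpolyD, comp_mpolyB,
  comp_mpolyN, comp_mpolyM, comp_mpolyMn, comp_mpoly0, comp_mpoly1).

Lemma sumsq_scale s : sumsq \mPo scale_by s = (s * s)%:MP * sumsq.
Proof. by rewrite /sumsq !sum3 !compE /=; ring. Qed.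

Lemma xyz_scale s : xyz \mPo scale_by s = (s * s * s)%:MP * xyz.
Proof. by rewrite /xyz !prod3 !compE /=; ring. Qed.

Lemma cofac_scale s a : cofac a \mPo scale_by s = (s * s)%:MP * cofac a.
Proof.
rewrite /cofac !prod3.
by case: (I3P a) => ->; rewrite !eqxx !i3E !compE /=; ring.
Qed.

Lemma phi_scale s s1 a :
  phi (s * s1) a \mPo scale_by s = (s * s * s)%:MP * phi s1 a.
Proof. by rewrite /phi !compE sumsq_scale cofac_scale; ring. Qed.

Lemma quart_scale s s1 a b :
  quart (s * s1) a b \mPo scale_by s = (s * s * s * s)%:MP * quart s1 a b.
Proof. by rewrite /quart; case: ifP => _; rewrite !compE /=; ring. Qed.

Lemma cay_scale s s1 :
  cay (s * s1) \mPo scale_by s = (s * s * s)%:MP * cay s1.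
Proof. by rewrite /cay !compE sumsq_scale xyz_scale; ring. Qed.

Lemma herm_scale u s s1 :
  herm u (s * s1) \mPo scale_by s = (s * s * s)%:MP * herm u s1.
Proof.
rewrite /herm comp_mpolyD raddf_sum /= mulrDr mulr_sumr; congr (_ + _).
  by rewrite !compE; ring.
apply: eq_bigr => a _; rewrite !compE cofac_scale raddf_sum mulrDr mulr_sumr /=.
congr (_ + _); first by ring.
by apply: eq_bigr => b _; case: ifP => _; rewrite !compE /=; ring.
Qed.

End Models.
Arguments jet {R} p v o.

Definition evalE := (mevalD, mevalB, mevalN, mevalM, mevalMn, mevalC,
  mevalXU, meval0, meval1).

Section Derivatives.
Variable R : comNzRingType.
Implicit Types (s : R) (a b d : 'I_3) (v : 'I_3 -> R).

Lemma thirdC a b : third a b = third b a.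
Proof. by case: (I3P a) => ->; case: (I3P b) => ->. Qed.

Lemma sumsq_eval v : (sumsq R).@[v] = v o0 ^+ 2 + v o1 ^+ 2 + v o2 ^+ 2.
Proof. by rewrite /sumsq sum3 !evalE !expr2. Qed.

Lemma sumsq_deriv d : (sumsq R)^`M(d) = 'X_d *+ 2.
Proof.
rewrite /sumsq sum3 !mderivD !mderivM !mderivXU.
by case: (I3P d) => ->; rewrite !eqxx !i3E /=; ring.
Qed.

Lemma cofac_deriv a d :
  (cofac R a)^`M(d) = if d == a then 0 else 'X_(third a d).
Proof.
rewrite /cofac prod3; case: (I3P a) => ->; case: (I3P d) => ->;
  rewrite ?eqxx ?i3E ?(mul1r, mulr1) !(mderivM, mderivXU) ?i3E ?eqxx
    ?(mul0r, mulr0, add0r, addr0, mul1r, mulr1) //;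
  by congr ('X_ _); apply: val_inj.
Qed.

Lemma xyz_deriv d : (xyz R)^`M(d) = cofac R d.
Proof.
rewrite /xyz /cofac !prod3 !mderivM !mderivXU.
by case: (I3P d) => ->; rewrite !eqxx !i3E /=; ring.
Qed.

Lemma xyz_eval v : (xyz R).@[v] = v o0 * v o1 * v o2.
Proof. by rewrite /xyz prod3 !evalE. Qed.

Lemma cofac_eval a v : (cofac R a).@[v] = \prod_b (if b == a then 1 else v b).
Proof.
rewrite /cofac rmorph_prod; apply: eq_bigr => b _.
by case: eqP => _ /=; rewrite ?meval1 ?mevalXU.
Qed.

Lemma cay_deriv s d :
  (cay s)^`M(d) = - (cofac R d *+ 2) + s%:MP * ('X_d *+ 2).
Proof.
by rewrite /cay mderivB mderivD mderivN mderivMn xyz_deriv mderiv_mulC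
  sumsq_deriv mderivC subr0.
Qed.

Lemma phi_deriv s a d : (phi s a)^`M(d) =
  (if d == a then ('X_a * 'X_a) *+ 6 - sumsq R - (s * s)%:MP
   else s%:MP * 'X_(third a d) *+ 2) - 'X_a * 'X_d *+ 2.
Proof.
rewrite /phi !(mderivB, mderivD, mderivMn, mderivM, mderivC, mderivXU).
rewrite sumsq_deriv cofac_deriv eq_sym; case: eqP => [->|_] /=; ring.
Qed.

End Derivatives.

(** * Values and gradients at the nodes of the Cayley cubic *)

Section Sign.
Variable R : comNzRingType.
Implicit Types (a b : 'I_3) (o : option 'I_3).

(* The four nodes of the affine Cayley cubic. *)
Definition sgn o b : R := if o is Some a then (if a == b then 1 else -1) else 1.

Lemma sgn_sqr o b : sgn o b * sgn o b = 1.
Proof. by rewrite /sgn; case: o => [a|]; [case: ifP|] => *; ring. Qed.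

Lemma sgn_third o a b : a != b -> sgn o (third a b) = sgn o a * sgn o b.
Proof.
case: o => [c|] /=; last by rewrite mulr1.
by case: (I3P a) => ->; case: (I3P b) => ->; case: (I3P c) => -> // _;
  rewrite /third /= ?i3E ?eqxx; ring.
Qed.

Lemma cofac_sgn a o : (cofac R a).@[sgn o] = sgn o a.
Proof.
rewrite cofac_eval prod3; case: o => [b|];
  case: (I3P a) => ->; rewrite /sgn ?eqxx ?i3E; try by ring.
all: by case: (I3P b) => ->; rewrite ?eqxx ?i3E; ring.
Qed.

Lemma sumsq_sgn o : (sumsq R).@[sgn o] = 3%:R.
Proof. by rewrite sumsq_eval !expr2 !sgn_sqr; ring. Qed.

Lemma xyz_sgn o : (xyz R).@[sgn o] = 1.
Proof.
by rewrite xyz_eval (_ : o2 = third o0 o1) ?sgn_third // mulrACA !sgn_sqr mulr1.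
Qed.

Lemma jet_cay_sgn o o' : jet (cay (1 : R)) (sgn o) o' = 0.
Proof.
case: o' => [d|] /=; first by rewrite cay_deriv !evalE cofac_sgn; ring.
by rewrite /cay !evalE xyz_sgn sumsq_sgn; ring.
Qed.

Lemma jet_phi_sgn b o o' : jet (phi (1 : R) b) (sgn o) o' = 0.
Proof.
case: o' => [d|] /=.
  rewrite phi_deriv !evalE; case: eqP => [->|/eqP db].
    by rewrite !evalE sumsq_sgn sgn_sqr; ring.
  by rewrite !evalE sgn_third 1?eq_sym //; ring.
by rewrite /phi !evalE sumsq_sgn cofac_sgn sgn_sqr; ring.
Qed.

(** Both factors of [quart] vanish at the four sign vectors, so their product is singular there. *)
Lemma jet_quart_sgn b c o o' : jet (quart (1 : R) b c) (sgn o) o' = 0.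
Proof.
have h1 : ('X_b * 'X_b - (1 * 1)%:MP : {mpoly R[3]}).@[sgn o] = 0.
  by rewrite !evalE sgn_sqr mulr1 subrr.
rewrite /quart; set p := (X in _ * X).
have h2 : p.@[sgn o] = 0.
  rewrite /p; case: eqP => [_ //|/eqP cb].
  by rewrite !evalE sgn_third 1?eq_sym // mul1r subrr.
case: o' => [d|] /=; first by rewrite mderivM mevalD !mevalM h1 h2 mulr0 mul0r addr0.
by rewrite mevalM h1 mul0r.
Qed.

Lemma herm_sgn u o : (herm u 1).@[sgn o] = u None None +
  \sum_a ((u (Some a) None + u (Some a) (Some a)) * sgn o a + u None (Some a)
          + \sum_b (if b == a then 0 else u (Some a) (Some b) * sgn o a)).
Proof.
rewrite /herm mevalD mevalC !mul1r; congr (_ + _).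
rewrite (raddf_sum (meval _)); apply: eq_bigr => a _.
rewrite /= mevalD (raddf_sum (meval _)); congr (_ + _).
  by rewrite !evalE cofac_sgn sgn_sqr; ring.
apply: eq_bigr => b _ /=; case: ifP => _; first exact: meval0.
by rewrite !evalE sgn_sqr mulr1.
Qed.

Lemma herm_deriv_sgn u o d : (herm u 1)^`M(d).@[sgn o] =
  \sum_a (if a == d
          then u (Some d) None + u None (Some d) * sgn o d *+ 2 +
               \sum_b (if b == d then 0 else u (Some d) (Some b))
          else (u (Some a) (Some a) + u (Some a) (Some d) *+ 2) *
               (sgn o a * sgn o d)).
Proof.
rewrite /herm mderivD mderivC add0r (raddf_sum (mderiv d)) (raddf_sum (meval _)).
apply: eq_bigr => a _ /=.
rewrite !mderivD !mderiv_mulC mderivM mderivXU cofac_deriv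
  (raddf_sum (mderiv d)) !mevalD (raddf_sum (meval _)) /=.
case: (eqVneq a d) => [->|ad].
  rewrite !evalE; congr (_ + _); first by rewrite /=; ring.
  apply: eq_bigr => b _ /=; case: eqP => [_|/eqP bd]; first by rewrite mderiv0 meval0.
  by rewrite !mderivM mderivC !mderivXU eqxx (negPf bd) !evalE /= sgn_sqr; ring.
rewrite !evalE sgn_third // (bigD1 d) //= eq_sym (negPf ad) big1.
  by rewrite !mderivM mderivC !mderivXU eqxx (negPf ad) !evalE /=; ring.
move=> b bd; case: eqP => _; first by rewrite mderiv0 meval0.
by rewrite !mderivM mderivC !mderivXU (negPf bd) (negPf ad) !evalE /=; ring.
Qed.

(* Splitting functions on the four nodes into characters of the group of sign
   changes reduces the 16 interpolation conditions to four 4x4 systems. *)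
Lemma hermite_interpolation (t : option 'I_3 -> option 'I_3 -> R) (c : R) :
  c * 8%:R = 1 ->
  exists u, forall o o', jet (herm u 1) (sgn o) o' = t o o'.
Proof.
move=> c8.
(* Multiplication by [c] = 1/8 averages over the four nodes and halves. For each [a], the component
   of the values along the character [sgn _ a], minus the mean of the [a]-derivatives, is the
   coefficient of [cofac a]; the other coefficients follow by substitution. *)
pose sum4 (h : option 'I_3 -> R) :=
  h None + h (Some o0) + h (Some o1) + h (Some o2).
pose v0 := sum4 (fun o => c * t o None).
pose d0 a := sum4 (fun o => c * sgn o a * t o (Some a)).
pose v a := sum4 (fun o => c * sgn o a * t o None).
pose d a b := sum4 (fun o => c * sgn o a * sgn o b * t o (Some b)).
pose q a := (v a - d a a) *+ 2.
pose r a b := d a b - (v a - d a a).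
pose u (o o' : option 'I_3) : R := match o, o' with
  | None, None => v0 *+ 2 - (d0 o0 + d0 o1 + d0 o2)
  | None, Some a => d0 a
  | Some a, None => d a a *+ 2 - \sum_b (if b == a then 0 else r a b)
  | Some a, Some b => if a == b then q a else r a b end.
exists u => o o'; have -> : t o o' = c * 8%:R * t o o' by rewrite c8 mul1r.
case: o' => [d'|]; rewrite /jet.
  rewrite herm_deriv_sgn; case: (I3P d') => ->;
  (case: o => [a|]; first case: (I3P a) => ->); rewrite !sum3 ?eqxx ?i3E
    /u /q /r /v0 /d0 /v /d /sum4
    ?sum3 /sgn ?i3E ?eqxx /=; ring.
rewrite herm_sgn.
  (case: o => [a|]; first case: (I3P a) => ->); rewrite !sum3 ?eqxx ?i3E
    /u /q /r /v0 /d0 /v /d /sum4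
    ?sum3 /sgn ?i3E ?eqxx /=; ring.
Qed.

End Sign.

Section MapModels.
Variables (R S : comNzRingType) (f : {rmorphism R -> S}).

Lemma map_sumsq : map_mpoly f (sumsq R) = sumsq S.
Proof.
by rewrite rmorph_sum; apply: eq_bigr => a _; rewrite rmorphM /= map_mpolyXU.
Qed.

Lemma map_cofac a : map_mpoly f (cofac R a) = cofac S a.
Proof.
rewrite rmorph_prod; apply: eq_bigr => b _.
by case: eqP => _; rewrite ?rmorph1 //= map_mpolyXU.
Qed.

Lemma map_xyz : map_mpoly f (xyz R) = xyz S.
Proof. by rewrite rmorph_prod; apply: eq_bigr => b _; rewrite /= map_mpolyXU. Qed.

Lemma map_cay s : map_mpoly f (cay s) = cay (f s).
Proof.
rewrite /cay rmorphB rmorphD rmorphN rmorphMn rmorphM /= map_sumsq map_xyz.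
by rewrite !map_mpolyCr !(rmorphM f).
Qed.

Lemma map_phi s a : map_mpoly f (phi s a) = phi (f s) a.
Proof.
rewrite /phi !(rmorphB, rmorphD, rmorphMn, rmorphM) /= map_sumsq map_cofac.
by rewrite !map_mpolyXU !map_mpolyCr ?(rmorphM f).
Qed.

Lemma map_quart s a b : map_mpoly f (quart s a b) = quart (f s) a b.
Proof.
rewrite /quart rmorphM; case: ifP => _;
by rewrite !(rmorphB, rmorphM) /= !map_mpolyXU !map_mpolyCr ?(rmorphM f).
Qed.

Lemma map_jet (p : {mpoly R[3]}) v o :
  jet (map_mpoly f p) (fun i => f (v i)) o = f (jet p v o).
Proof. by case: o => [d|] /=; rewrite ?map_mderiv; exact: map_meval. Qed.

End MapModels.

(** * The correction terms at the coordinate points, modulo e *)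

Section UnitVector.
Variable R : comNzRingType.

Definition evec (a b : 'I_3) : R := (b == a)%:R.

Lemma sumsq_evec a : (sumsq R).@[evec a] = 1.
Proof.
by rewrite sumsq_eval /evec; case: (I3P a) => ->; rewrite !i3E ?eqxx /=; ring.
Qed.

(** With [jet_quart_evec], this is the matrix modulo e of the twelve conditions at the axis nodes.
    The entry -1 is the only interaction between different axes; it comes from the term -X_b X_a^2
    of [phi 0 b]. *)
Lemma jet_phi_evec a b o : jet (phi (0 : R) b) (evec a) o =
  if b == a then (if o is Some d then (if d == a then 3%:R else 0) else 1)
  else if o == Some b then -1 else 0.
Proof.
case: o => [d|] /=.
  rewrite phi_deriv !mevalB mul0r mpolyC0; case: (eqVneq d b) => [<-|db].
    rewrite !evalE sumsq_evec eqxx /evec; case: (d == a) => /=; ring.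
  have -> : (Some d == Some b) = false by apply/eqP => -[] /eqP; rewrite (negPf db).
  rewrite mul0r mul0rn !evalE /evec; case: (eqVneq b a) => [<-|ba].
    by rewrite (negPf db) /=; ring.
  by rewrite /=; ring.
rewrite /phi (mul0r (0 : R)) !mpolyC0 !evalE sumsq_evec /evec; case: (b == a) => /=; ring.
Qed.

Lemma jet_quart_evec a b c o : jet (quart (0 : R) b c) (evec a) o =
  if b == a then (if o is Some d then
     (if d == a then (if c == a then 4%:R else 0) else (c == d)%:R)
     else (c == a)%:R)
  else 0.
Proof.
have -> : quart (0 : R) b c = ('X_b * 'X_b) * ('X_b * 'X_c).
  rewrite /quart mul0r mpolyC0 subr0 mul0r subr0.
  by case: eqP => [->|].
case: o => [d|] /=.
  rewrite !mderivM !mderivXU !evalE /evec.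
  case: (eqVneq b a) => [->|ba] /=; last by ring.
  rewrite [a == d]eq_sym; case: (eqVneq d a) => [->|da] /=.
    by case: (c == a) => /=; ring.
  by ring.
by rewrite !evalE /evec; case: (b == a) => /=; ring.
Qed.

End UnitVector.

(* O is a valuation ring with residue map st, and cst is a section of st; sp_val
   says that of any two elements one divides the other. *)
Record specialization (K : fieldType) (O : comNzRingType)
    (st : {rmorphism O -> K}) (cst : {rmorphism K -> O}) : Prop := Specialization {
  sp_cst : forall a, st (cst a) = a;
  sp_dom : forall x y : O, x * y = 0 -> x = 0 \/ y = 0;
  sp_val : forall x y : O, (exists z, y = x * z) \/ (exists z, x = y * z);
  sp_unit : forall x : O, st x != 0 -> exists y, x * y = 1 }.

(** * Linear systems and divisibility in a valuation ring *)

Section Specialization.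
Variables (K : fieldType) (O : comNzRingType).
Variables (st : {rmorphism O -> K}) (cst : {rmorphism K -> O}).
Hypothesis sp : specialization st cst.

(** Injectivity over the residue field makes the determinant a unit of [O], and the adjugate matrix
    then gives the solution. *)
Lemma sp_solve (J : finType) (A : J -> J -> O) (c : J -> O) :
  (forall v : J -> K, (forall i, \sum_j st (A i j) * v j = 0) ->
                      forall j, v j = 0) ->
  exists w, forall i, \sum_j A i j * w j = c i.
Proof.
move=> inj.
pose M := \matrix_(i < #|J|, j < #|J|) A (enum_val i) (enum_val j).
have detM : st (\det M) != 0.
  rewrite -det_map_mx -det_tr; apply/det0P => -[v v0 vM].
  case/eqP: v0; apply/rowP => k; rewrite mxE.
  rewrite -[k]enum_valK; apply: (inj (fun j => v 0 (enum_rank j))) => i.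
  have /rowP /(_ (enum_rank i)) := vM; rewrite !mxE => E; rewrite -[RHS]E.
  rewrite (reindex (@enum_val J predT)) /=; last first.
    by apply: onW_bij; exists enum_rank; [apply: enum_valK|apply: enum_rankK].
  by apply: eq_bigr => j _; rewrite !mxE enum_valK enum_rankK mulrC.
have [y My] := sp_unit sp detM.
pose C := \col_(i < #|J|) c (enum_val i).
pose W := y *: (\adj M *m C).
have MW : M *m W = C.
  by rewrite -scalemxAr mulmxA mul_mx_adj mul_scalar_mx scalerA mulrC My scale1r.
exists (fun j => W (enum_rank j) 0) => i.
have /colP /(_ (enum_rank i)) := MW; rewrite !mxE enum_rankK => <-.
rewrite (reindex (@enum_val J predT)) /=; last first.
  by apply: onW_bij; exists enum_rank; [apply: enum_valK|apply: enum_rankK].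
by apply: eq_bigr => j _; rewrite [M _ _]mxE enum_rankK enum_valK.
Qed.

Lemma sp_cancel (x y z : O) : x != 0 -> x * y = x * z -> y = z.
Proof.
move=> x0 /eqP; rewrite -subr_eq0 -mulrBr => /eqP /(sp_dom sp) [].
  by move/eqP: x0.
by move/eqP; rewrite subr_eq0 => /eqP.
Qed.

Lemma sp_mul_neq0 (x y : O) : x != 0 -> y != 0 -> x * y != 0.
Proof. by move=> x0 y0; apply/eqP => /(sp_dom sp) [] /eqP; apply/negP. Qed.

Lemma sp_unit_eq0 (x y : O) : st x != 0 -> x * y = 0 -> y = 0.
Proof.
move=> /(sp_unit sp) [z xz] xy0.
by rewrite -[y]mul1r -xz mulrAC xy0 mul0r.
Qed.

Lemma sp_inv (x : O) : st x != 0 -> exists y, x * y = 1 /\ st y = (st x)^-1.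
Proof.
move=> x0; have [y xy] := sp_unit sp x0; exists y; split=> //.
have := congr1 st xy; rewrite rmorphM rmorph1 => E.
by rewrite -[RHS]mulr1 -E mulrA mulVf ?mul1r.
Qed.

(** The maximum for size, hence a common divisor. One of the quotients is exactly 1, which prevents
    the three specialized quotients from all being zero. *)
Lemma sp_max3 (x y z : O) : exists m x' y' z' : O,
  [/\ x = m * x', y = m * y', z = m * z',
      [|| x' == 1, y' == 1 | z' == 1] & [|| m == x, m == y | m == z]].
Proof.
have step (p q : O) : exists m p' q' : O, [/\ p = m * p', q = m * q',
    (p' == 1) || (q' == 1) & (m == p) || (m == q)].
  case: (sp_val sp p q) => -[t ht].
    by exists p, 1, t; rewrite mulr1 !eqxx.
  by exists q, t, 1; rewrite mulr1 !eqxx !orbT.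
have [m [x' [y' [hx hy h1 hm]]]] := step x y.
case: (sp_val sp m z) => -[t ht].
  exists m, x', y', t; split => //; first by rewrite orbA h1.
  by rewrite orbA hm.
exists z, (t * x'), (t * y'), 1; rewrite mulr1 !eqxx !orbT; split => //.
  by rewrite mulrA -ht.
by rewrite mulrA -ht.
Qed.

(** Projective normalization over a valuation ring: division by a coordinate of least valuation. *)
Lemma sp_divides_all (x : 'I_3 -> O) : exists a v, v a = 1 /\ forall i, x i = x a * v i.
Proof.
have [m [x' [y' [z' [h0 h1 h2 one hm]]]]] := sp_max3 (x o0) (x o1) (x o2).
pose v i := if i == o0 then x' else if i == o1 then y' else z'.
have hv i : x i = m * v i by case: (I3P i) => ->.
have [a va] : exists a, v a = 1.
  by case/or3P: one => /eqP E; [exists o0|exists o1|exists o2].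
by exists a, v; split=> // i; rewrite [x a]hv va mulr1.
Qed.

End Specialization.

Lemma meval_diff n (R : comNzRingType) (p : {mpoly R[n]}) (u v : 'I_n -> R) e :
  (forall i, exists c, u i - v i = e * c) -> exists c, p.@[u] - p.@[v] = e * c.
Proof.
move=> uv; elim/mpoly_gen_ind: p => [c|a|p q [c Hc] [d Hd]|p q [c Hc] [d Hd]].
- by exists 0; rewrite !mevalC subrr mulr0.
- by rewrite !mevalXU.
- by exists (c + d); rewrite !mevalD mulrDr -Hc -Hd; ring.
- exists (c * q.@[u] + p.@[v] * d).
  rewrite !mevalM mulrDr mulrA -Hc mulrCA -Hd; ring.
Qed.

Lemma scale_by_low d (R : comNzRingType) (p : {mpoly R[3]}) (s : R) :
  (forall m : 'X_{1..3}, (mdeg m < d)%N -> p@_m = 0) ->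
  exists r, p \mPo scale_by s = (s ^+ d)%:MP * r.
Proof.
move=> low.
exists (\sum_(m <- msupp p) (p@_m * s ^+ (mdeg m - d)) *: 'X_[m]).
rewrite comp_mpolyEX mulr_sumr big_seq [RHS]big_seq; apply: eq_bigr => m mp.
have dm : (d <= mdeg m)%N.
  by rewrite leqNgt; apply: contraL mp => /low h; rewrite mcoeff_msupp h eqxx.
rewrite mul_mpolyC scalerA mulrCA -exprD subnKC // -scalerA; congr (_ *: _).
rewrite comp_mpolyX mpolyXE_id mdegE -prodrXr -mul_mpolyC rmorph_prod /= -big_split.
by apply: eq_bigr => i _; rewrite tnth_mktuple exprMn rmorphXn.
Qed.

Lemma det2 (R : comNzRingType) (M : 'M[R]_2) :
  \det M = M ord0 ord0 * M ord_max ord_max - M ord0 ord_max * M ord_max ord0.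
Proof.
rewrite (expand_det_row _ ord0) !big_ord_recl big_ord0 /cofactor !det_mx11 !mxE.
have -> : lift ord0 (ord0 : 'I_1) = ord_max by apply: val_inj.
have -> : lift (ord_max : 'I_2) ord0 = ord0 by apply: val_inj.
by rewrite /= /bump /=; ring.
Qed.

Lemma det3 (R : comNzRingType) (M : 'M[R]_3) : \det M =
  M o0 o0 * (M o1 o1 * M o2 o2 - M o1 o2 * M o2 o1)
  - M o0 o1 * (M o1 o0 * M o2 o2 - M o1 o2 * M o2 o0)
  + M o0 o2 * (M o1 o0 * M o2 o1 - M o1 o1 * M o2 o0).
Proof.
rewrite (expand_det_row _ o0) sum3 /cofactor !det2 !mxE /=.
have l00 : lift o0 (ord0 : 'I_2) = o1 by apply: val_inj.
have l01 : lift o0 (ord_max : 'I_2) = o2 by apply: val_inj.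
have l10 : lift o1 (ord0 : 'I_2) = o0 by apply: val_inj.
have l11 : lift o1 (ord_max : 'I_2) = o2 by apply: val_inj.
have l20 : lift o2 (ord0 : 'I_2) = o0 by apply: val_inj.
have l21 : lift o2 (ord_max : 'I_2) = o1 by apply: val_inj.
by rewrite l00 l01 l10 l11 l20 l21 /=; ring.
Qed.

Definition distinct3 (a b c : 'I_3) := [&& a != b, a != c & b != c].

Lemma distinct3_ex a : exists b c, distinct3 a b c.
Proof.
by case: (I3P a) => ->; [exists o1, o2|exists o0, o2|exists o0, o1].
Qed.

Lemma distinct3P a b c : distinct3 a b c ->
  forall i, [\/ i = a, i = b | i = c].
Proof.
move=> h i; suff: [|| i == a, i == b | i == c].
  by case/or3P => /eqP ->; [apply: Or31|apply: Or32|apply: Or33].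
by move: h; case: (I3P a) => ->; case: (I3P b) => ->; case: (I3P c) => ->;
  case: (I3P i) => ->.
Qed.

Lemma distinct3_third a b c : distinct3 a b c -> third a b = c.
Proof.
by case: (I3P a) => ->; case: (I3P b) => ->; case: (I3P c) => ->.
Qed.

Lemma distinct3_xyz (R : comNzRingType) (v : 'I_3 -> R) a b c :
  distinct3 a b c -> (xyz R).@[v] = v a * v b * v c.
Proof.
rewrite xyz_eval.
by case: (I3P a) => ->; case: (I3P b) => ->; case: (I3P c) => -> // _; ring.
Qed.

Lemma distinct3_cofac (R : comNzRingType) (v : 'I_3 -> R) a b c :
  distinct3 a b c -> (cofac R a).@[v] = v b * v c.
Proof.
rewrite cofac_eval prod3.
by case: (I3P a) => ->; case: (I3P b) => ->; case: (I3P c) => -> // _;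
  rewrite ?eqxx ?i3E; ring.
Qed.

Lemma distinct3_sum (R : comNzRingType) (h : 'I_3 -> R) a b c :
  distinct3 a b c -> \sum_i h i = h a + h b + h c.
Proof.
rewrite sum3.
by case: (I3P a) => ->; case: (I3P b) => ->; case: (I3P c) => -> // _; ring.
Qed.

Lemma distinct3_det (R : comNzRingType) (M : 'M[R]_3) a b c :
  distinct3 a b c -> \det M =
  M a a * (M b b * M c c - M b c * M c b)
  - M a b * (M b a * M c c - M b c * M c a)
  + M a c * (M b a * M c b - M b b * M c a).
Proof.
rewrite det3.
by case: (I3P a) => ->; case: (I3P b) => ->; case: (I3P c) => -> // _; ring.
Qed.

Lemma distinct3_rot a b c : distinct3 a b c -> distinct3 b c a /\ distinct3 c a b.
Proof.
by case: (I3P a) => ->; case: (I3P b) => ->; case: (I3P c) => ->.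
Qed.

(** The gradient says that each coordinate is the product of the other two, so every square equals
    xyz. The value then reads xyz - 1 = 0, hence the coordinates are signs of product 1. *)
Lemma cayley_critical (K : numFieldType) (v : 'I_3 -> K) :
  (forall o, jet (cay (1 : K)) v o = 0) -> exists o, v =1 sgn K o.
Proof.
move=> h.
have hd d : v d = (cofac K d).@[v].
  have := h (Some d); rewrite /= cay_deriv !evalE => hd.
  have : (2%:R : K) * (v d - (cofac K d).@[v]) = 0 by rewrite -hd; ring.
  by move=> /eqP; rewrite mulf_eq0 pnatr_eq0 /= subr_eq0 => /eqP.
have hx := hd o0; have hy := hd o1; have hz := hd o2.
rewrite (@distinct3_cofac _ _ o0 o1 o2) // in hx.
rewrite (@distinct3_cofac _ _ o1 o0 o2) // in hy.
rewrite (@distinct3_cofac _ _ o2 o0 o1) // in hz.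
have := h None; rewrite /= /cay !evalE xyz_eval sumsq_eval => h0.
have p1 : v o0 * v o1 * v o2 = 1.
  apply/eqP; rewrite -subr_eq0 -[X in _ == X]h0 -subr_eq0; apply/eqP.
  have x2 : v o0 ^+ 2 = v o0 * v o1 * v o2 by rewrite expr2 {2}hx mulrA.
  have y2 : v o1 ^+ 2 = v o0 * v o1 * v o2 by rewrite expr2 {2}hy; ring.
  have z2 : v o2 ^+ 2 = v o0 * v o1 * v o2 by rewrite expr2 {2}hz; ring.
  by rewrite x2 y2 z2; ring.
have sqr1 (x y : K) : x = y -> x * y = 1 -> x = 1 \/ x = -1.
  move=> <- /eqP; rewrite -expr2 sqrf_eq1 => /orP [] /eqP; [left|right]; done.
have := sqr1 _ _ hx; rewrite mulrA p1 => /(_ erefl) vx.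
have := sqr1 _ _ hy; rewrite mulrA [v o1 * v o0]mulrC p1 => /(_ erefl) vy.
have vsgn o : v o0 = sgn K o o0 -> v o1 = sgn K o o1 -> v o2 = sgn K o o2 ->
  exists o, v =1 sgn K o by move=> e0 e1 e2; exists o => i; case: (I3P i) => ->.
case: vx vy => ex [] ey; have ez := hz; rewrite ex ey in ez.
- by apply: (vsgn None); rewrite ?ex ?ey ?ez /=; ring.
- by apply: (vsgn (Some o0)); rewrite ?ex ?ey ?ez /sgn ?i3E ?eqxx; ring.
- by apply: (vsgn (Some o1)); rewrite ?ex ?ey ?ez /sgn ?i3E ?eqxx; ring.
- by apply: (vsgn (Some o2)); rewrite ?ex ?ey ?ez /sgn ?i3E ?eqxx; ring.
Qed.

(** Cramer's rule without division, by explicit combinations of the three equations. In its uses [D]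
    has nonzero specialization, so it can be cancelled. *)
Lemma cramer3 (R : comNzRingType) (a11 a12 a13 a21 a22 a23 a31 a32 a33 x y z : R) :
  a11 * x + a12 * y + a13 * z = 0 -> a21 * x + a22 * y + a23 * z = 0 ->
  a31 * x + a32 * y + a33 * z = 0 ->
  let D := a11 * (a22 * a33 - a23 * a32) - a12 * (a21 * a33 - a23 * a31)
           + a13 * (a21 * a32 - a22 * a31) in
  [/\ D * x = 0, D * y = 0 & D * z = 0].
Proof.
move=> h1 h2 h3 D; split; rewrite /D.
- transitivity ((a22 * a33 - a23 * a32) * (a11 * x + a12 * y + a13 * z)
    - (a12 * a33 - a13 * a32) * (a21 * x + a22 * y + a23 * z)
    + (a12 * a23 - a13 * a22) * (a31 * x + a32 * y + a33 * z)); first by ring.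
  by rewrite h1 h2 h3; ring.
- transitivity ((a11 * a33 - a13 * a31) * (a21 * x + a22 * y + a23 * z)
    - (a21 * a33 - a23 * a31) * (a11 * x + a12 * y + a13 * z)
    - (a11 * a23 - a13 * a21) * (a31 * x + a32 * y + a33 * z)); first by ring.
  by rewrite h1 h2 h3; ring.
- transitivity ((a21 * a32 - a22 * a31) * (a11 * x + a12 * y + a13 * z)
    - (a11 * a32 - a12 * a31) * (a21 * x + a22 * y + a23 * z)
    + (a11 * a22 - a12 * a21) * (a31 * x + a32 * y + a33 * z)); first by ring.
  by rewrite h1 h2 h3; ring.
Qed.

Lemma jet_xyz (R : comNzRingType) (v : 'I_3 -> R) a b c : distinct3 a b c ->
  [/\ jet (xyz R) v None = v a * v b * v c, jet (xyz R) v (Some a) = v b * v c,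
      jet (xyz R) v (Some b) = v a * v c & jet (xyz R) v (Some c) = v a * v b].
Proof.
move=> abc; have [bca cab] := distinct3_rot abc.
rewrite /jet !xyz_deriv (distinct3_xyz _ abc) (distinct3_cofac _ abc).
by rewrite (distinct3_cofac _ bca) (distinct3_cofac _ cab) [v c * v a]mulrC.
Qed.

(** The hypotheses say that t x^2 - 2 p x^3 + q x^4 has a double root at x = 1, so it is a multiple
    of x^2 (x - 1)^2. *)
Lemma limit_ratio (K : numFieldType) (p q t : K) : t - p *+ 2 + q = 0 ->
  t *+ 2 - p *+ 6 + q *+ 4 = 0 -> [/\ p = q & t = q].
Proof.
move=> h1 h2; have pq : p = q.
  have : 2%:R * (q - p) = (t *+ 2 - p *+ 6 + q *+ 4) - 2%:R * (t - p *+ 2 + q) by ring.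
  rewrite h1 h2 mulr0 subrr => /eqP; rewrite mulf_eq0 pnatr_eq0 /= subr_eq0.
  by move/eqP.
split=> //; apply/eqP; rewrite -subr_eq0 -h1 pq; apply/eqP; ring.
Qed.

(** * Degree bounds; [msize] at most k + 1 means degree at most k *)

Section Degree.
Variables (n : nat) (R : comNzRingType).
Implicit Types (p q : {mpoly R[n]}) (k : nat).

Lemma msizeD_bound k p q : (msize p <= k)%N -> (msize q <= k)%N -> (msize (p + q) <= k)%N.
Proof. by move=> hp hq; rewrite (leq_trans (msizeD_le _ _)) // geq_max hp hq. Qed.

Lemma msizeM_bound j k p q :
  (msize p <= j.+1)%N -> (msize q <= k.+1)%N -> (msize (p * q) <= (j + k).+1)%N.
Proof.
move=> hp hq; rewrite msizeE; apply/bigmax_leqP_seq => m + _.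
move=> /msuppM_le /allpairsP [[m1 m2] [/= h1 h2 ->]].
rewrite mdegD ltnS leq_add // -ltnS.
  by apply: leq_trans hp; apply: msize_mdeg_lt.
by apply: leq_trans hq; apply: msize_mdeg_lt.
Qed.

Lemma msizeCM_bound k c p : (msize p <= k)%N -> (msize (c%:MP * p) <= k)%N.
Proof. by move=> hp; rewrite mul_mpolyC (leq_trans (msizeZ_le _ _)). Qed.

Lemma msizeC_bound k c : (msize (c%:MP : {mpoly R[n]}) <= k.+1)%N.
Proof. by rewrite msizeC; case: (c != 0). Qed.

Lemma msizeN_bound k p : (msize p <= k)%N -> (msize (- p) <= k)%N.
Proof. by rewrite msizeN. Qed.

Lemma msize_double_bound k p : (msize p <= k)%N -> (msize (p *+ 2) <= k)%N.
Proof. by move=> hp; rewrite mulr2n msizeD_bound. Qed.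

Lemma msizeXU_bound k (i : 'I_n) : (msize ('X_i : {mpoly R[n]}) <= k.+2)%N.
Proof. by rewrite msizeX mdeg1. Qed.

Lemma msize_sum_bound k (I : finType) (F : I -> {mpoly R[n]}) :
  (forall i, (msize (F i) <= k)%N) -> (msize (\sum_i F i) <= k)%N.
Proof.
move=> h; apply: (big_ind (fun p => (msize p <= k)%N)) => //.
  by rewrite msize0.
by move=> p q; apply: msizeD_bound.
Qed.

End Degree.

Section ModelDegree.
Variable R : comNzRingType.

Lemma msize_sumsq : (msize (sumsq R) <= 3)%N.
Proof.
by apply: msize_sum_bound => a; apply: (@msizeM_bound _ _ 1 1); apply: msizeXU_bound.
Qed.

Lemma msize_cofac a : (msize (cofac R a) <= 3)%N.
Proof.
have [b [c abc]] := distinct3_ex a.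
have -> : cofac R a = 'X_b * 'X_c.
  rewrite /cofac prod3; move: abc.
  by case: (I3P a) => ->; case: (I3P b) => ->; case: (I3P c) => -> // _;
    rewrite ?eqxx ?i3E; ring.
by apply: (@msizeM_bound _ _ 1 1); apply: msizeXU_bound.
Qed.

Lemma msize_phi s a : (msize (phi (s : R) a) <= 4)%N.
Proof.
have X1 : (msize ('X_a : {mpoly R[3]}) <= 2)%N by apply: msizeXU_bound.
apply: msizeD_bound; last by apply/msizeN_bound/msizeCM_bound/msizeXU_bound.
apply: msizeD_bound; last first.
  by apply/msize_double_bound/msizeCM_bound; apply: leq_trans (msize_cofac a) _.
apply: msizeD_bound; first apply: msize_double_bound.
  by apply: (@msizeM_bound _ _ 2 1) => //; apply: (@msizeM_bound _ _ 1 1).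
by apply: msizeN_bound; apply: (@msizeM_bound _ _ 1 2) => //; apply: msize_sumsq.
Qed.

Lemma msize_quart s a b : (msize (quart (s : R) a b) <= 5)%N.
Proof.
have h1 : (msize ('X_a * 'X_a - (s * s)%:MP : {mpoly R[3]}) <= 3)%N.
  apply: msizeD_bound; first by apply: (@msizeM_bound _ _ 1 1); apply: msizeXU_bound.
  by apply/msizeN_bound/msizeC_bound.
apply: (@msizeM_bound _ _ 2 2) => //; case: ifP => // _.
apply: msizeD_bound; first by apply: (@msizeM_bound _ _ 1 1); apply: msizeXU_bound.
by apply/msizeN_bound/msizeCM_bound/msizeXU_bound.
Qed.

Lemma msize_herm u (s : R) : (msize (herm u s) <= 4)%N.
Proof.
apply: msizeD_bound; first exact: msizeC_bound.
apply: msize_sum_bound => a; apply: msizeD_bound; last first.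
  apply: msize_sum_bound => b; case: ifP => _; first by rewrite msize0.
  apply: msizeCM_bound; apply: (@msizeM_bound _ _ 1 2); first exact: msizeXU_bound.
  by apply: (@msizeM_bound _ _ 1 1); apply: msizeXU_bound.
apply: msizeD_bound; last by apply: msizeCM_bound; apply: leq_trans (msize_cofac a) _.
apply: msizeD_bound; apply: msizeCM_bound; first exact: msizeXU_bound.
apply: leq_trans (@msizeM_bound _ _ 1 1 _ _ _ _) _ => //; exact: msizeXU_bound.
Qed.

End ModelDegree.

Lemma sum_pair_option (I : finType) (V : nmodType) (F : I * option I -> V) :
  \sum_j F j = \sum_a (F (a, None) + \sum_b F (a, Some b)).
Proof.
rewrite (eq_bigr (fun j => F (j.1, j.2))); last by case.
rewrite -(pair_bigA _ (fun a o => F (a, o))) /=.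
apply: eq_bigr => a _; rewrite (bigD1 None) //=; congr (_ + _).
by rewrite (reindex_omap Some id) /=; [apply: eq_bigl => b; rewrite eqxx|case].
Qed.

(** * The deformation and its nodes *)

Section Family.
Variables (K : numFieldType) (O : comNzRingType).
Variables (st : {rmorphism O -> K}) (cst : {rmorphism K -> O}).
Hypothesis sp : specialization st cst.
Variable e : O.
Hypotheses (e_neq0 : e != 0) (st_e : st e = 0).
Variables f4 f5 : {mpoly K[3]}.
Hypotheses (f4_homog : f4 \is 4.-homog)
  (f4_evec : forall a, f4.@[evec K a] = 1)
  (f5_low : forall m : 'X_{1..3}, (mdeg m < 5)%N -> f5@_m = 0).

Local Notation F4 := (map_mpoly cst f4).
Local Notation F5 := (map_mpoly cst f5).
Implicit Types (u : option 'I_3 -> option 'I_3 -> O)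
  (w : 'I_3 * option 'I_3 -> O).

(** The index set also labels the conditions, a value or a partial derivative at the node of each
    axis, so that the system for [w] is square. *)
Definition basis s (j : 'I_3 * option 'I_3) : {mpoly O[3]} :=
  if j.2 is Some b then quart s j.1 b else phi s j.1.

Definition cubics u w s : {mpoly O[3]} :=
  herm u s + \sum_a (w (a, None))%:MP * basis s (a, None).

Definition quartics w s : {mpoly O[3]} :=
  \sum_a \sum_b (w (a, Some b))%:MP * basis s (a, Some b).

(** This is the change of the equation divided by e. After multiplication by e, its first two terms
    turn -2xyz into [cay (e * e)]. The corrections [cubics] and [quartics] receive different powers
    of e because rescaling by s multiplies them by s^3 and s^4; at s = e both end up with weight
    e^2. *)
Definition perturbation u w : {mpoly O[3]} :=
  e%:MP * sumsq O - (e * e * e * e * e)%:MP - (\sum_a phi (e * e) a) *+ 2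
  + e%:MP * cubics u w (e * e) + quartics w (e * e).

Definition deformation u w : {mpoly O[3]} :=
  map_mpoly cst (- (xyz K *+ 2) + f4 + f5) + e%:MP * perturbation u w.

(* The deformation rescaled by s and divided by s ^+ 3, when s * s1 = e * e. *)
Definition rescaled u w s s1 r : {mpoly O[3]} :=
  cay s1 - (e *+ 2)%:MP * \sum_a phi s1 a + s%:MP * F4 + (s * s)%:MP * r
  + (e * e)%:MP * cubics u w s1 + (e * s)%:MP * quartics w s1.

Lemma rescaled_rest s : exists r, F5 \mPo scale_by s = (s ^+ 5)%:MP * r.
Proof.
by apply: scale_by_low => m /f5_low h; rewrite mcoeff_map_mpoly h raddf0.
Qed.

Lemma homog_scale d (p : {mpoly K[3]}) s : p \is d.-homog ->
  map_mpoly cst p \mPo scale_by s = (s ^+ d)%:MP * map_mpoly cst p.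
Proof.
move=> /dhomogP hp; rewrite [p]mpolyE (raddf_sum (map_mpoly cst)).
rewrite (raddf_sum (comp_mpoly _)) mulr_sumr big_seq [RHS]big_seq.
apply: eq_bigr => m mp /=; rewrite -mul_mpolyC rmorphM /= map_mpolyCr map_mpolyX.
rewrite comp_mpolyM comp_mpolyC mulrCA; congr (_ * _).
have <- : mdeg m = d by exact: hp.
rewrite comp_mpolyX mpolyXE_id mdegE -prodrXr rmorph_prod /= -big_split.
by apply: eq_bigr => i _; rewrite tnth_mktuple exprMn rmorphXn.
Qed.

Lemma basis_scaleN s s1 a :
  basis (s * s1) (a, None) \mPo scale_by s = (s * s * s)%:MP * basis s1 (a, None).
Proof. exact: phi_scale. Qed.

Lemma basis_scaleS s s1 a b : basis (s * s1) (a, Some b) \mPo scale_by s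
  = (s * s * s * s)%:MP * basis s1 (a, Some b).
Proof. exact: quart_scale. Qed.

(** Every part is weighted so that s^3 factors out. The choice [s1 = 1] is the scale of the four
    Cayley nodes and [s = s1 = e] that of the axis nodes; the remaining factorizations of e^2 are
    needed to exclude further singular points. *)
Lemma deformation_scale u w s s1 r : s * s1 = e * e ->
  F5 \mPo scale_by s = (s ^+ 5)%:MP * r ->
  deformation u w \mPo scale_by s = (s * s * s)%:MP * rescaled u w s s1 r.
Proof.
move=> ss1 hr.
have -> : deformation u w = cay (s * s1) - (e *+ 2)%:MP * \sum_a phi (s * s1) a
   + F4 + F5 + (e * e)%:MP * cubics u w (s * s1) + e%:MP * quartics w (s * s1).
  rewrite ss1 /deformation /perturbation /cay 2!rmorphD rmorphN rmorphMn /= map_xyz.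
  by ring.
rewrite 4!comp_mpolyD comp_mpolyB 3!comp_mpolyM 3!comp_mpolyC.
rewrite cay_scale (homog_scale _ f4_homog) hr /rescaled.
have -> : (\sum_a phi (s * s1) a) \mPo scale_by s
    = (s * s * s)%:MP * \sum_a phi s1 a.
  rewrite raddf_sum mulr_sumr; apply: eq_bigr => a _; exact: phi_scale.
have -> : cubics u w (s * s1) \mPo scale_by s = (s * s * s)%:MP * cubics u w s1.
  rewrite /cubics comp_mpolyD herm_scale raddf_sum [RHS]mulrDr; congr (_ + _).
  rewrite mulr_sumr.
  by apply: eq_bigr => a _ /=; rewrite comp_mpolyM comp_mpolyC basis_scaleN; ring.
have -> : quartics w (s * s1) \mPo scale_by s
    = (s * s * s * s)%:MP * quartics w s1.
  rewrite /quartics raddf_sum mulr_sumr; apply: eq_bigr => a _ /=.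
  rewrite raddf_sum mulr_sumr; apply: eq_bigr => b _ /=.
  by rewrite comp_mpolyM comp_mpolyC basis_scaleS; ring.
by rewrite !rmorphXn /=; ring.
Qed.

Lemma meval_deformation u w s s1 r v : s * s1 = e * e ->
  F5 \mPo scale_by s = (s ^+ 5)%:MP * r ->
  (deformation u w).@[fun a => s * v a]
  = s * s * s * (rescaled u w s s1 r).@[v].
Proof.
move=> ss1 hr; rewrite -scale_by_eval (deformation_scale _ _ ss1 hr).
by rewrite mevalM mevalC.
Qed.

Lemma deriv_deformation u w s s1 r v d : s != 0 -> s * s1 = e * e ->
  F5 \mPo scale_by s = (s ^+ 5)%:MP * r ->
  (deformation u w)^`M(d).@[fun a => s * v a]
  = s * s * (rescaled u w s s1 r)^`M(d).@[v].
Proof.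
move=> s0 ss1 hr; apply: (sp_cancel sp s0).
rewrite -scale_by_eval.
have := congr1 (meval v) (scale_by_deriv (deformation u w) s d).
by rewrite (deformation_scale _ _ ss1 hr) mderiv_mulC !mevalM !mevalC => <-; ring.
Qed.

Lemma hess_deformation u w s s1 r v d d' : s != 0 -> s * s1 = e * e ->
  F5 \mPo scale_by s = (s ^+ 5)%:MP * r ->
  (deformation u w)^`M(d)^`M(d').@[fun a => s * v a]
  = s * (rescaled u w s s1 r)^`M(d)^`M(d').@[v].
Proof.
move=> s0 ss1 hr; apply: (sp_cancel sp s0); apply: (sp_cancel sp s0).
rewrite -scale_by_eval.
have := scale_by_deriv (deformation u w) s d.
rewrite (deformation_scale _ _ ss1 hr) mderiv_mulC => /(congr1 (mderiv d')).
rewrite !mderiv_mulC scale_by_deriv => /(congr1 (meval v)).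
by rewrite !mevalM !mevalC => <-; ring.
Qed.

Lemma jet_deformation u w s s1 r v o : s != 0 -> s * s1 = e * e ->
  F5 \mPo scale_by s = (s ^+ 5)%:MP * r ->
  jet (rescaled u w s s1 r) v o = 0 ->
  jet (deformation u w) (fun a => s * v a) o = 0.
Proof.
move=> s0 ss1 hr; case: o => [d|] /= h.
  by rewrite (deriv_deformation _ _ _ _ s0 ss1 hr) h mulr0.
by rewrite (meval_deformation _ _ _ ss1 hr) h mulr0.
Qed.

Lemma jet_rescaled u w s s1 r v o : jet (rescaled u w s s1 r) v o =
  jet (cay s1) v o - e *+ 2 * \sum_a jet (phi s1 a) v o + s * jet F4 v o
  + s * s * jet r v o + e * e * jet (cubics u w s1) v o
  + e * s * jet (quartics w s1) v o.
Proof. by rewrite /rescaled 5!jetD jetN 5!jetCM jet_sum. Qed.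

Lemma jet_cubics u w s v o : jet (cubics u w s) v o =
  jet (herm u s) v o + \sum_a w (a, None) * jet (basis s (a, None)) v o.
Proof.
rewrite /cubics jetD jet_sum; congr (_ + _).
by apply: eq_bigr => a _; rewrite jetCM.
Qed.

Lemma jet_quartics w s v o : jet (quartics w s) v o =
  \sum_a \sum_b w (a, Some b) * jet (basis s (a, Some b)) v o.
Proof.
rewrite /quartics jet_sum; apply: eq_bigr => a _; rewrite jet_sum.
by apply: eq_bigr => b _; rewrite jetCM.
Qed.

(** The [phi] and [quart] terms have zero jets at the sign vectors, which is why [u] does not depend
    on [w]. At scale e^2 the error to be cancelled is e^2 (f4 + e^2 r), of the same weight as
    [cubics], so the interpolation data lie in [O]. *)
Lemma cayley_nodes : exists u, forall w o o',
  jet (deformation u w) (fun a => e * e * sgn O o a) o' = 0.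
Proof.
have [r hr] := rescaled_rest (e * e).
have c8 : cst 8%:R^-1 * 8%:R = 1.
  by rewrite -(rmorph_nat cst 8) -rmorphM mulVf ?rmorph1 // pnatr_eq0.
have [u hu] := hermite_interpolation
  (fun o o' => - jet (F4 + (e * e)%:MP * r) (sgn O o) o') c8.
exists u => w o o'; apply: (jet_deformation (s1 := 1) _ _ hr); rewrite ?mulr1 //.
  exact: (sp_mul_neq0 sp).
move: (hu o o'); rewrite jetD jetCM => hu'.
rewrite jet_rescaled jet_cubics jet_quartics jet_cay_sgn hu' !big1; first by ring.
- by move=> a _; rewrite big1 // => b _; rewrite jet_quart_sgn mulr0.
- by move=> a _; rewrite jet_phi_sgn mulr0.
- by move=> a _; rewrite jet_phi_sgn.
Qed.

(* Direction of the node near the a-axis; the choice cancels the leading term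
   of the transversal derivatives. *)
Definition axis_slope (a b : 'I_3) : O :=
  1 + cst (2%:R^-1 * f4^`M(third a b).@[evec K a]).

Definition axis_point (a b : 'I_3) : O :=
  if b == a then 1 else e * axis_slope a b.

Lemma st_axis_point a b : st (axis_point a b) = evec K a b.
Proof.
rewrite /axis_point /evec; case: ifP; first by rewrite rmorph1.
by rewrite rmorphM st_e mul0r.
Qed.

Lemma f4_deriv_evec a : f4^`M(a).@[evec K a] = 4%:R.
Proof.
have := euler_homog (evec K a) f4_homog; rewrite f4_evec mulr1 => <-.
rewrite (bigD1 a) //= /evec eqxx mul1r big1 ?addr0 // => b ba.
by rewrite (negPf ba) mul0r.
Qed.

Lemma jet_diff (p : {mpoly O[3]}) (v v' : 'I_3 -> O) o :
  (forall i, exists c, v i - v' i = e * c) ->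
  exists c, jet p v o = jet p v' o + e * c.
Proof.
move=> vv; have [c hc] : exists c, jet p v o - jet p v' o = e * c.
  by case: o => [d|]; apply: meval_diff.
by exists c; rewrite -hc; ring.
Qed.

(** On the axis this polynomial is x^2 - 2 x^3 + x^4, with a double root at x = 1, so only
    transversal derivatives survive. Their constant part 2 comes from the term -X_d X_a^2 of
    [phi 0 d]. *)
Lemma jet_leading a o :
  jet (sumsq K - (\sum_b phi 0 b) *+ 2 + f4) (evec K a) o =
  if o is Some d then (if d == a then 0 else 2%:R + f4^`M(d).@[evec K a]) else 0.
Proof.
rewrite 2!jetD jetN jetMn jet_sum.
under eq_bigr do rewrite jet_phi_evec.
rewrite (bigD1 a) //= eqxx.
case: o => [d|] /=; last first.
  rewrite sumsq_evec f4_evec big1 ?addr0; first by ring.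
  by move=> b ba; rewrite (negPf ba).
rewrite sumsq_deriv !evalE /evec; case: (eqVneq d a) => [->|da] /=.
  rewrite big1 ?f4_deriv_evec; first by ring.
  move=> b ba; rewrite (negPf ba); case: eqP => // -[ab].
  by rewrite ab eqxx in ba.
rewrite (bigD1 d) //= (negPf da) eqxx big1; first by ring.
move=> b /andP [ba bd]; rewrite (negPf ba); case: eqP => // -[db].
by rewrite db eqxx in bd.
Qed.

(** The terms of order 0 and 1 in e cancel: by the double root for the value and the axial
    derivative, by the choice of [axis_slope] for the transversal derivatives. The remaining factor
    e^2 is the weight of [w] in [rescaled_affine], so the correction can be found in [O]. *)
Lemma rescaled_axis u r a o : exists c,
  jet (rescaled u (fun=> 0) e e r) (axis_point a) o = e * e * c.
Proof.
pose q0 := map_mpoly cst (sumsq K - (\sum_b phi 0 b) *+ 2 + f4).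
pose q1 := - e%:MP - (\sum_b (cofac O b *+ 2 - e%:MP * 'X_b)) *+ 2 + r + herm u e.
have -> : rescaled u (fun=> 0) e e r = - (xyz O *+ 2) + e%:MP * (q0 + e%:MP * q1).
  have -> : q0 = sumsq O - (\sum_b phi 0 b) *+ 2 + F4.
    rewrite /q0 rmorphD rmorphB /= map_sumsq rmorphMn rmorph_sum /=.
    by under eq_bigr do rewrite map_phi rmorph0.
  rewrite /rescaled /cubics /quartics /q1 /cay.
  have -> : \sum_b phi e b = \sum_b phi 0 b +
      e%:MP * \sum_b (cofac O b *+ 2 - e%:MP * 'X_b).
    rewrite mulr_sumr -big_split; apply: eq_bigr => b _ /=.
    by rewrite /phi (mul0r (0 : O)) !mpolyC0 !rmorphM /=; ring.
  rewrite [\sum_a _ * basis e (a, None)]big1; last by move=> *; rewrite mpolyC0 mul0r.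
  rewrite [\sum_a \sum_b _]big1; last first.
    by move=> *; rewrite big1 // => *; rewrite mpolyC0 mul0r.
  by rewrite !rmorphM rmorphMn /=; ring.
have close i : exists c, axis_point a i - evec O a i = e * c.
  rewrite /axis_point /evec; case: eqP => _; first by exists 0; rewrite subrr mulr0.
  by exists (axis_slope a i); rewrite subr0.
have [c hc] := jet_diff q0 o close.
rewrite jetD jetN jetMn jetCM jetD jetCM hc.
have -> : jet q0 (evec O a) o = if o is Some d then
    (if d == a then 0 else 2%:R + cst f4^`M(d).@[evec K a]) else 0.
  rewrite (@jet_eq _ _ _ (fun i => cst (evec K a i))) => [|i]; last first.
    by rewrite /evec rmorph_nat.
  rewrite /q0 map_jet jet_leading; case: o {hc} => [d|]; last exact: rmorph0.
  by case: ifP => _; rewrite ?rmorph0 // rmorphD rmorph_nat.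
have hx : exists c', jet (xyz O) (axis_point a) o = e * e * c' +
    if o is Some d then (if d == a then 0 else e * axis_slope a (third a d)) else 0.
  case: o {hc} => [d|]; rewrite /jet.
    rewrite xyz_deriv cofac_eval prod3 /axis_point.
    case: (I3P a) => ->; case: (I3P d) => ->; rewrite /third ?i3E ?eqxx /=;
      rewrite ?(mul1r, mulr1);
      try (by exists 0; rewrite mulr0 add0r);
      rewrite mulrACA; eexists; rewrite addr0; reflexivity.
  rewrite xyz_eval /axis_point.
  case: (I3P a) => ->; rewrite ?i3E ?eqxx /= ?(mul1r, mulr1) mulrACA;
    eexists; rewrite addr0; reflexivity.
have [c' ->] := hx.
exists (- (c' *+ 2) + c + jet q1 (axis_point a) o).
case: o {hc hx} => [d|]; last by ring.
case: eqVneq => [_|da]; first by ring.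
have -> : axis_slope a (third a d) = 1 + cst (2%:R^-1 * f4^`M(d).@[evec K a]).
  rewrite /axis_slope; congr (1 + cst (_ * f4^`M(_).@[_])).
  by move: da; case: (I3P a) => ->; case: (I3P d) => ->.
have -> : cst f4^`M(d).@[evec K a]
    = 2%:R * cst (2%:R^-1 * f4^`M(d).@[evec K a]).
  by rewrite -(rmorph_nat cst 2) -rmorphM mulrA divff ?mul1r // pnatr_eq0.
by ring.
Qed.

Lemma rescaled_affine u w r : rescaled u w e e r =
  rescaled u (fun=> 0) e e r + (e * e)%:MP * \sum_j (w j)%:MP * basis e j.
Proof.
rewrite sum_pair_option big_split /= /rescaled /cubics /quartics.
rewrite [\sum_a 0%:MP * basis e (a, None)]big1; last first.
  by move=> *; rewrite mpolyC0 mul0r.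
rewrite [\sum_a \sum_b 0%:MP * _]big1; last first.
  by move=> *; rewrite big1 // => *; rewrite mpolyC0 mul0r.
ring.
Qed.

(** Modulo e, the value and the axial derivative at axis [a] give the rows (1, 1) and (3, 4) on the
    coefficients of [phi a] and [quart a a], with determinant 1. Once all these coefficients vanish,
    the derivative along [d] isolates the coefficient of X_a^3 X_d. *)
Lemma axis_nodes u : exists w, forall a o,
  jet (deformation u w) (fun b => e * axis_point a b) o = 0.
Proof.
have [r hr] := rescaled_rest e.
pose A (i j : 'I_3 * option 'I_3) := jet (basis e j) (axis_point i.1) i.2.
have [c hc] := boolp.choice (fun i : 'I_3 * option 'I_3 =>
  rescaled_axis u r i.1 i.2).
have [|w hw] := @sp_solve _ _ _ _ sp _ A (fun i => - c i); last first.
  exists w => a o; apply: (jet_deformation _ _ hr) => //.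
  rewrite rescaled_affine jetD jetCM jet_sum (hc (a, o)) -mulrDr.
  under eq_bigr do rewrite jetCM mulrC.
  by rewrite (hw (a, o)) subrr mulr0.
have stA i j : st (A i j) = if j.2 is Some b
    then jet (quart 0 j.1 b) (evec K i.1) i.2 else jet (phi 0 j.1) (evec K i.1) i.2.
  rewrite /A -map_jet (jet_eq _ _ (st_axis_point i.1)) /basis.
  by case: j.2 => [b|]; rewrite ?map_quart ?map_phi st_e.
move=> v hv.
have row a o : jet (phi 0 a) (evec K a) o * v (a, None)
    + \sum_c jet (quart 0 a c) (evec K a) o * v (a, Some c)
    + \sum_(b | b != a) (if o == Some b then -1 else 0) * v (b, None) = 0.
  rewrite -[RHS](hv (a, o)) sum_pair_option [RHS](bigD1 a) //= stA /=; congr (_ + _ + _).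
    by apply: eq_bigr => c' _; rewrite stA.
  apply: eq_bigr => b ba; rewrite stA /= jet_phi_evec (negPf ba) big1 ?addr0 //.
  by move=> c' _; rewrite stA /= jet_quart_evec (negPf ba) mul0r.
have val0 a : v (a, None) + v (a, Some a) = 0.
  rewrite -[RHS](row a None) jet_phi_evec eqxx mul1r [X in _ = _ + X]big1.
    rewrite addr0; under [in RHS]eq_bigr do rewrite jet_quart_evec eqxx.
    rewrite (bigD1 a) //= eqxx mul1r big1 ?addr0 // => b ba.
    by rewrite (negPf ba) mul0r.
  by move=> b _; rewrite mul0r.
have der0 a : 3%:R * v (a, None) + 4%:R * v (a, Some a) = 0.
  rewrite -[RHS](row a (Some a)) jet_phi_evec !eqxx [X in _ = _ + X]big1.
    rewrite addr0; under [in RHS]eq_bigr do rewrite jet_quart_evec !eqxx.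
    rewrite (bigD1 a) //= eqxx big1 ?addr0 // => b ba.
    by rewrite (negPf ba) mul0r.
  move=> b ba; case: eqP => [[ab]|_]; last by rewrite mul0r.
  by rewrite ab eqxx in ba.
have vaa a : v (a, Some a) = 0.
  have -> : v (a, Some a) = 3%:R * v (a, None) + 4%:R * v (a, Some a)
     - 3%:R * (v (a, None) + v (a, Some a)) by ring.
  by rewrite der0 val0 mulr0 subrr.
have vaN a : v (a, None) = 0 by rewrite -[LHS]addr0 -[X in _ + X](vaa a) val0.
case=> a [d|]; last exact: vaN.
have [->|da] := eqVneq d a; first exact: vaa.
have := row a (Some d); rewrite vaN mulr0 add0r [X in _ + X]big1; last first.
  by move=> b _; rewrite vaN mulr0.
rewrite addr0; under eq_bigr do rewrite jet_quart_evec eqxx (negPf da).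
rewrite (bigD1 d) //= eqxx mul1r big1 ?addr0 // => b bd.
by rewrite (negPf bd) mul0r.
Qed.

Lemma msize_perturbation u w : (msize (perturbation u w) <= 5)%N.
Proof.
apply: msizeD_bound; last first.
  do 2!(apply: msize_sum_bound => ?); apply: msizeCM_bound; exact: msize_quart.
apply: msizeD_bound; last first.
  apply/msizeCM_bound; apply: msizeD_bound; first by apply: leq_trans (msize_herm _ _) _.
  apply: msize_sum_bound => a; apply: msizeCM_bound.
  by apply: leq_trans (msize_phi _ _) _.
apply: msizeD_bound; last first.
  apply/msizeN_bound/msize_double_bound; apply: msize_sum_bound => a.
  by apply: leq_trans (msize_phi _ _) _.
apply: msizeD_bound; last by apply/msizeN_bound/msizeC_bound.
by apply: msizeCM_bound; apply: leq_trans (msize_sumsq _) _.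
Qed.

(** * Nondegeneracy, uniqueness and completeness of the seven nodes *)

Lemma map_st_cst n (p : {mpoly K[n]}) : map_mpoly st (map_mpoly cst p) = p.
Proof. by apply/mpolyP => m; rewrite !mcoeff_map_mpoly; apply: (sp_cst sp). Qed.

Lemma jet_rescaled_eq0 u w s s1 r v : s != 0 -> s * s1 = e * e ->
  F5 \mPo scale_by s = (s ^+ 5)%:MP * r ->
  (forall o, jet (deformation u w) (fun a => s * v a) o = 0) ->
  forall o, jet (rescaled u w s s1 r) v o = 0.
Proof.
move=> s0 ss1 hr h o; have := h o; case: o => [d|] /=.
  rewrite (deriv_deformation _ _ _ _ s0 ss1 hr) => /eqP.
  rewrite -[X in _ == X](mulr0 (s * s)) => /eqP; apply: (sp_cancel sp).
  exact: (sp_mul_neq0 sp).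
rewrite (meval_deformation _ _ _ ss1 hr) => /eqP.
rewrite -[X in _ == X](mulr0 (s * s * s)) => /eqP; apply: (sp_cancel sp).
by rewrite !(sp_mul_neq0 sp).
Qed.

Lemma map_rescaled u w s s1 r : st s = 0 ->
  map_mpoly st (rescaled u w s s1 r) = cay (st s1).
Proof.
move=> s0; rewrite /rescaled 4!rmorphD rmorphB 5!rmorphM /= map_cay.
rewrite !map_mpolyCr (rmorphM st s s) (rmorphM st e e) (rmorphM st e s) rmorphMn.
by rewrite s0 st_e mul0rn mul0r mpolyC0 !mul0r subr0 !addr0.
Qed.

Definition hess (p : {mpoly O[3]}) v : 'M[O]_3 :=
  \matrix_(i, j) (p^`M(i)^`M(j)).@[v].

Lemma cay_hess (s : K) o i j : (cay 1)^`M(i)^`M(j).@[sgn K o] =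
  if j == i then 2%:R else - (sgn K o i * sgn K o j) *+ 2.
Proof.
rewrite cay_deriv mderivD mderivN mderiv_mulC !mderivMn cofac_deriv mderivXU
  [i == j]eq_sym.
case: (eqVneq j i) => [_|ij]; first by rewrite !evalE /=; ring.
by rewrite !evalE sgn_third 1?eq_sym //=; ring.
Qed.

Lemma st_hess_node u w s r v o d d' : st s = 0 -> (forall i, st (v i) = sgn K o i) ->
  st ((rescaled u w s 1 r)^`M(d)^`M(d').@[v]) =
  if d' == d then 2%:R else - (sgn K o d * sgn K o d') *+ 2.
Proof.
move=> s0 sv; rewrite -map_meval -!map_mderiv map_rescaled // rmorph1.
by rewrite (meval_eq _ sv) (cay_hess 0).
Qed.

(* Nonsingularity of the Hessian at a Cayley node makes the critical point
   specialising to it unique. *)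
Lemma cayley_unique u w s r o v v' : st s = 0 ->
  (forall i, st (v i) = sgn K o i) -> (forall i, st (v' i) = sgn K o i) ->
  (forall o, jet (rescaled u w s 1 r) v o = 0) ->
  (forall o, jet (rescaled u w s 1 r) v' o = 0) -> v =1 v'.
Proof.
move=> s0 sv sv' h h'.
have stv i : st (v i) = st (v' i) by rewrite sv sv'.
have T d := taylor1 (rescaled u w s 1 r)^`M(d) stv.
have [m0 E0 M0] := T o0; have [m1 E1 M1] := T o1; have [m2 E2 M2] := T o2.
have zero d : (rescaled u w s 1 r)^`M(d).@[v] - (rescaled u w s 1 r)^`M(d).@[v'] = 0.
  by have := h (Some d); have := h' (Some d); rewrite /jet => -> ->; exact: subrr.
rewrite zero sum3 in E0; rewrite zero sum3 in E1; rewrite zero sum3 in E2.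
have C (m : 'I_3 -> O) : 0 = (v o0 - v' o0) * m o0 + (v o1 - v' o1) * m o1
    + (v o2 - v' o2) * m o2 ->
    m o0 * (v o0 - v' o0) + m o1 * (v o1 - v' o1) + m o2 * (v o2 - v' o2) = 0.
  by move=> ->; ring.
have [] := cramer3 (C _ E0) (C _ E1) (C _ E2).
set D := (X in X * _); have stD : st D != 0.
  rewrite /D !(rmorphD, rmorphN, rmorphM) !M0 !M1 !M2 /=.
  rewrite !(st_hess_node _ _ _ _ _ s0 sv') !eqxx !i3E.
  (* Conjugation by the diagonal matrix of signs turns the Hessian into 4 I - 2 J, where J has all
     entries 1; its eigenvalues are 4, 4 and -2. *)
  have : - 32%:R != 0 :> K by rewrite oppr_eq0 pnatr_eq0.
  congr (_ != _); rewrite (_ : o2 = third o0 o1) // sgn_third //.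
  have := sgn_sqr K o o0; have := sgn_sqr K o o1.
  set x := sgn K o o0; set y := sgn K o o1 => yy xx.
  transitivity (8%:R * (1 - (x * x) * (y * y) * (y * y) - (x * x) * (y * y)
     - (x * x) * (x * x) * (y * y)
     - (x * x) * (x * x) * (y * y) * (y * y) *+ 2) : K).
    by rewrite yy xx; ring.
  by ring.
move=> /(sp_unit_eq0 sp stD) /eqP; rewrite subr_eq0 => /eqP e0.
move=> /(sp_unit_eq0 sp stD) /eqP; rewrite subr_eq0 => /eqP e1.
move=> /(sp_unit_eq0 sp stD) /eqP; rewrite subr_eq0 => /eqP e2.
by move=> i; case: (I3P i) => ->.
Qed.

(* With e, s, s1 = m e', m s', m s1', this is the cofactor of m in the part of
   the rescaled family other than the cubic form. *)
Definition leading u w m e' s' s1' r : {mpoly O[3]} :=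
  s1'%:MP * sumsq O - (m * m * s1' * s1' * s1')%:MP
  - (e' *+ 2)%:MP * \sum_a phi (m * s1') a + s'%:MP * F4
  + (m * s' * s')%:MP * r + (m * e' * e')%:MP * cubics u w (m * s1')
  + (m * e' * s')%:MP * quartics w (m * s1').

Lemma rescaled_leading u w m e' s' s1' r : e = m * e' ->
  rescaled u w (m * s') (m * s1') r =
  - (xyz O *+ 2) + m%:MP * leading u w m e' s' s1' r.
Proof. by move=> em; rewrite /rescaled /leading /cay em !rmorphM /=; ring. Qed.

(** On each axis this is s1' x^2 - 2 e' x^3 + s' x^4; the parameters are the limits of e, s and s1
    relative to the largest of them. *)
Definition limit_form (e' s' s1' : K) : {mpoly K[3]} :=
  s1'%:MP * sumsq K - (e' *+ 2)%:MP * (\sum_a phi 0 a) + s'%:MP * f4.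

Lemma map_leading u w m e' s' s1' r : st m = 0 ->
  map_mpoly st (leading u w m e' s' s1' r) = limit_form (st e') (st s') (st s1').
Proof.
move=> m0; rewrite /leading /limit_form 4!rmorphD rmorphB rmorphB
  6!(rmorphM (map_mpoly st)) /=.
rewrite map_sumsq map_st_cst (rmorph_sum (map_mpoly st)) /=.
under eq_bigr do rewrite map_phi rmorphM m0 mul0r.
rewrite !map_mpolyCr !(rmorphM st) m0 rmorphMn !mul0r !mpolyC0.
by rewrite ?mul0r subr0 !addr0.
Qed.

Lemma jet_limit_form e' s' s1' a o : jet (limit_form e' s' s1') (evec K a) o =
  if o is Some d then
    (if d == a then s1' *+ 2 - e' *+ 6 + s' *+ 4
     else e' *+ 2 + s' * f4^`M(d).@[evec K a])
  else s1' - e' *+ 2 + s'.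
Proof.
rewrite /limit_form jetD jetD jetN 3!jetCM jet_sum.
under eq_bigr do rewrite jet_phi_evec.
rewrite (bigD1 a) //= eqxx.
case: o => [d|] /=; last first.
  rewrite sumsq_evec f4_evec big1 ?addr0; first by ring.
  by move=> b ba; rewrite (negPf ba).
rewrite sumsq_deriv !evalE /evec; case: (eqVneq d a) => [->|da] /=.
  rewrite big1 ?f4_deriv_evec; first by ring.
  move=> b ba; rewrite (negPf ba); case: eqP => // -[ab].
  by rewrite ab eqxx in ba.
rewrite (bigD1 d) //= (negPf da) eqxx big1; first by ring.
move=> b /andP [ba bd]; rewrite (negPf ba); case: eqP => // -[db].
by rewrite db eqxx in bd.
Qed.

Lemma hess_limit_form e' s' s1' a :
  (limit_form e' s' s1')^`M(a)^`M(a).@[evec K a]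
  = s1' *+ 2 - e' *+ 12 + s' *+ 12.
Proof.
have f4aa : f4^`M(a)^`M(a).@[evec K a] = 12%:R.
  have h : f4^`M(a) \is 3.-homog.
    apply/dhomogP => m; rewrite mcoeff_msupp mcoeff_deriv => hm.
    have : (m + U_(a))%MM \in msupp f4.
      by rewrite mcoeff_msupp; apply: contraNneq hm => ->; rewrite mul0rn.
    move/dhomogP: f4_homog => hf /hf /=; rewrite mdegD mdeg1 addn1 => -[]; exact.
  have := euler_homog (evec K a) h; rewrite f4_deriv_evec.
  rewrite (bigD1 a) //= {1}/evec eqxx mul1r big1 ?addr0 => [->|b ba].
    by rewrite -natrM.
  by rewrite {1}/evec (negPf ba) mul0r.
rewrite /limit_form !mderivD !mderivN !mderiv_mulC !mevalD !mevalN !mevalM !mevalC f4aa.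
have msum (F : 'I_3 -> {mpoly K[3]}) : (\sum_b F b)^`M(a) = \sum_b (F b)^`M(a).
  exact: raddf_sum.
rewrite sumsq_deriv mderivMn mderivXU eqxx !msum (raddf_sum (meval _)) /=.
under eq_bigr do rewrite phi_deriv.
rewrite (bigD1 a) //= eqxx big1 ?addr0 => [|b ba].
  rewrite !(mderivB, mderivMn, mderivM, mderivXU, mderivC) sumsq_deriv eqxx.
  by rewrite !evalE /evec eqxx /=; ring.
rewrite eq_sym (negPf ba) !(mderivB, mderivMn, mderivM, mderivXU, mderivC) eqxx.
by rewrite !evalE /evec (negPf ba) eqxx /=; ring.
Qed.

Lemma sp_two_unit : exists h : O, 2%:R * h = 1.
Proof. by apply: (sp_unit sp); rewrite rmorph_nat pnatr_eq0. Qed.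

Lemma sp_double_inj (x y : O) : x *+ 2 = y *+ 2 -> x = y.
Proof.
have [h h2] := sp_two_unit => xy; rewrite -[x]mulr1 -[y]mulr1 -h2.
have -> : x * (2%:R * h) = x *+ 2 * h by ring.
by rewrite xy; ring.
Qed.

Lemma rescaled_diag u w r :
  rescaled u w e e r = - (xyz O *+ 2) + e%:MP * leading u w e 1 1 1 r.
Proof. by rewrite -rescaled_leading !mulr1. Qed.

(** The transversal coordinates are multiples of e, not merely infinitesimal: the critical equations
    become nondegenerate only after these coordinates are divided by e. *)
Definition near_axis a (v : 'I_3 -> O) :=
  st (v a) = 1 /\ forall i, i != a -> exists y, v i = e * y.

Lemma st_near_axis a v : near_axis a v -> forall i, st (v i) = evec K a i.
Proof.
move=> [va vn] i; rewrite /evec; case: eqVneq => [->|/vn [y ->]]; first exact: va.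
by rewrite rmorphM st_e mul0r.
Qed.

(** Near the axis all derivatives of xyz are multiples of e, as is the rest of the equation, so the
    critical equations can be divided by e. *)
Lemma near_axis_deriv u w r a b c v y z : distinct3 a b c ->
  v b = e * y -> v c = e * z ->
  (forall o, jet (rescaled u w e e r) v o = 0) ->
  let q := leading u w e 1 1 1 r in
  [/\ q^`M(a).@[v] = e * y * z *+ 2, q^`M(b).@[v] = v a * z *+ 2 &
      q^`M(c).@[v] = v a * y *+ 2].
Proof.
move=> abc vb vc h q; have [_ xa xb xc] := jet_xyz v abc.
have hq d : e * q^`M(d).@[v] = jet (xyz O) v (Some d) *+ 2.
  have := h (Some d); rewrite rescaled_diag jetD jetN jetMn jetCM => hd.
  by rewrite -[RHS]addr0 -[X in _ = _ + X]hd /jet /q; ring.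
split; apply: (sp_cancel sp e_neq0); rewrite hq ?xa ?xb ?xc ?vb ?vc; ring.
Qed.

Lemma st_leading_hess u w r a d d' v : (forall i, st (v i) = evec K a i) ->
  st ((leading u w e 1 1 1 r)^`M(d)^`M(d').@[v])
  = (limit_form 1 1 1)^`M(d)^`M(d').@[evec K a].
Proof.
move=> sv; rewrite -map_meval -!map_mderiv map_leading // rmorph1.
exact: meval_eq.
Qed.

(** Subtracting the divided equations of two points gives a linear system in the differences of
    [v a], y and z. Modulo e its first row is (2, 0, 0), where 2 is the second derivative of x^2 (x
    - 1)^2 at 1, and its lower right block is antidiagonal with entries -2; the determinant
    specializes to -8. *)
Lemma axis_unique u w r a v v' : near_axis a v -> near_axis a v' ->
  (forall o, jet (rescaled u w e e r) v o = 0) ->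
  (forall o, jet (rescaled u w e e r) v' o = 0) -> v =1 v'.
Proof.
move=> nv nv' h h'; have [b [c abc]] := distinct3_ex a.
have /and3P [ab ac bc] := abc; rewrite eq_sym in ab; rewrite eq_sym in ac.
have [y vb] := nv.2 b ab; have [z vc] := nv.2 c ac.
have [y' vb'] := nv'.2 b ab; have [z' vc'] := nv'.2 c ac.
pose q := leading u w e 1 1 1 r.
have [qa qb qc] := near_axis_deriv abc vb vc h.
have [qa' qb' qc'] := near_axis_deriv abc vb' vc' h'.
have stv i : st (v i) = st (v' i) by rewrite (st_near_axis nv) (st_near_axis nv').
have T d := taylor1 q^`M(d) stv.
have [ma Ea Ma] := T a; have [mb Eb _] := T b; have [mc Ec _] := T c.
rewrite (distinct3_sum _ abc) vb vb' vc vc' qa qa' in Ea.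
rewrite (distinct3_sum _ abc) vb vb' vc vc' qb qb' in Eb.
rewrite (distinct3_sum _ abc) vb vb' vc vc' qc qc' in Ec.
have Ca : ma a * (v a - v' a) + e * (ma b - z *+ 2) * (y - y')
    + e * (ma c - y' *+ 2) * (z - z') = 0.
  transitivity (((v a - v' a) * ma a + (e * y - e * y') * ma b
     + (e * z - e * z') * ma c) - (e * y * z *+ 2 - e * y' * z' *+ 2)); first by ring.
  by rewrite Ea subrr.
have Cb : (mb a - z *+ 2) * (v a - v' a) + e * mb b * (y - y')
    + (e * mb c - v' a *+ 2) * (z - z') = 0.
  transitivity (((v a - v' a) * mb a + (e * y - e * y') * mb b
     + (e * z - e * z') * mb c) - (v a * z *+ 2 - v' a * z' *+ 2)); first by ring.
  by rewrite Eb subrr.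
have Cc : (mc a - y *+ 2) * (v a - v' a) + (e * mc b - v' a *+ 2) * (y - y')
    + e * mc c * (z - z') = 0.
  transitivity (((v a - v' a) * mc a + (e * y - e * y') * mc b
     + (e * z - e * z') * mc c) - (v a * y *+ 2 - v' a * y' *+ 2)); first by ring.
  by rewrite Ec subrr.
have [] := cramer3 Ca Cb Cc.
set D := (X in X * _); have stD : st D != 0.
  have : - 8%:R != 0 :> K by rewrite oppr_eq0 pnatr_eq0.
  congr (_ != _); rewrite /D !(rmorphD, rmorphN, rmorphM, rmorphMn) st_e nv'.1.
  by rewrite Ma (st_leading_hess _ _ _ _ _ (st_near_axis nv')) hess_limit_form; ring.
move=> /(sp_unit_eq0 sp stD) /eqP; rewrite subr_eq0 => /eqP ea.
move=> /(sp_unit_eq0 sp stD) /eqP; rewrite subr_eq0 => /eqP eb.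
move=> /(sp_unit_eq0 sp stD) /eqP; rewrite subr_eq0 => /eqP ec.
by move=> i; case: (distinct3P abc i) => ->; rewrite ?vb ?vb' ?vc ?vc' ?ea ?eb ?ec.
Qed.

Lemma det_hess_deformation u w s s1 r v : s != 0 -> s * s1 = e * e ->
  F5 \mPo scale_by s = (s ^+ 5)%:MP * r ->
  \det (hess (deformation u w) (fun a => s * v a))
  = s ^+ 3 * \det (hess (rescaled u w s s1 r) v).
Proof.
move=> s0 ss1 hr; rewrite -detZ; congr (\det _); apply/matrixP => i j.
by rewrite !mxE (hess_deformation _ _ _ _ _ s0 ss1 hr).
Qed.

Lemma cayley_hess u w o :
  \det (hess (deformation u w) (fun a => e * e * sgn O o a)) != 0.
Proof.
have [r hr] := rescaled_rest (e * e).
have ee0 : e * e != 0 by exact: (sp_mul_neq0 sp).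
rewrite (det_hess_deformation _ _ _ ee0 (mulr1 _) hr).
have s0 : st (e * e) = 0 by rewrite rmorphM st_e mul0r.
have sv i : st (sgn O o i) = sgn K o i.
  by case: o => [a|] /=; rewrite /sgn; [case: ifP => _|]; rewrite ?rmorphN rmorph1.
apply: (sp_mul_neq0 sp); first by rewrite !exprS expr0 !(sp_mul_neq0 sp) ?oner_eq0.
suff : st (\det (hess (rescaled u w (e * e) 1 r) (sgn O o))) != 0.
  by apply: contraNneq => ->; rewrite rmorph0.
have : - 32%:R != 0 :> K by rewrite oppr_eq0 pnatr_eq0.
congr (_ != _); rewrite det3 !mxE !(rmorphD, rmorphN, rmorphM).
rewrite !(st_hess_node _ _ _ _ _ s0 sv) !eqxx !i3E (_ : o2 = third o0 o1) // sgn_third //.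
have := sgn_sqr K o o0; have := sgn_sqr K o o1.
set x := sgn K o o0; set y := sgn K o o1 => yy xx.
transitivity (8%:R * (1 - (x * x) * (y * y) * (y * y) - (x * x) * (y * y)
   - (x * x) * (x * x) * (y * y)
   - (x * x) * (x * x) * (y * y) * (y * y) *+ 2) : K).
  by rewrite yy xx; ring.
by ring.
Qed.

(** The rescaled Hessian is singular modulo e, because its row [a] is a multiple of e. Removing this
    single factor from the determinant leaves [D], which specializes to 2 * (-4) = -8. *)
Lemma axis_hess u w a :
  \det (hess (deformation u w) (fun b => e * axis_point a b)) != 0.
Proof.
have [r hr] := rescaled_rest e.
rewrite (det_hess_deformation _ _ _ e_neq0 erefl hr).
apply: (sp_mul_neq0 sp).
  by rewrite !exprS expr0 mulr1 !(sp_mul_neq0 sp).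
have [b [c abc]] := distinct3_ex a.
have /and3P [ab ac bc] := abc; rewrite eq_sym in ab; rewrite eq_sym in ac.
pose q i j := (leading u w e 1 1 1 r)^`M(i)^`M(j).@[axis_point a].
have ent i j : hess (rescaled u w e e r) (axis_point a) i j =
   - ((if j == i then 0 else axis_point a (third i j)) *+ 2) + e * q i j.
  rewrite mxE rescaled_diag /q; move: (leading u w e 1 1 1 r) => L.
  rewrite !(mderivD, mderivN, mderivMn, mderiv_mulC) xyz_deriv cofac_deriv !evalE.
  by case: ifP => _; rewrite ?meval0 ?mevalXU.
have [bca cab] := distinct3_rot abc.
have t1 : third b a = c by rewrite thirdC (distinct3_third abc).
have t2 : third c a = b by rewrite (distinct3_third cab).
have t3 : third c b = a by rewrite thirdC (distinct3_third bca).
rewrite (distinct3_det _ abc) !ent !eqxx (negPf ab) (negPf ac) (negPf bc).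
rewrite ![a == _]eq_sym (negPf ab) (negPf ac) [c == b]eq_sym (negPf bc).
rewrite t1 t2 t3 (distinct3_third abc) (distinct3_third bca) [third a c]thirdC t2.
rewrite /axis_point eqxx (negPf ab) (negPf ac).
set sb := axis_slope a b; set sc := axis_slope a c.
pose D := q a a * ((e * q b b) * (e * q c c)
             - (e * q b c - 2%:R) * (e * q c b - 2%:R))
  - (q a b - sc *+ 2) * (e * (q b a - sc *+ 2) * (e * q c c)
             - (e * q b c - 2%:R) * (e * (q c a - sb *+ 2)))
  + (q a c - sb *+ 2) * (e * (q b a - sc *+ 2) * (e * q c b - 2%:R)
             - (e * q b b) * (e * (q c a - sb *+ 2))).
rewrite (_ : _ + _ = e * D); last by rewrite /D; ring.
apply: (sp_mul_neq0 sp) => //.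
suff : st D != 0 by apply: contraNneq => ->; rewrite rmorph0.
have : - 8%:R != 0 :> K by rewrite oppr_eq0 pnatr_eq0.
congr (_ != _); rewrite /D !(rmorphD, rmorphN, rmorphM, rmorphMn) st_e /=.
by rewrite (st_leading_hess _ _ _ _ _ (st_axis_point a)) hess_limit_form rmorph1; ring.
Qed.

(* Away from the scale e^2 of the Cayley cubic, a singular point is close to
   an axis, at distance asymptotic to e. *)
Lemma critical_point_axis u w s s1 r a v : s != 0 -> s * s1 = e * e ->
  st s = 0 -> st s1 = 0 -> v a = 1 ->
  (forall o, jet (rescaled u w s s1 r) v o = 0) ->
  exists V, near_axis a V /\ forall i, s * v i = e * V i.
Proof.
move=> s0 ss1 sts sts1 va h; have [b [c abc]] := distinct3_ex a.
have [bca cab] := distinct3_rot abc.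
(* The scale s is unknown relative to e, so the equation is compared with the largest of e, s and
   s1, which is infinitesimal as all three are. *)
have [m [e' [s' [s1' [em sm s1m one mes]]]]] := sp_max3 sp e s s1.
have stm : st m = 0 by case/or3P: mes => /eqP ->.
have m0 : m != 0 by apply: contraNneq s0 => m0; rewrite sm m0 mul0r.
pose L := leading u w m e' s' s1' r.
have hL o : m * jet L v o = jet (xyz O) v o *+ 2.
  have := h o; rewrite sm s1m (rescaled_leading u w s' s1' r em)
    jetD jetN jetMn jetCM => ho.
  by rewrite -[RHS]addr0 -[X in _ = _ + X]ho /L; ring.
have [x0 xa xb xc] := jet_xyz v abc.
have [k k2] := sp_two_unit.
(* As [v a = 1], the derivatives of xyz along [c] and [b] are [v b] and [v c]; the critical
   equations therefore make both of them multiples of m. *)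
pose wb := k * jet L v (Some c); pose wc := k * jet L v (Some b).
have vb : v b = m * wb.
  by apply: sp_double_inj; rewrite -[v b]mul1r -va -xc -hL /wb -[LHS]mul1r -k2; ring.
have vc : v c = m * wc.
  by apply: sp_double_inj; rewrite -[v c]mul1r -va -xb -hL /wc -[LHS]mul1r -k2; ring.
have sv i : st (v i) = evec K a i.
  have /and3P [ab ac _] := abc.
  rewrite /evec; case: (distinct3P abc i) => ->.
  - by rewrite va rmorph1 eqxx.
  - by rewrite vb rmorphM stm mul0r eq_sym (negPf ab).
  - by rewrite vc rmorphM stm mul0r eq_sym (negPf ac).
have stL o : st (jet L v o) = jet (limit_form (st e') (st s') (st s1')) (evec K a) o.
  by rewrite -map_jet map_leading // (jet_eq _ _ sv).
(* The value and the [a]-derivative of xyz are then multiples of m^2, so they still specialize to 0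
   after division by m. *)
have z0 o : o = None \/ o = Some a -> st (jet L v o) = 0.
  move=> ho; have -> : jet L v o = m * wb * wc *+ 2.
    apply: (sp_cancel sp m0); rewrite hL.
    by case: ho => ->; rewrite ?x0 ?xa ?va vb vc; ring.
  by rewrite rmorphMn !rmorphM stm !mul0r mul0rn.
have := z0 _ (or_introl erefl); rewrite stL jet_limit_form => h1.
have := z0 _ (or_intror erefl); rewrite stL jet_limit_form eqxx => h2.
(* The limits of e', s' and s1' coincide; as one of the three equals 1, all have limit 1. Hence e'
   is a unit and s / e has limit 1. *)
have [es1 s1s'] := limit_ratio h1 h2.
have st1 : st s' = 1.
  case/or3P: one => /eqP E; last by rewrite -s1s' E rmorph1.
    by rewrite -es1 E rmorph1.
  by rewrite E rmorph1.
have [e'i [ee ste]] : exists y, e' * y = 1 /\ st y = (st e')^-1.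
  by apply: (sp_inv sp); rewrite es1 st1 oner_eq0.
have sE : s = e * (e'i * s') by rewrite em sm -[m in LHS]mulr1 -ee; ring.
have mE : m = e * e'i by rewrite em -[LHS]mulr1 -ee mulrA.
exists (fun i => e'i * s' * v i); split; last by move=> i; rewrite sE; ring.
split; first by rewrite va mulr1 rmorphM ste es1 st1 invr1 mulr1.
have /and3P [ab ac _] := abc.
move=> i ia; case: (distinct3P abc i) ia => -> ia; first by rewrite eqxx in ia.
  by exists (e'i * s' * e'i * wb); rewrite vb mE; ring.
by exists (e'i * s' * e'i * wc); rewrite vc mE; ring.
Qed.

Definition node_point (j : option 'I_3 + 'I_3) (b : 'I_3) : O :=
  match j with inl o => e * e * sgn O o b | inr a => e * axis_point a b end.

Lemma near_axis_point a : near_axis a (axis_point a).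
Proof.
split; first by rewrite st_axis_point // /evec eqxx.
move=> i ia; exists (axis_slope a i).
by rewrite /axis_point (negPf ia).
Qed.

(** The largest coordinate of the point is compared with e^2. If e^2 divides it, or the two differ
    by a unit, the point rescaled by e^2 specializes to a critical point of the Cayley cubic.
    Otherwise the point is much larger than e^2 and [critical_point_axis] applies. *)
Lemma singular_point_is_node u w :
  (forall j o, jet (deformation u w) (node_point j) o = 0) ->
  forall x, (forall i, st (x i) = 0) ->
  (forall o, jet (deformation u w) x o = 0) -> exists j, x =1 node_point j.
Proof.
move=> nodes x x0 hx.
have ee0 : e * e != 0 by exact: (sp_mul_neq0 sp).
have st_ee : st (e * e) = 0 by rewrite rmorphM st_e mul0r.
have [[V hV]|[a [s1 [v [va hv ss1 sts1]]]]] : (exists V, forall i, x i = e * e * V i) \/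
    exists a s1 v, [/\ v a = 1, forall i, x i = x a * v i, x a * s1 = e * e
                     & st s1 = 0].
  have [a [v [va hv]]] := sp_divides_all sp x.
  case: (sp_val sp (x a) (e * e)) => -[t ht]; last first.
    by left; exists (fun i => t * v i) => i; rewrite hv ht mulrA.
  have [t0|tn] := eqVneq (st t) 0; first by right; exists a, t, v.
  have [t' tt] := sp_unit sp tn.
  left; exists (fun i => t' * v i) => i.
  by rewrite hv ht -[x a in LHS]mulr1 -tt; ring.
- have [r hr] := rescaled_rest (e * e).
  have crit z : (forall o, jet (deformation u w) (fun i => e * e * z i) o = 0) ->
      forall o, jet (rescaled u w (e * e) 1 r) z o = 0.
    by move=> hz; apply: (jet_rescaled_eq0 ee0 (mulr1 _) hr).
  have cV := crit V (fun o => etrans (jet_eq _ _ (fun i => esym (hV i))) (hx o)).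
  have [o so] : exists o, (fun i => st (V i)) =1 sgn K o.
    apply: cayley_critical => o; have := congr1 st (cV o).
    by rewrite rmorph0 -map_jet map_rescaled // rmorph1.
  have st_sgn i : st (sgn O o i) = sgn K o i.
    by case: o {so} => [a|] /=; rewrite /sgn; [case: ifP => _|]; rewrite ?rmorphN rmorph1.
  exists (inl o) => i; rewrite hV /=; congr (_ * _).
  by apply: (cayley_unique st_ee so st_sgn cV); exact: (crit _ (nodes (inl o))).
have xa0 : x a != 0.
  by apply/negP => /eqP E; rewrite -ss1 E mul0r eqxx in ee0.
have [r hr] := rescaled_rest (x a).
have hx' o : jet (deformation u w) (fun i => x a * v i) o = 0.
  by rewrite -(jet_eq _ _ hv).
have [V [nV hV]] := critical_point_axis xa0 ss1 (x0 a) sts1 va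
  (jet_rescaled_eq0 xa0 ss1 hr hx').
have [re hre] := rescaled_rest e.
have crit z : (forall o, jet (deformation u w) (fun i => e * z i) o = 0) ->
    forall o, jet (rescaled u w e e re) z o = 0.
  by move=> hz; apply: (jet_rescaled_eq0 e_neq0 erefl hre).
exists (inr a) => i; rewrite hv hV /=; congr (_ * _).
apply: (axis_unique nV (near_axis_point a) (crit _ _) (crit _ (nodes (inr a)))).
by move=> o; rewrite -(jet_eq _ _ hV).
Qed.

Lemma node_point_inj j j' : node_point j =1 node_point j' -> j = j'.
Proof.
have sgn_inj o o' : (forall b, sgn O o b = sgn O o' b) -> o = o'.
  have two0 : (1 : O) <> -1.
    move=> E; have /eqP := congr1 st E; rewrite rmorphN rmorph1 -subr_eq0 opprK.
    by rewrite -mulr2n pnatr_eq0.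
  case: o o' => [a|] [a'|] // H.
  - have [->//|aa] := eqVneq a a'; have := H a; rewrite /= eqxx eq_sym (negPf aa).
    by move=> /two0.
  - have [b [c /and3P [ab _ _]]] := distinct3_ex a.
    by have := H b; rewrite /= (negPf ab) => /esym /two0.
  - have [b [c /and3P [ab _ _]]] := distinct3_ex a'.
    by have := H b; rewrite /= (negPf ab) => /two0.
have cancel2 (x y : O) : e * x = e * y -> x = y by exact: (sp_cancel sp).
have axis1 a b : axis_point a b = 1 -> a = b.
  have [->//|ab E] := eqVneq a b; have := st_axis_point a b.
  rewrite E rmorph1 /evec eq_sym (negPf ab) => /eqP; by rewrite oner_eq0.
have st_axis a o : axis_point a a <> e * sgn O o a.
  move=> /(congr1 st); rewrite st_axis_point rmorphM st_e mul0r /evec eqxx.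
  by move/eqP; rewrite oner_eq0.
case: j j' => [o|a] [o'|a'] H.
- by congr inl; apply: sgn_inj => b; have := H b; rewrite /= -!mulrA => /cancel2 /cancel2.
- by have := H a'; rewrite /= -mulrA => /cancel2 /esym /st_axis.
- by have := H a; rewrite /= -mulrA => /cancel2 /st_axis.
- congr inr; have := H a'; rewrite /= => /cancel2.
  rewrite [RHS]/axis_point eqxx; exact: axis1.
Qed.

(** The Hessian determinants are asserted to be nonzero, not units: they are infinitesimal, which
    matches the collision of all the nodes at the triple point in the limit. *)
Theorem affine_deformation : exists E : {mpoly O[3]},
  exists P : option 'I_3 + 'I_3 -> 'I_3 -> O,
  let g := map_mpoly cst (- (xyz K *+ 2) + f4 + f5) + e%:MP * E in
  [/\ (msize E <= 5)%N,
      injective P,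
      forall j, (forall o, jet g (P j) o = 0) /\ \det (hess g (P j)) != 0
    & forall x, (forall i, st (x i) = 0) -> (forall o, jet g x o = 0) ->
        exists j, x =1 P j].
Proof.
have [u hu] := cayley_nodes.
have [w hw] := axis_nodes u.
have nodes j o : jet (deformation u w) (node_point j) o = 0.
  by case: j => [o'|a]; [exact: hu|exact: hw].
exists (perturbation u w), node_point => g; split.
- exact: msize_perturbation.
- by move=> j j' E; apply: node_point_inj => b; rewrite E.
- by move=> [o|a]; split; [exact: nodes|exact: cayley_hess|exact: nodes|exact: axis_hess].
- exact: singular_point_is_node.
Qed.

End Family.

(** * The ultraproduct of the complex numbers *)

Lemma free_ultrafilter_exists :
  {U : set_system nat | UltraFilter U /\ (eventually `<=` U)%classic}.
Proof. exact: cid (ultraFilterLemma eventually_filter). Qed.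

Definition ae (P : nat -> Prop) : Prop := sval free_ultrafilter_exists P.

Lemma ae_ultra : UltraFilter ae.
Proof. by case: (svalP free_ultrafilter_exists). Qed.

#[local] Instance ae_proper : ProperFilter ae.
Proof. by case: ae_ultra. Qed.

(** * Limits along the ultrafilter *)

Section Ultra.
Variable R : realType.
Local Notation C := (complex R).

Lemma ae_ge N : ae (fun k => (N <= k)%N).
Proof. by apply: (svalP free_ultrafilter_exists).2; exists N. Qed.

Lemma ae_all P : (forall k, P k) -> ae P.
Proof. by move=> h; apply: filterS filterT => k _. Qed.

Lemma aeS (P Q : nat -> Prop) : (forall k, P k -> Q k) -> ae P -> ae Q.
Proof. by move=> PQ; apply: filterS. Qed.

Lemma aeI (P Q : nat -> Prop) : ae P -> ae Q -> ae (fun k => P k /\ Q k).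
Proof. by move=> hP hQ; apply: filterI. Qed.

Lemma ae_or (P : nat -> Prop) : ae P \/ ae (fun k => ~ P k).
Proof. exact: (in_ultra_setVsetC _ ae_ultra). Qed.

Lemma ae_ex (P : nat -> Prop) : ae P -> exists k, P k.
Proof. by move=> /filter_ex [k Pk]; exists k. Qed.

Lemma ae_neg (P : nat -> Prop) : ae P -> ae (fun k => ~ P k) -> False.
Proof. by move=> h1 h2; have [k []] := ae_ex (aeI h1 h2). Qed.

Lemma ae_fin (I : finType) (P : I -> nat -> Prop) :
  (forall i, ae (P i)) -> ae (fun k => forall i, P i k).
Proof.
move=> h; suff H (s : seq I) : ae (fun k => forall i, i \in s -> P i k).
  by apply: aeS (H (enum I)) => k hk i; apply: hk; rewrite mem_enum.
elim: s => [|i s IH]; first exact: ae_all.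
apply: aeS (aeI (h i) IH) => k [hi hs] j; rewrite inE => /orP [/eqP -> //|].
exact: hs.
Qed.

(** When a finite union belongs to an ultrafilter, so does one of its members. This serves to make
    an index that varies with the term constant. *)
Lemma ae_exists (I : finType) (P : I -> nat -> Prop) :
  ae (fun k => exists i, P i k) -> exists i, ae (P i).
Proof.
move=> h; apply: contrapT => nP.
have H i : ae (fun k => ~ P i k) by case: (ae_or (P i)) => // hi; case: nP; exists i.
apply: (ae_neg h); apply: aeS (ae_fin H) => k hk [j]; exact: hk.
Qed.

Definition cvr (u : nat -> R) l := forall d, 0 < d -> ae (fun k => `|u k - l| < d).

Lemma cvr_const c : cvr (fun=> c) c.
Proof. by move=> d d0; apply: ae_all => k; rewrite subrr normr0. Qed.

Lemma cvrN u l : cvr u l -> cvr (fun k => - u k) (- l).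
Proof. by move=> hu d /hu; apply: aeS => k; rewrite -opprD normrN. Qed.

Lemma cvrD u v l m : cvr u l -> cvr v m -> cvr (fun k => u k + v k) (l + m).
Proof.
move=> hu hv d d0; have d2 : 0 < d / 2 by rewrite divr_gt0.
apply: aeS (aeI (hu _ d2) (hv _ d2)) => k [h1 h2].
rewrite opprD addrACA (le_lt_trans (ler_normD _ _)) //.
by rewrite [ltRHS]splitr ltrD.
Qed.

Lemma cvrM u v l m : cvr u l -> cvr v m -> cvr (fun k => u k * v k) (l * m).
Proof.
move=> hu hv d d0.
pose B := `|l| + `|m| + 1; have B0 : 0 < B.
  by rewrite /B; have := normr_ge0 l; have := normr_ge0 m; lra.
have d2 : 0 < Num.min 1 (d / (2 * B)).
  by rewrite lt_min ltr01 divr_gt0 // mulr_gt0.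
apply: aeS (aeI (hu _ d2) (hv _ d2)) => k [].
set a := u k; set b := v k; rewrite !lt_min => /andP [a1 ad] /andP [b1 bd].
have -> : a * b - l * m = (a - l) * b + l * (b - m) by ring.
apply: le_lt_trans (ler_normD _ _) _; rewrite !normrM.
have hb : `|b| <= B.
  have -> : b = (b - m) + m by ring.
  apply: le_trans (ler_normD _ _) _; rewrite /B; have := normr_ge0 l; lra.
have hl : `|l| <= B by rewrite /B; have := normr_ge0 m; lra.
have E : d = d / (2 * B) * B + B * (d / (2 * B)).
  by field; rewrite gt_eqF.
have dB : 0 < d / (2 * B) by rewrite divr_gt0 // mulr_gt0.
rewrite [ltRHS]E; apply: ltr_leD.
  apply: le_lt_trans (_ : `|a - l| * B < _); first by rewrite ler_wpM2l.
  by rewrite ltr_pM2r.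
apply: le_trans (_ : B * `|b - m| <= _); first by rewrite ler_wpM2r.
by rewrite ler_wpM2l // ltW.
Qed.

Lemma cvr_uniq u l m : cvr u l -> cvr u m -> l = m.
Proof.
move=> hl hm; apply/eqP; rewrite -subr_eq0 -normr_eq0; apply/negPn/negP => n0.
have d0 : 0 < `|l - m| / 2 by rewrite divr_gt0 // lt_neqAle eq_sym n0 normr_ge0.
have [k [h1 h2]] := ae_ex (aeI (hl _ d0) (hm _ d0)).
have : `|l - m| < `|l - m|.
  have -> : l - m = - (u k - l) + (u k - m) by ring.
  apply: le_lt_trans (ler_normD _ _) _; rewrite normrN.
  have -> : - (u k - l) + (u k - m) = l - m by ring.
  by rewrite [ltRHS]splitr ltrD.
by rewrite ltxx.
Qed.

Lemma cvr_ae u v l : ae (fun k => u k = v k) -> cvr u l -> cvr v l.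
Proof. by move=> uv hu d /hu h; apply: aeS (aeI uv h) => k [->]. Qed.

(** The limit is the supremum of the numbers that are lower bounds almost everywhere. The
    ultrafilter decides whether u k < sup + d holds almost everywhere, and the negation would exceed
    the supremum. *)
Lemma cvr_bounded u B : ae (fun k => `|u k| <= B) -> exists l, cvr u l.
Proof.
move=> hB; pose S := [set r : R | ae (fun k => r <= u k)]%classic.
have S0 : S (- B) by apply: aeS hB => k; rewrite ler_norml => /andP [].
have Sub : ubound S B.
  move=> r hr; have [k [h1 h2]] := ae_ex (aeI hr hB).
  by apply: le_trans h1 _; apply: le_trans (ler_norm _) h2.
have hsup : has_sup S by split; [exists (- B)|exists B].
exists (sup S) => d d0.
have [r Sr hr] := sup_adherent d0 hsup.
have nS : ae (fun k => u k < sup S + d).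
  case: (ae_or (fun k => u k < sup S + d)) => // h.
  have : S (sup S + d) by apply: aeS h => k /negP; rewrite -leNgt.
  move/(ub_le_sup hsup.2); rewrite gerDl leNgt d0; done.
apply: aeS (aeI Sr nS) => k [h1 h2]; rewrite ltr_norml; lra.
Qed.

Local Notation Re := (@complex.Re R).
Local Notation Im := (@complex.Im R).

Definition cvc (u : nat -> C) (l : C) :=
  cvr (fun k => Re (u k)) (Re l) /\ cvr (fun k => Im (u k)) (Im l).

Lemma cvc_const c : cvc (fun=> c) c.
Proof. by split; apply: cvr_const. Qed.

Lemma cvcB u v l m : cvc u l -> cvc v m -> cvc (fun k => u k - v k) (l - m).
Proof.
case=> u1 u2 [v1 v2]; rewrite /cvc !raddfB; split.
  by have := cvrD u1 (cvrN v1); apply: cvr_ae; apply: ae_all => k; rewrite raddfB.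
by have := cvrD u2 (cvrN v2); apply: cvr_ae; apply: ae_all => k; rewrite raddfB.
Qed.

Lemma cvcM u v l m : cvc u l -> cvc v m -> cvc (fun k => u k * v k) (l * m).
Proof.
case=> u1 u2 [v1 v2]; split.
  have -> : Re (l * m) = Re l * Re m - Im l * Im m by case: l {u1 u2}; case: m {v1 v2}.
  have := cvrD (cvrM u1 v1) (cvrN (cvrM u2 v2)); apply: cvr_ae; apply: ae_all => k.
  by case: (u k); case: (v k).
have -> : Im (l * m) = Re l * Im m + Im l * Re m by case: l {u1 u2}; case: m {v1 v2}.
have := cvrD (cvrM u1 v2) (cvrM u2 v1); apply: cvr_ae; apply: ae_all => k.
by case: (u k); case: (v k).
Qed.

Lemma cvc_uniq u l m : cvc u l -> cvc u m -> l = m.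
Proof.
case=> l1 l2 [m1 m2]; apply/eqP; rewrite eq_complex.
by rewrite (cvr_uniq l1 m1) (cvr_uniq l2 m2) !eqxx.
Qed.

Lemma cvc_ae u v l : ae (fun k => u k = v k) -> cvc u l -> cvc v l.
Proof.
move=> uv [h1 h2].
by split; [apply: cvr_ae h1|apply: cvr_ae h2]; apply: aeS uv => k ->.
Qed.

Local Notation normc := (@ComplexField.Normc.normc R).

Lemma normc_nneg (z : C) : 0 <= normc z.
Proof. by case: z => a b; apply: sqrtr_ge0. Qed.

Lemma Re_le_normc (z : C) : `|Re z| <= normc z.
Proof.
by case: z => a b /=; rewrite -sqrtr_sqr ler_wsqrtr // lerDl sqr_ge0.
Qed.

Lemma Im_le_normc (z : C) : `|Im z| <= normc z.
Proof.
by case: z => a b /=; rewrite -sqrtr_sqr ler_wsqrtr // lerDr sqr_ge0.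
Qed.

Lemma cvc_bounded u B : ae (fun k => normc (u k) <= B) -> exists l, cvc u l.
Proof.
move=> hB.
have [a ha] : exists a, cvr (fun k => Re (u k)) a.
  by apply: (@cvr_bounded _ B); apply: aeS hB => k; apply: le_trans (Re_le_normc _).
have [b hb] : exists b, cvr (fun k => Im (u k)) b.
  by apply: (@cvr_bounded _ B); apply: aeS hB => k; apply: le_trans (Im_le_normc _).
by exists (Complex a b).
Qed.

End Ultra.

(** * The valuation ring of convergent sequences modulo equality almost everywhere *)

Section UltraRing.
Variable R : realType.
Local Notation C := (complex R).

(** Bounded sequences converge along the ultrafilter, so the quotient below is the ring of finite
    elements of the ultrapower of the complex numbers. *)
Definition convergent : pred (nat -> C) := fun u => `[< exists l, cvc u l >].

Lemma convergent_subring : subring_closed convergent.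
Proof.
split.
- by apply/asboolP; exists 1; apply: cvc_const.
- move=> u v /asboolP [l hl] /asboolP [m hm]; apply/asboolP.
  by exists (l - m); apply: cvcB.
- move=> u v /asboolP [l hl] /asboolP [m hm]; apply/asboolP.
  by exists (l * m); apply: cvcM.
Qed.

HB.instance Definition _ :=
  GRing.isSubringClosed.Build (nat -> C) convergent convergent_subring.

Record cseq := CSeq { cseq_val :> nat -> C; _ : convergent cseq_val }.
HB.instance Definition _ := [isSub for cseq_val].
HB.instance Definition _ := [Choice of cseq by <:].
HB.instance Definition _ := [SubChoice_isSubComNzRing of cseq by <:].

Definition ae_null : cseq -> bool := fun u => `[< ae (fun k => u k = 0) >].

Lemma ae_null_ideal : idealr_closed ae_null.
Proof.
split.
- by apply/asboolP/ae_all.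
- apply/asboolP => /ae_ex [k] /eqP; by rewrite oner_eq0.
- move=> a u v /asboolP hu /asboolP hv; apply/asboolP.
  apply: aeS (aeI hu hv) => k [h1 h2].
  by rewrite -[LHS]/(a k * u k + v k) h1 h2 mulr0 addr0.
Qed.

HB.instance Definition _ := isIdealr.Build cseq ae_null ae_null_ideal.

Definition ae_null_idealr : idealr cseq := ae_null.
Definition ultra := {ideal_quot ae_null_idealr}.
HB.instance Definition _ := GRing.ComNzRing.on ultra.

Local Open Scope quotient_scope.

Definition cls (u : cseq) : ultra := \pi_ultra u.

Lemma cls_is_zmod : zmod_morphism cls.
Proof. by move=> u v; rewrite /cls rmorphB. Qed.

Lemma cls_is_monoid : monoid_morphism cls.
Proof. by split; [exact: rmorph1|move=> u v; exact: rmorphM]. Qed.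

HB.instance Definition _ := GRing.isZmodMorphism.Build cseq ultra cls cls_is_zmod.
HB.instance Definition _ := GRing.isMonoidMorphism.Build cseq ultra cls cls_is_monoid.

Lemma cls_eq (u v : cseq) : cls u = cls v <-> ae (fun k => u k = v k).
Proof.
have E : (cls u == cls v) = (u - v \in ae_null_idealr).
  by rewrite Quotient.idealrBE.
split=> [/eqP|h].
  rewrite E => /asboolP; apply: aeS => k /eqP.
  by rewrite -[X in X == _]/(u k - v k) subr_eq0 => /eqP.
apply/eqP; rewrite E; apply/asboolP; apply: aeS h => k hk.
by rewrite -[LHS]/(u k - v k) hk subrr.
Qed.

Lemma cls_surj (x : ultra) : exists u, x = cls u.
Proof. by exists (repr x); rewrite /cls reprK. Qed.

Definition term (k : nat) (u : cseq) : C := u k.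
Lemma term_is_zmod k : zmod_morphism (term k). Proof. by []. Qed.

Lemma term_is_monoid k : monoid_morphism (term k). Proof. by []. Qed.

HB.instance Definition _ k := GRing.isZmodMorphism.Build cseq C (term k) (term_is_zmod k).
HB.instance Definition _ k :=
  GRing.isMonoidMorphism.Build cseq C (term k) (term_is_monoid k).

Lemma cseq_cvc (u : cseq) : exists l, cvc u l.
Proof. by case: u => u /= /asboolP. Qed.

Definition clim (u : cseq) : C := sval (cid (cseq_cvc u)).

Lemma climP (u : cseq) : cvc u (clim u).
Proof. exact: svalP (cid (cseq_cvc u)). Qed.

Lemma clim_eq (u : cseq) l : cvc u l -> clim u = l.
Proof. exact: cvc_uniq (climP u). Qed.

Definition st (x : ultra) : C := clim (repr x).

Lemma st_cls u : st (cls u) = clim u.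
Proof.
apply: clim_eq; apply: cvc_ae (climP u).
have : cls u = cls (repr (cls u)) by exact: esym (reprK (cls u)).
by move/cls_eq.
Qed.

Lemma st_is_zmod : zmod_morphism st.
Proof.
move=> x y; have [u ->] := cls_surj x; have [v ->] := cls_surj y.
rewrite -rmorphB !st_cls; apply: clim_eq; exact: cvcB (climP u) (climP v).
Qed.

Lemma st_is_monoid : monoid_morphism st.
Proof.
split; first by rewrite -(rmorph1 cls) st_cls; apply: clim_eq; apply: cvc_const.
move=> x y; have [u ->] := cls_surj x; have [v ->] := cls_surj y.
rewrite -rmorphM !st_cls; apply: clim_eq; exact: cvcM (climP u) (climP v).
Qed.

HB.instance Definition _ := GRing.isZmodMorphism.Build ultra C st st_is_zmod.
HB.instance Definition _ := GRing.isMonoidMorphism.Build ultra C st st_is_monoid.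

Lemma convergentP (u : nat -> C) l : cvc u l -> convergent u.
Proof. by move=> h; apply/asboolP; exists l. Qed.

Definition cconst (c : C) : cseq := CSeq (convergentP (cvc_const c)).
Lemma cconst_is_zmod : zmod_morphism cconst.
Proof. by move=> a b; apply: val_inj. Qed.

Lemma cconst_is_monoid : monoid_morphism cconst.
Proof. by split=> [|a b]; apply: val_inj. Qed.

HB.instance Definition _ := GRing.isZmodMorphism.Build C cseq cconst cconst_is_zmod.
HB.instance Definition _ := GRing.isMonoidMorphism.Build C cseq cconst cconst_is_monoid.

Definition cst (c : C) : ultra := cls (cconst c).

Lemma cst_is_zmod : zmod_morphism cst.
Proof. by move=> a b; rewrite /cst -rmorphB; apply/cls_eq/ae_all. Qed.

Lemma cst_is_monoid : monoid_morphism cst.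
Proof.
split; first by rewrite -(rmorph1 cls); apply/cls_eq/ae_all.
by move=> a b; rewrite /cst -rmorphM; apply/cls_eq/ae_all.
Qed.

HB.instance Definition _ := GRing.isZmodMorphism.Build C ultra cst cst_is_zmod.
HB.instance Definition _ := GRing.isMonoidMorphism.Build C ultra cst cst_is_monoid.

Local Notation normc := (@ComplexField.Normc.normc R).

(** The quotient v / u is bounded almost everywhere, hence converges and is itself an element of the
    ring. *)
Lemma ultra_dvd (u v : cseq) B :
  ae (fun k => u k != 0 /\ normc (v k) <= B * normc (u k)) ->
  exists z, cls v = cls u * z.
Proof.
move=> h; have [|l hl] := @cvc_bounded R (fun k => v k / u k) B.
  apply: aeS h => k [u0 uv]; rewrite ComplexField.Normc.normcM ComplexField.Normc.normcV.
  have n0 : 0 < normc (u k).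
    rewrite lt_neqAle eq_sym normc_nneg andbT; apply/eqP => /ComplexField.Normc.eq0_normc.
    by apply/eqP.
  by rewrite ler_pdivrMr.
exists (cls (CSeq (convergentP hl))); rewrite -rmorphM; apply/cls_eq.
by apply: aeS h => k [u0 _]; rewrite -[RHS]/(u k * (v k / u k)) mulrCA divff // mulr1.
Qed.

(** In each case the ultrafilter decides: which of two factors vanishes almost everywhere, or which
    of two norms is the smaller. A nonzero limit keeps a sequence away from 0, so that its inverse
    is bounded. *)
Lemma ultra_specialization : specialization st cst.
Proof.
split.
- by move=> a; rewrite /= /cst st_cls; apply: clim_eq; apply: cvc_const.
- move=> x y; have [u ->] := cls_surj x; have [v ->] := cls_surj y.
  rewrite -rmorphM -(rmorph0 cls) => /cls_eq h.
  case: (ae_or (fun k => u k = 0)) => h0; [left|right]; apply/cls_eq => //.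
  apply: aeS (aeI h h0) => k [/eqP]; rewrite -[X in X == _]/(u k * v k) mulf_eq0.
  by move=> /orP [/eqP //|/eqP].
- move=> x y; have [u ->] := cls_surj x; have [v ->] := cls_surj y.
  case: (ae_or (fun k => u k = 0)) => u0.
    right; exists 0; rewrite mulr0 -(rmorph0 cls); exact/cls_eq.
  case: (ae_or (fun k => v k = 0)) => v0.
    left; exists 0; rewrite mulr0 -(rmorph0 cls); exact/cls_eq.
  case: (ae_or (fun k => normc (v k) <= normc (u k))) => h; [left|right].
    apply: (@ultra_dvd _ _ 1); apply: aeS (aeI u0 h) => k [/eqP ? ?].
    by rewrite mul1r.
  apply: (@ultra_dvd _ _ 1); apply: aeS (aeI v0 h) => k [/eqP ? /negP].
  by rewrite mul1r -ltNge => /ltW.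
- move=> x; have [u ->] := cls_surj x; rewrite /= st_cls => l0.
  have nl : exists2 d, 0 < d & ae (fun k => d <= normc (u k)).
    have [hr hi] := climP u.
    have [r0|r0] := eqVneq (complex.Re (clim u)) 0.
      have i0 : complex.Im (clim u) != 0.
        by apply: contraNneq l0 => i0; rewrite eq_complex r0 i0 !eqxx.
      have d0 : 0 < `|complex.Im (clim u)| / 2 by rewrite divr_gt0 ?normr_gt0.
      exists (`|complex.Im (clim u)| / 2) => //; apply: aeS (hi _ d0) => k hk.
      apply: le_trans (Im_le_normc _).
      have := ler_normD (complex.Im (u k)) (complex.Im (clim u) - complex.Im (u k)).
      rewrite distrC in hk; rewrite addrC subrK; lra.
    have d0 : 0 < `|complex.Re (clim u)| / 2 by rewrite divr_gt0 ?normr_gt0.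
    exists (`|complex.Re (clim u)| / 2) => //; apply: aeS (hr _ d0) => k hk.
    apply: le_trans (Re_le_normc _).
    have := ler_normD (complex.Re (u k)) (complex.Re (clim u) - complex.Re (u k)).
    rewrite distrC in hk; rewrite addrC subrK; lra.
  have [d d0 hd] := nl.
  have [|z hz] := @ultra_dvd u 1 d^-1; last by exists z; rewrite -hz rmorph1.
  apply: aeS hd => k hk; split.
    apply: contraTneq hk => ->; rewrite -ltNge.
    by rewrite ComplexField.Normc.normc0.
  rewrite -[X in normc X]/(1 : C) ComplexField.Normc.normc1.
  by rewrite mulrC ler_pdivlMr // mul1r.
Qed.

Lemma inv_succ_cvc : cvc (fun k => (k.+1%:R^-1 : C)) 0.
Proof.
have E k : (k.+1%:R^-1 : C) = Complex (k.+1%:R^-1) 0.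
  by rewrite -[RHS]/(real_complex R _) fmorphV rmorph_nat.
split=> /=; last first.
  by apply: cvr_ae (cvr_const 0); apply: ae_all => k; rewrite E.
move=> d d0; apply: aeS (ae_ge (Num.truncn d^-1)) => k hk.
rewrite E subr0 ger0_norm ?invr_ge0 //= invf_plt ?posrE ?ltr0n //.
apply: lt_le_trans (truncnS_gt _) _; by rewrite ler_nat.
Qed.

Definition infinitesimal : ultra := cls (CSeq (convergentP inv_succ_cvc)).

Lemma st_infinitesimal : st infinitesimal = 0.
Proof. by rewrite st_cls; apply: clim_eq; apply: inv_succ_cvc. Qed.

Lemma infinitesimal_neq0 : infinitesimal != 0.
Proof.
apply/eqP; rewrite -(rmorph0 cls) => /cls_eq /ae_ex [k] /eqP.
by rewrite /= invr_eq0 pnatr_eq0.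
Qed.

End UltraRing.

(** * Transfer to the Severi variety *)

Section LinearChange.
Variables (n : nat) (K : comNzRingType).

(** Points are row vectors, so this substitution is q |-> q N, and a substitution performed later
    multiplies on the left. *)
Definition lin (N : 'M[K]_n) : n.-tuple {mpoly K[n]} :=
  [tuple \sum_i N i k *: 'X_i | k < n].

Lemma lin_eval (G : {mpoly K[n]}) (N : 'M[K]_n) (q : 'rV[K]_n) :
  (G \mPo lin N).@[q 0] = G.@[(q *m N) 0].
Proof.
rewrite comp_mpoly_meval; apply: meval_eq => k.
rewrite tnth_mktuple (raddf_sum (meval _)) mxE; apply: eq_bigr => i _.
by rewrite /= mevalZ mevalXU mulrC.
Qed.

Lemma lin_deriv (G : {mpoly K[n]}) (N : 'M[K]_n) i :
  (G \mPo lin N)^`M(i) = \sum_k N i k *: (G^`M(k) \mPo lin N).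
Proof.
rewrite mderiv_comp; apply: eq_bigr => k _.
rewrite tnth_mktuple (raddf_sum (mderiv i)) (bigD1 i) //= big1 ?addr0.
  by rewrite mderivZ mderivXU eqxx -mul_mpolyC mulr1 mulrC mul_mpolyC.
by move=> j ji; rewrite mderivZ mderivXU (negPf ji) scaler0.
Qed.

Lemma lin_homog d (G : {mpoly K[n]}) (N : 'M[K]_n) :
  G \is d.-homog -> G \mPo lin N \is d.-homog.
Proof.
move=> /dhomogP hG; rewrite comp_mpolyEX big_seq; apply: rpred_sum => m mG.
apply: rpredZ; rewrite comp_mpolyX.
have <- : mdeg m = d by exact: hG.
rewrite mdegE; elim/big_ind2: _ => [|p d1 q d2 hp hq|k _].
- exact: dhomog1.
- exact: dhomogM.
have h1 : tnth (lin N) k \is 1.-homog.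
  rewrite tnth_mktuple; apply: rpred_sum => i _; apply: rpredZ.
  by rewrite dhomogX /= mdeg1.
by have := dhomogMn (m k) h1; rewrite mul1n.
Qed.

Lemma lin_comp (G : {mpoly K[n]}) (N N' : 'M[K]_n) :
  (G \mPo lin N) \mPo lin N' = G \mPo lin (N' *m N).
Proof.
rewrite comp_mpolyA; congr (G \mPo _); apply: eq_from_tnth => k.
rewrite !tnth_mktuple raddf_sum /=.
under eq_bigr => i _ do rewrite comp_mpolyZ comp_mpoly_tnth tnth_mktuple scaler_sumr.
rewrite exchange_big /=; apply: eq_bigr => j _.
by rewrite mxE scaler_suml; apply: eq_bigr => i _; rewrite scalerA mulrC.
Qed.

Lemma lin1 (G : {mpoly K[n]}) : G \mPo lin 1%:M = G.
Proof.
rewrite -[RHS]comp_mpoly_id; congr (G \mPo _); apply: eq_from_tnth => k.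
rewrite !tnth_mktuple (bigD1 k) //= mxE eqxx scale1r big1 ?addr0 // => i ik.
by rewrite mxE (negPf ik) scale0r.
Qed.

End LinearChange.

Section LinearSeveri.
Variables (n : nat) (K : numClosedFieldType).
Implicit Types (G : {mpoly K[n.+1]}) (N M : 'M[K]_n.+1) (q : 'rV[K]_n.+1).

Lemma local_eq_lin G N M : local_eq (G \mPo lin N) M = local_eq G (M *m N).
Proof.
rewrite /local_eq comp_mpolyA; congr (G \mPo _); apply: eq_from_tnth => k.
rewrite !tnth_mktuple raddf_sum /=.
under eq_bigr => i _ do
  rewrite comp_mpolyZ comp_mpoly_tnth tnth_mktuple scalerDr scaler_sumr.
rewrite big_split /=; congr (_ + _).
  rewrite mxE rmorph_sum /=; apply: eq_bigr => i _.
  by rewrite -mul_mpolyC -rmorphM mulrC.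
rewrite exchange_big /=; apply: eq_bigr => j _.
by rewrite mxE scaler_suml; apply: eq_bigr => i _; rewrite scalerA mulrC.
Qed.

Lemma singular_lin G N q : N \in unitmx ->
  singular_at (G \mPo lin N) q <-> singular_at G (q *m N).
Proof.
have imp G' N' q' : singular_at G' (q' *m N') -> singular_at (G' \mPo lin N') q'.
  move=> [v0 d0]; split; first by rewrite lin_eval.
  move=> i; rewrite lin_deriv (raddf_sum (meval _)) big1 // => k _.
  by rewrite /= mevalZ lin_eval d0 mulr0.
move=> uN; split; last exact: imp.
move=> h; have := imp (G \mPo lin N) (invmx N) (q *m N).
by rewrite mulmxK // lin_comp mulVmx // lin1; apply.
Qed.

Lemma severi_lin d delta G N : N \in unitmx ->
  severi d delta G -> severi d delta (G \mPo lin N).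
Proof.
move=> uN [[hG G0] [P [Pn0 Pd Pnode Pall]]]; split.
  split; first exact: lin_homog.
  apply: contraNneq G0 => E.
  by rewrite -[G]lin1 -(mulVmx uN) -lin_comp E comp_mpoly0.
exists (fun i => P i *m invmx N); split.
- move=> i; apply: contraNneq (Pn0 i) => E.
  by rewrite -[P i](mulmxKV uN) E mul0mx.
- move=> i j ij; apply: contra (Pd i j ij) => /andP [h1 h2].
  rewrite -[P i](mulmxKV uN) -[P j](mulmxKV uN); apply/andP.
  by split; apply: submxMr.
- move=> i; have [M [[uM rM] sM hM]] := Pnode i.
  exists (M *m invmx N); rewrite local_eq_lin mulmxKV //; split => //.
  by split; [rewrite unitmx_mul uM unitmx_inv|rewrite row_mul rM].
- move=> q q0 /(singular_lin _ _ uN) sq.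
  have qN0 : q *m N != 0.
    by apply: contraNneq q0 => E; rewrite -[q](mulmxK uN) E mul0mx.
  have [i /andP [h1 h2]] := Pall _ qN0 sq; exists i; apply/andP.
  by rewrite -[q](mulmxK uN); split; apply: submxMr.
Qed.

End LinearSeveri.

Lemma deriv_homog n d (S : comNzRingType) (p : {mpoly S[n]}) i :
  p \is d.-homog -> p^`M(i) \is d.-1.-homog.
Proof.
move=> /dhomogP hp; apply/dhomogP => m; rewrite mcoeff_msupp mcoeff_deriv => hm.
have /hp /= <- : (m + U_(i))%MM \in msupp p.
  by rewrite mcoeff_msupp; apply: contraNneq hm => ->; rewrite mul0rn.
by rewrite mdegD mdeg1 addn1.
Qed.

Lemma singular_scale n d (K : numClosedFieldType) (G : {mpoly K[n]}) (q : 'rV[K]_n) c :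
  G \is d.-homog ->
  singular_at G q -> singular_at G (c *: q).
Proof.
move=> hG [h0 hd].
have E e (p : {mpoly K[n]}) : p \is e.-homog -> p.@[q 0] = 0 -> p.@[(c *: q) 0] = 0.
  move=> hp p0; rewrite (@meval_eq _ _ _ (fun i => c * q 0 i)) => [|i]; last by rewrite mxE.
  by rewrite (meval_homog _ _ hp) p0 mulr0.
by split=> [|i]; [exact: E hG h0|apply: E (deriv_homog i hG) (hd i)].
Qed.

(** * Nodes in the standard affine chart *)

Section AffineNode.
Variables (n : nat) (K : numClosedFieldType).
Implicit Types (p : 'rV[K]_n.+1).

(** For this frame the chart is a translation in the standard affine coordinates, so derivatives of
    the local equation are plain partial derivatives of the form. *)
Definition affine_frame p : 'M[K]_n.+1 :=
  \matrix_(i, k) if i == 0 then p 0 k else (i == k)%:R.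

Lemma affine_frame_at p : p 0 0 = 1 -> frame_at p (affine_frame p).
Proof.
move=> p0; split; last by apply/rowP => k; rewrite !mxE eqxx.
rewrite unitmxE -det_tr det_trig.
  rewrite big1 ?unitr1 // => i _; rewrite !mxE; case: eqP => [->|_] //.
  by rewrite eqxx.
apply/is_trig_mxP => i j ij; rewrite !mxE; case: eqP => [j0|_].
  by rewrite j0 in ij.
by case: eqP => // ji; rewrite ji ltnn in ij.
Qed.

Lemma local_eq_affine_deriv (G : {mpoly K[n.+1]}) p (i : 'I_n) :
  (local_eq G (affine_frame p))^`M(i)
  = local_eq (G^`M(lift ord0 i)) (affine_frame p).
Proof.
rewrite /local_eq mderiv_comp (bigD1 (lift ord0 i)) //= big1 ?addr0.
  rewrite tnth_mktuple mderivD mderivC add0r (raddf_sum (mderiv i)) (bigD1 i) //=.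
  rewrite big1 ?addr0 => [|j ji]; last by rewrite mderivZ mderivXU (negPf ji) scaler0.
  by rewrite mderivZ mderivXU eqxx mxE /= eqxx scale1r mulr1.
move=> k ki; rewrite tnth_mktuple mderivD mderivC add0r (raddf_sum (mderiv i)) (bigD1 i) //=.
rewrite big1 ?addr0 => [|j ji]; last by rewrite mderivZ mderivXU (negPf ji) scaler0.
by rewrite mxE /= eq_sym (negPf ki) mderivZ scale0r mulr0.
Qed.

Lemma local_eq_affine_eval (G : {mpoly K[n.+1]}) p :
  (local_eq G (affine_frame p)).@[(0 : 'rV[K]_n) 0] = G.@[p 0].
Proof.
rewrite comp_mpoly_meval; apply: meval_eq => k; rewrite tnth_mktuple mevalD mevalC mxE.
rewrite (raddf_sum (meval _)) big1 ?addr0 //= => j _.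
by rewrite mevalZ mevalXU !mxE mulr0.
Qed.

Lemma node_affine (G : {mpoly K[n.+1]}) p : p 0 0 = 1 -> singular_at G p ->
  \det (\matrix_(i < n, j < n) (G^`M(lift ord0 i)^`M(lift ord0 j)).@[p 0]) != 0 ->
  node G p.
Proof.
move=> p0 [v0 d0] hess0; exists (affine_frame p); split.
- exact: affine_frame_at.
- split=> [|i]; first by rewrite local_eq_affine_eval.
  by rewrite local_eq_affine_deriv local_eq_affine_eval.
rewrite unitmxE unitfE; congr (\det _ != 0): hess0; apply/matrixP => i j.
by rewrite !mxE !local_eq_affine_deriv local_eq_affine_eval.
Qed.

End AffineNode.

(** * Passage from the ultraproduct to the terms of a sequence *)

Section Transfer.
Variable R : realType.
Local Notation C := (complex R).
Local Notation O := (ultra R).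
Local Notation cls := (@cls R).
Local Notation st := (@st R).
Local Notation term := (@term R).

Lemma cls_eq0 (u : cseq R) : cls u = 0 <-> ae (fun k => term k u = 0).
Proof. by rewrite -(rmorph0 cls); apply: cls_eq. Qed.

Lemma mpoly_lift n (G : {mpoly O[n]}) :
  exists Gt : {mpoly (cseq R)[n]}, map_mpoly cls Gt = G /\
    forall d, G \is d.-homog -> Gt \is d.-homog.
Proof.
have [lift liftK] := boolp.choice (@cls_surj R).
exists (\sum_(m <- msupp G) lift G@_m *: 'X_[m]); split.
  rewrite [RHS]mpolyE (raddf_sum (map_mpoly cls)); apply: eq_bigr => m _ /=.
  have Z c p : map_mpoly cls (c *: p) = cls c *: map_mpoly cls p :> {mpoly O[n]}.
    rewrite -!mul_mpolyC (rmorphM (map_mpoly cls)) /=; by rewrite map_mpolyCr.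
  by rewrite Z map_mpolyX -liftK.
move=> d /dhomogP hG; rewrite big_seq; apply: rpred_sum => m mG.
by apply: rpredZ; rewrite dhomogX; apply/eqP; exact: hG.
Qed.

Lemma ae_meval_eq0 n (Gt : {mpoly (cseq R)[n]}) (q : 'I_n -> cseq R) :
  (map_mpoly cls Gt).@[fun i => cls (q i)] = 0 <->
  ae (fun k => (map_mpoly (term k) Gt).@[fun i => q i k] = 0).
Proof.
rewrite (map_meval cls Gt q) cls_eq0; split; apply: aeS => k;
  by rewrite -(map_meval (term k) Gt q).
Qed.

(** The counterpart of [singular_at], which is only available over a closed field, for the ring
    [ultra]. *)
Definition usingular n (G : {mpoly O[n]}) (q : 'I_n -> O) :=
  G.@[q] = 0 /\ forall i, (G^`M(i)).@[q] = 0.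

Lemma ae_singular n (Gt : {mpoly (cseq R)[n]}) (q : 'I_n -> cseq R) :
  usingular (map_mpoly cls Gt) (fun i => cls (q i)) <->
  ae (fun k => singular_at (map_mpoly (term k) Gt) (\row_i q i k)).
Proof.
have E k (p : {mpoly C[n]}) : p.@[(\row_i q i k) 0] = p.@[fun i => q i k].
  by apply: meval_eq => i; rewrite mxE.
split=> [[h0 hd]|h].
  have h0' := (ae_meval_eq0 Gt q).1 h0.
  have hd' i : ae (fun k => (map_mpoly (term k) Gt)^`M(i).@[fun i => q i k] = 0).
    have := hd i; rewrite map_mderiv => /ae_meval_eq0.
    by apply: aeS => k; rewrite map_mderiv.
  apply: aeS (aeI h0' (ae_fin hd')) => k [h1 h2].
  by split=> [|i]; rewrite E.
split=> [|i]; first by apply/ae_meval_eq0; apply: aeS h => k [+ _]; rewrite E.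
rewrite map_mderiv; apply/ae_meval_eq0; apply: aeS h => k [_ /(_ i)].
by rewrite E map_mderiv.
Qed.

Local Notation normc := (@ComplexField.Normc.normc R).

(** Division by a coordinate of largest norm. The bound by 1 makes a sequence of normalized points
    converge, hence define a point over [ultra]. *)
Lemma normalize_row n (q : 'rV[C]_n) : q != 0 -> exists c i,
  [/\ c != 0, (c *: q) 0 i = 1 & forall a, normc ((c *: q) 0 a) <= 1].
Proof.
move=> q0; have [i0 _] : exists i : 'I_n, True.
  apply: contrapT => h; case/eqP: q0; apply/rowP => i; by case: h; exists i.
have [i _ imax] := @Order.TotalTheory.arg_maxP _ _ _ i0 predT (fun i => normc (q 0 i)) isT.
have qi0 : q 0 i != 0.
  apply: contraNneq q0 => qi; apply/eqP/rowP => a; rewrite mxE.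
  apply: ComplexField.Normc.eq0_normc; apply/eqP.
  rewrite eq_le normc_nneg andbT -(ComplexField.Normc.normc0 R) -qi.
  exact: imax.
exists (q 0 i)^-1, i; split; first by rewrite invr_eq0.
  by rewrite mxE mulVf.
move=> a; rewrite mxE ComplexField.Normc.normcM ComplexField.Normc.normcV mulrC.
rewrite ler_pdivrMr ?mul1r; first exact: imax.
rewrite lt_neqAle normc_nneg andbT eq_sym; apply: contraNneq qi0.
by move/ComplexField.Normc.eq0_normc ->.
Qed.

Lemma map_mpoly_homog n d (S T : comNzRingType) (f : {rmorphism S -> T})
  (p : {mpoly S[n]}) : p \is d.-homog -> map_mpoly f p \is d.-homog.
Proof.
move=> /dhomogP hp; apply/dhomogP => m; rewrite mcoeff_msupp mcoeff_map_mpoly => h.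
apply: hp; rewrite mcoeff_msupp; apply: contraNneq h => ->; exact/eqP/raddf0.
Qed.

Lemma bounded_cseq (u : nat -> C) : ae (fun k => normc (u k) <= 1) ->
  exists v : cseq R, forall k, v k = u k.
Proof. by move=> /cvc_bounded [l hl]; exists (CSeq (convergentP hl)). Qed.

(** A transfer principle. What concerns the given points is a finite set of equations and
    inequations, valid in almost every term. Completeness quantifies over all points of each term;
    it transfers because a sequence of counterexamples, once normalized, is a point over [ultra]. *)
Lemma ae_severi n d (J : finType) (Gt : {mpoly (cseq R)[n.+1]})
    (P : J -> 'I_n.+1 -> cseq R) (G := map_mpoly cls Gt) :
  Gt \is d.-homog -> G != 0 ->
  (forall j, cls (P j ord0) = 1) ->
  (forall j, usingular G (fun a => cls (P j a))) ->
  (forall j, \det (\matrix_(i < n, j' < n)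
    (G^`M(lift ord0 i)^`M(lift ord0 j')).@[fun a => cls (P j a)]) != 0) ->
  (forall j j', j != j' -> exists a, cls (P j a) != cls (P j' a)) ->
  (forall q, (exists a, q a = 1) -> usingular G q ->
     exists j, forall a, q a = q ord0 * cls (P j a)) ->
  ae (fun k => severi d #|J| (map_mpoly (term k) Gt)).
Proof.
move=> hGt G0 P0 Ps Ph Pd Pu.
pose row k j : 'rV[C]_n.+1 := \row_a P j a k.
have rowE k j (p : {mpoly C[n.+1]}) : p.@[(row k j) 0] = p.@[fun a => P j a k].
  by apply: meval_eq => a; rewrite mxE.
have a0 : ae (fun k => forall j, P j ord0 k = 1).
  apply: ae_fin => j; have := P0 j; rewrite -(rmorph1 cls) => /cls_eq; exact: aeS.
have a1 : ae (fun k => map_mpoly (term k) Gt != 0).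
  have [m hm] : exists m, G@_m != 0.
    apply: contrapT => h; case/eqP: G0; apply/mpolyP => m; rewrite mcoeff0.
    by apply/eqP/negPn/negP => hm; apply: h; exists m.
  case: (ae_or (fun k => map_mpoly (term k) Gt != 0)) => // h.
  case/eqP: hm; rewrite mcoeff_map_mpoly; apply/cls_eq0; apply: aeS h => k /negP.
  by rewrite negbK => /eqP E; rewrite -(mcoeff_map_mpoly (term k)) E mcoeff0.
have a2 : ae (fun k => forall j, singular_at (map_mpoly (term k) Gt) (row k j)).
  by apply: ae_fin => j; apply/ae_singular.
have a3 : ae (fun k => forall j, \det (\matrix_(i < n, j' < n)
    ((map_mpoly (term k) Gt)^`M(lift ord0 i)^`M(lift ord0 j')).@[(row k j) 0]) != 0).
  apply: ae_fin => j.
  pose M := \matrix_(i < n, j' < n) (Gt^`M(lift ord0 i)^`M(lift ord0 j')).@[P j].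
  have E (S : comNzRingType) (f : {rmorphism cseq R -> S}) :
      \det (\matrix_(i < n, j' < n)
      ((map_mpoly f Gt)^`M(lift ord0 i)^`M(lift ord0 j')).@[fun a => f (P j a)])
      = f (\det M).
    rewrite -det_map_mx; congr (\det _); apply/matrixP => i j'.
    by rewrite !mxE !map_mderiv (map_meval f _ (P j)).
  have := Ph j; rewrite /G E => hdet.
  case: (ae_or (fun k => term k (\det M) != 0)) => h; last first.
    case/eqP: hdet; apply/cls_eq0; apply: aeS h => k /negP.
    by rewrite negbK => /eqP.
  apply: aeS h => k; rewrite -E; congr (\det _ != 0); apply/matrixP => i j'.
  by rewrite !mxE rowE.
have a4 : ae (fun k => forall jj : J * J, jj.1 != jj.2 ->
    exists a, P jj.1 a k != P jj.2 a k).
  apply: ae_fin => -[j j'] /=; case: eqVneq => [_|/Pd [a ha]]; first exact: ae_all.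
  case: (ae_or (fun k => P j a k = P j' a k)) => [/cls_eq /eqP|].
    by rewrite (negPf ha).
  by apply: aeS => k /eqP h _; exists a.
pose bad k (q : 'rV[C]_n.+1) := singular_at (map_mpoly (term k) Gt) q /\
  ~ exists j, forall a, q 0 a = q 0 ord0 * P j a k.
have a5 : ae (fun k => forall q, q != 0 -> ~ bad k q).
  case: (ae_or (fun k => forall q, q != 0 -> ~ bad k q)) => // h.
  (* Suppose that almost every term has a singular point outside the list. A normalized one is
     chosen in each such term; the default 0 of [xget] only occurs in the other terms. *)
  pose Q k : set 'rV[C]_n.+1 := fun q => bad k q /\ exists i,
      q 0 i = 1 /\ forall a, normc (q 0 a) <= 1.
  pose q k := xget 0 (Q k).
  have hq : ae (fun k => exists i, Q k (q k) /\ (q k) 0 i = 1).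
    apply: aeS h => k /existsNP [q0 /not_implyP [q0n0 /contrapT [sq nq]]].
    have [c [i [c0 qi qa]]] := normalize_row q0n0.
    have Qq : Q k (q k).
      apply: xgetPex; exists (c *: q0); split; last by exists i.
      split; first exact: singular_scale (map_mpoly_homog _ hGt) sq.
      move=> [j hj]; apply: nq; exists j => a; apply: (mulfI c0).
      by have := hj a; rewrite !mxE mulrA.
    by have [_ [i' [qi' _]]] := Qq; exists i'.
  (* The position of the coordinate equal to 1 depends on the term; there are finitely many
     positions, so one of them occurs almost everywhere. *)
  have [i hi] := ae_exists hq.
  have qv a : exists v : cseq R, ae (fun k => v k = q k 0 a).
    have hb : ae (fun k => normc (q k 0 a) <= 1).
      by apply: aeS hi => k [[_ [_ [_ +]]] _]; exact.
    have [v hv] := bounded_cseq hb; exists v; exact: ae_all.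
  have [v hv] := boolp.choice qv.
  have vq : ae (fun k => \row_a v a k = q k).
    by apply: aeS (ae_fin hv) => k hk; apply/rowP => a; rewrite mxE hk.
  have vi : cls (v i) = 1.
    rewrite -(rmorph1 cls); apply/cls_eq; apply: aeS (aeI (hv i) hi) => k [-> [_ ->]].
    by [].
  have sv : usingular G (fun a => cls (v a)).
    by apply/ae_singular; apply: aeS (aeI vq hi) => k [-> [[[]]]].
  have [j hj] := Pu _ (ex_intro _ i vi) sv.
  exfalso; apply: (ae_neg hi).
  have hj' : ae (fun k => forall a, v a k = v ord0 k * P j a k).
    by apply: ae_fin => a; have := hj a; rewrite -rmorphM => /cls_eq.
  apply: aeS (aeI (ae_fin hv) hj') => k [hk hjk] [[[_ +] _] _]; apply.
  by exists j => a; rewrite -!hk.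
apply: aeS (aeI a0 (aeI a1 (aeI a2 (aeI a3 (aeI a4 a5))))).
move=> k [h0 [h1 [h2 [h3 [h4 h5]]]]].
have row0 j : row k j 0 0 = 1 by rewrite mxE h0.
have rown0 j : row k j != 0.
  by apply/eqP => /rowP /(_ 0); rewrite row0 mxE => /eqP; rewrite oner_eq0.
split; first by split=> //; exact: map_mpoly_homog.
exists (fun i => row k (enum_val i)); split=> [i //|i j ij|i|q q0 sq].
- apply/negP => /andP [/sub_rVP [c E] _].
  have [|a] := h4 (enum_val i, enum_val j); first by rewrite (inj_eq enum_val_inj).
  have c1 : c = 1 by move/rowP/(_ 0): (E); rewrite [RHS]mxE !row0 mulr1.
  by move/rowP/(_ a): E; rewrite c1 !mxE mul1r => -> /eqP.
- exact: node_affine.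
have /contrapT [j hj] : ~ ~ exists j, forall a, q 0 a = q 0 ord0 * P j a k.
  by move=> nj; apply: (h5 q q0).
have qE : q = q 0 0 *: row k j by apply/rowP => a; rewrite !mxE hj.
have q00 : q 0 0 != 0 by apply: contraNneq q0 => z; rewrite qE z scale0r.
exists (enum_rank j); rewrite enum_rankK; apply/andP; split.
  by rewrite {1}qE scalemx_sub.
have -> : row k j = (q 0 0)^-1 *: q by rewrite {2}qE scalerA mulVf // scale1r.
exact: scalemx_sub.
Qed.

(** A form vanishing on the Severi variety vanishes at almost every term of the family, hence is
    zero at the coefficients taken in [ultra]; specialization carries this to F. The matrix [N]
    brings the family back to the original coordinates. *)
Lemma in_closure_ultra n d (J : finType) (G : {mpoly O[n.+1]})
    (P : J -> 'I_n.+1 -> O) (F : {mpoly C[n.+1]}) (N : 'M[C]_n.+1) :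
  N \in unitmx -> G \is d.-homog -> map_mpoly st G = F -> F != 0 ->
  (forall j, P j ord0 = 1) ->
  (forall j, usingular G (P j)) ->
  (forall j, \det (\matrix_(i < n, j' < n)
    (G^`M(lift ord0 i)^`M(lift ord0 j')).@[P j]) != 0) ->
  (forall j j', j != j' -> exists a, P j a != P j' a) ->
  (forall q, (exists a, q a = 1) -> usingular G q ->
     exists j, forall a, q a = q ord0 * P j a) ->
  in_closure d (severi d #|J|) (F \mPo lin N).
Proof.
move=> uN hG stG F0 P0 Ps Ph Pd Pu.
have [Gt [clsG homGt]] := mpoly_lift G.
have [lft lftK] := boolp.choice (@cls_surj R).
pose Pt j a := lft (P j a).
have PtE j : (fun a => cls (Pt j a)) =1 P j by move=> a; rewrite -lftK.
have G0 : G != 0 by apply: contraNneq F0 => G0; rewrite -stG G0 rmorph0.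
have hs : ae (fun k => severi d #|J| (map_mpoly (term k) Gt)).
  apply: (@ae_severi _ _ _ _ Pt); rewrite ?clsG //.
  - exact: homGt.
  - by move=> j; rewrite -lftK.
  - by move=> j; have [h0 hd] := Ps j; split=> [|i]; rewrite (meval_eq _ (PtE j)).
  - move=> j; apply: contraNneq (Ph j) => <-; apply/eqP; congr (\det _).
    by apply/matrixP => i j'; rewrite !mxE (meval_eq _ (PtE j)).
  - by move=> j j' /Pd [a ha]; exists a; rewrite -!lftK.
  - move=> q q1 sq; have [j hj] := Pu q q1 sq; exists j => a.
    by rewrite -lftK.
move=> d' H hH Hzero.
pose GN := Gt \mPo lin (map_mx (@cconst R) N).
(* The value of [H] along the family, as one sequence: its terms are the values at the members of
   the family, and its limit is the value at the surface to be approximated. *)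
pose x : cseq R :=
  (map_mpoly (@cconst R) H).@[(fun i => GN@_(enum_val i : 'X_{1..n.+1 < d.+1}))].
have xE (f : {rmorphism cseq R -> C}) : (forall c, f (cconst c) = c) ->
    f x = H.@[(coefs d (map_mpoly f Gt \mPo lin N)) 0].
  move=> fc; rewrite /x -map_meval.
  have -> : map_mpoly f (map_mpoly (@cconst R) H) = H.
    by apply/mpolyP => m; rewrite !mcoeff_map_mpoly /=; exact: fc.
  have GNE : map_mpoly f GN = map_mpoly f Gt \mPo lin N.
    have linE : [tuple map_mpoly f (tnth (lin (map_mx (@cconst R) N)) i) | i < n.+1]
        = lin N.
      apply: eq_from_tnth => a; rewrite !tnth_mktuple (rmorph_sum (map_mpoly f)).
      apply: eq_bigr => b _; rewrite -!mul_mpolyC (rmorphM (map_mpoly f)) /=.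
      by rewrite map_mpolyCr map_mpolyXU mxE fc.
    by rewrite /GN (map_comp_mpoly f Gt) linE.
  by apply: meval_eq => i; rewrite mxE -GNE mcoeff_map_mpoly.
have x0 : ae (fun k => term k x = 0).
  apply: aeS hs => k hk; rewrite (xE (term k) (fun=> erefl)).
  apply: Hzero; exists (map_mpoly (term k) Gt \mPo lin N); last exact: erefl.
  exact: (severi_lin uN hk).
have := congr1 st ((cls_eq0 x).2 x0); rewrite rmorph0 -[LHS]/((st \o cls) x) xE.
  have stclsG : map_mpoly (st \o cls) Gt = F.
    rewrite -stG -clsG; apply/mpolyP => m.
    rewrite [RHS](mcoeff_map_mpoly st) (mcoeff_map_mpoly cls).
    exact: (mcoeff_map_mpoly (st \o cls)).
  rewrite stclsG.
  move=> h.
  exact: h.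
by move=> c; rewrite /= -[RHS](sp_cst (ultra_specialization R)).
Qed.

End Transfer.

(** * Affine and homogeneous equations *)

Section Dehomogenization.
Variables (n : nat) (R : comNzRingType).

Definition affine_point (S : nzRingType) (v : 'I_n -> S) (k : 'I_n.+1) : S :=
  if unlift ord0 k is Some j then v j else 1.

Definition dehomog_tuple : n.+1.-tuple {mpoly R[n]} :=
  [tuple affine_point (fun j => 'X_j) k | k < n.+1].

Definition dehomog (G : {mpoly R[n.+1]}) : {mpoly R[n]} := G \mPo dehomog_tuple.

Lemma affine_point0 (S : nzRingType) (v : 'I_n -> S) : affine_point v ord0 = 1.
Proof. by rewrite /affine_point unlift_none. Qed.

Lemma affine_pointS (S : nzRingType) (v : 'I_n -> S) j :
  affine_point v (lift ord0 j) = v j.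
Proof. by rewrite /affine_point liftK. Qed.

Lemma dehomog_eval G v : (dehomog G).@[v] = G.@[affine_point v].
Proof.
rewrite comp_mpoly_meval; apply: meval_eq => k; rewrite tnth_mktuple.
by rewrite /affine_point; case: unlift => [j|]; rewrite ?mevalXU ?meval1.
Qed.

Lemma dehomog_deriv G i : (dehomog G)^`M(i) = dehomog (G^`M(lift ord0 i)).
Proof.
rewrite /dehomog mderiv_comp (bigD1 (lift ord0 i)) //= big1 ?addr0.
  by rewrite tnth_mktuple affine_pointS mderivXU eqxx mulr1.
move=> k; rewrite tnth_mktuple; case: (unliftP ord0 k) => [j ->|-> _].
  rewrite affine_pointS mderivXU (inj_eq lift_inj) => /negPf ->.
  by rewrite mulr0.
by rewrite affine_point0 mderiv1 mulr0.
Qed.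

(** The subtraction is truncated; the result has degree [d] only when [mdeg m] is at most [d], which
    the size bound in [homogenize_homog] ensures. *)
Definition hom_mnm d (m : 'X_{1..n}) : 'X_{1..n.+1} :=
  [multinom if unlift ord0 k is Some j then m j else (d - mdeg m)%N | k < n.+1].

Definition homogenize d (p : {mpoly R[n]}) : {mpoly R[n.+1]} :=
  \sum_(m <- msupp p) p@_m *: 'X_[hom_mnm d m].

Lemma homogenize_homog d p : (msize p <= d.+1)%N -> homogenize d p \is d.-homog.
Proof.
move=> hp; rewrite /homogenize big_seq; apply: rpred_sum => m mp.
apply: rpredZ; rewrite dhomogX /= mdegE big_ord_recl mnmE unlift_none.
under eq_bigr do rewrite mnmE liftK.
rewrite -mdegE subnK // -ltnS (leq_trans _ hp) //; exact: msize_mdeg_lt.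
Qed.

Lemma homogenizeK d p : dehomog (homogenize d p) = p.
Proof.
rewrite /dehomog /homogenize (raddf_sum (comp_mpoly _)) [RHS]mpolyE.
apply: eq_bigr => m _ /=; rewrite comp_mpolyZ; congr (_ *: _).
rewrite comp_mpolyX big_ord_recl tnth_mktuple affine_point0 expr1n mul1r.
rewrite [RHS]mpolyXE_id; apply: eq_bigr => i _.
by rewrite tnth_mktuple affine_pointS mnmE liftK.
Qed.

End Dehomogenization.
Arguments affine_point {n S} v k.

Lemma map_dehomog n (R S : comNzRingType) (f : {rmorphism R -> S})
  (G : {mpoly R[n.+1]}) : map_mpoly f (dehomog G) = dehomog (map_mpoly f G).
Proof.
have E : [tuple map_mpoly f (tnth (dehomog_tuple n R) i) | i < n.+1]
    = dehomog_tuple n S.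
  apply: eq_from_tnth => k; rewrite !tnth_mktuple /affine_point.
  by case: unlift => [j|]; rewrite ?map_mpolyXU ?rmorph1.
by rewrite /dehomog map_comp_mpoly E.
Qed.

Section NormalFormClosure.
Variable R : realType.
Local Notation C := (complex R).
Local Notation O := (ultra R).
Local Notation e := (infinitesimal R).
Local Notation st := (@st R).
Local Notation cst := (@cst R).

(** The perturbation has degree at most 4, so n >= 4 allows its homogenization in degree n. A
    singular point over [ultra] with a coordinate 1 specializes to a singular point of F, that is,
    to the origin of the chart; its coordinate 0 is therefore a unit, and the affine statement
    applies after division by it. *)
Lemma normal_form_closure n (F : {mpoly C[4]}) (f4 f5 : {mpoly C[3]})
    (N : 'M[C]_4) : (4 <= n)%N -> F \is n.-homog -> F != 0 -> N \in unitmx ->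
  (forall q : 'rV[C]_4, q != 0 -> singular_at F q ->
     forall j, q 0 (lift ord0 j) = 0) ->
  dehomog F = - (xyz C *+ 2) + f4 + f5 ->
  f4 \is 4.-homog -> (forall a, f4.@[evec C a] = 1) ->
  (forall m : 'X_{1..3}, (mdeg m < 5)%N -> f5@_m = 0) ->
  in_closure n (severi n 7) (F \mPo lin N).
Proof.
move=> n4 hF F0 uN sing dF hf4 f4e f5low.
have sp := ultra_specialization R.
have [E [p [degE p_inj pnode puniq]]] := affine_deformation sp
  (infinitesimal_neq0 R) (st_infinitesimal R) hf4 f4e f5low.
pose G := map_mpoly cst F + e%:MP * homogenize n E.
have hG : G \is n.-homog.
  apply: rpredD; first exact: map_mpoly_homog.
  by rewrite mul_mpolyC; apply/rpredZ/homogenize_homog/(leq_trans degE).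
have dG : dehomog G = map_mpoly cst (- (xyz C *+ 2) + f4 + f5) + e%:MP * E.
  rewrite -dF map_dehomog /G /dehomog comp_mpolyD comp_mpolyM comp_mpolyC.
  by rewrite -[X in _%:MP * X]/(dehomog (homogenize n E)) homogenizeK.
have stG : map_mpoly st G = F.
  rewrite /G rmorphD rmorphM /= map_mpolyCr /= st_infinitesimal mpolyC0 mul0r addr0.
  by apply/mpolyP => m; rewrite !mcoeff_map_mpoly; exact: (sp_cst sp).
pose P j := affine_point (p j).
(* The derivative along coordinate 0 is recovered from Euler's relation, where its coefficient is
   1. *)
have sing_jet q : usingular G (affine_point q) <-> forall o, jet (dehomog G) q o = 0.
  split=> [[h0 hd] [d|]|h]; first by rewrite /jet dehomog_deriv dehomog_eval.
    by rewrite /jet dehomog_eval.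
  have h0 : G.@[affine_point q] = 0 by rewrite -dehomog_eval; exact: (h None).
  split=> // k; case: (unliftP ord0 k) => [j ->|->].
    by rewrite -dehomog_eval -dehomog_deriv; exact: (h (Some j)).
  have := euler_homog (affine_point q) hG; rewrite h0 mulr0 big_ord_recl.
  rewrite affine_point0 mul1r big1 ?addr0 // => j _.
  have := h (Some j); rewrite /jet dehomog_deriv dehomog_eval => ->.
  exact: mulr0.
have -> : 7%N = #|{: option 'I_3 + 'I_3}| by rewrite card_sum card_option card_ord.
apply: (@in_closure_ultra R 3 n _ G P F N) => //.
- by move=> j; apply: affine_point0.
- by move=> j; apply/sing_jet; rewrite dG; have [] := pnode j.
- move=> j; have [_] := pnode j; congr (\det _ != 0); apply/matrixP => a b.
  by rewrite !mxE -dG !dehomog_deriv dehomog_eval.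
- move=> j j' jj'; apply: contrapT => h; case/eqP: jj'; apply: p_inj.
  apply/funext => a; apply: contrapT => ha; apply: h; exists (lift ord0 a).
  by rewrite /P !affine_pointS; apply/eqP.
move=> q [a qa] [q0 qd].
pose qb : 'rV[C]_4 := \row_k st (q k).
have qbE (g : {mpoly O[4]}) : (map_mpoly st g).@[qb 0] = st g.@[q].
  by rewrite -map_meval; apply: meval_eq => k; rewrite mxE.
have qb0 : qb != 0.
  by apply/eqP => /rowP /(_ a); rewrite !mxE qa rmorph1 => /eqP; rewrite oner_eq0.
have sqb : singular_at F qb.
  split=> [|k]; first by rewrite -stG qbE q0 rmorph0.
  by rewrite -stG map_mderiv qbE qd rmorph0.
have qbj := sing _ qb0 sqb.
have qb00 : st (q ord0) != 0.
  apply: contraNneq qb0 => z; apply/eqP/rowP => k; rewrite !mxE.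
  by case: (unliftP ord0 k) => [j ->|-> //]; have := qbj j; rewrite mxE.
have [y qy] := sp_unit sp qb00.
pose x i := y * q (lift ord0 i).
have xE : affine_point x =1 fun k => y * q k.
  move=> k; case: (unliftP ord0 k) => [j ->|->]; first by rewrite affine_pointS.
  by rewrite affine_point0 mulrC qy.
have [j hj] : exists j, x =1 p j.
  apply: puniq => [i|].
    rewrite rmorphM /=; have := qbj i; rewrite mxE => ->; exact: mulr0.
  rewrite -dG; apply/sing_jet; split=> [|k].
    by rewrite (meval_eq _ xE) (meval_homog _ _ hG) q0 mulr0.
  by rewrite (meval_eq _ xE) (meval_homog _ _ (deriv_homog k hG)) qd mulr0.
exists j => k; rewrite /P; case: (unliftP ord0 k) => [i ->|->].
  by rewrite affine_pointS -hj /x mulrA qy mul1r.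
by rewrite affine_point0 mulr1.
Qed.

End NormalFormClosure.

(** * Normal form of the triple point *)

Section LowOrder.
Variables (n : nat) (R : comNzRingType).
Implicit Types (p : {mpoly R[n]}) (d : nat).

Definition order_ge d p := forall m : 'X_{1..n}, (mdeg m < d)%N -> p@_m = 0.

Lemma homog_coeff0 d p m : p \is d.-homog -> mdeg m != d -> p@_m = 0.
Proof.
move=> /dhomogP hp; apply: contraNeq; rewrite -mcoeff_msupp => mp.
by apply/eqP; exact: hp.
Qed.

Lemma homog_part_split d p : order_ge d p -> exists p0 p1,
  [/\ p = p0 + p1, p0 \is d.-homog & order_ge d.+1 p1].
Proof.
move=> low; exists (pihomog mdeg d p), (p - pihomog mdeg d p).
split; [by rewrite addrC subrK|exact: pihomogP|].
have hom := pihomogP mdeg d p.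
have E m : mdeg m = d -> (pihomog mdeg d p)@_m = p@_m.
  move=> md; rewrite pihomogE (raddf_sum (mcoeff m)) /= [in RHS](mpolyE p).
  rewrite (raddf_sum (mcoeff m)) big_mkcond /=; apply: eq_bigr => m' _.
  case: eqP => // m'd; rewrite mcoeffZ mcoeffX; case: eqP => [E|_]; last by rewrite mulr0.
  by rewrite E in m'd.
move=> m; rewrite ltnS leq_eqVlt => /orP [/eqP md|md]; rewrite mcoeffB.
  by rewrite E // subrr.
rewrite low // (homog_coeff0 hom) ?subrr //.
by rewrite neq_ltn md.
Qed.

Lemma order_ge_lin d p (A : 'M[R]_n) : order_ge d p -> order_ge d (p \mPo lin A).
Proof.
move=> low m md; rewrite comp_mpolyEX (raddf_sum (mcoeff m)) big_seq big1 //= => m' m'p.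
have hm : 'X_[m'] \mPo lin A \is (mdeg m').-homog by apply: lin_homog; rewrite dhomogX.
rewrite mcoeffZ (homog_coeff0 hm) ?mulr0 //.
apply/eqP => /= E; move: m'p; rewrite mcoeff_msupp low ?eqxx //.
by rewrite -E.
Qed.

Lemma order_ge_comp k d p (c : {mpoly R[k]}) (t : n.-tuple {mpoly R[k]}) :
  order_ge d p -> exists r, p \mPo [tuple c * tnth t j | j < n] = c ^+ d * r.
Proof.
move=> low; exists (\sum_(m <- msupp p) p@_m *: (c ^+ (mdeg m - d) * ('X_[m] \mPo t))).
rewrite comp_mpolyEX mulr_sumr big_seq [RHS]big_seq; apply: eq_bigr => m mp.
have dm : (d <= mdeg m)%N.
  by rewrite leqNgt; apply: contraL mp => /low h; rewrite mcoeff_msupp h eqxx.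
rewrite -scalerAr; congr (_ *: _); rewrite mulrA -exprD subnKC // !comp_mpolyX.
rewrite mdegE -prodrXr -big_split; apply: eq_bigr => i _.
by rewrite tnth_mktuple exprMn.
Qed.

Lemma homog_comp k d p (c : {mpoly R[k]}) (t : n.-tuple {mpoly R[k]}) :
  p \is d.-homog -> p \mPo [tuple c * tnth t j | j < n] = c ^+ d * (p \mPo t).
Proof.
move=> /dhomogP hp; rewrite !comp_mpolyEX mulr_sumr big_seq [RHS]big_seq.
apply: eq_bigr => m mp; rewrite -scalerAr; congr (_ *: _); rewrite !comp_mpolyX.
have <- : mdeg m = d by exact: hp.
rewrite mdegE -prodrXr -big_split; apply: eq_bigr => i _.
by rewrite tnth_mktuple exprMn.
Qed.

Lemma linear_form p : p \is 1.-homog -> p = \sum_k p@_(U_(k))%MM *: 'X_k.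
Proof.
move=> hp; apply/mpolyP => m; rewrite (raddf_sum (mcoeff m)) /=.
have [/mdeg1P [k /eqP ->]|m1] := boolP (mdeg m == 1%N).
  rewrite (bigD1 k) //= mcoeffZ mcoeffXU eqxx mulr1 big1 ?addr0 // => j jk.
  by rewrite mcoeffZ mcoeffXU (negPf jk) mulr0.
rewrite (homog_coeff0 hp) // big1 // => j _.
rewrite mcoeffZ mcoeffX; case: eqP => [E|_]; last by rewrite mulr0.
by rewrite -E mdeg1 in m1.
Qed.

End LowOrder.

(** * Tangent cone and blow-up charts *)

Section Charts.
Variables (n : nat) (K : numClosedFieldType).
Implicit Types (p C : {mpoly K[n]}) (i : 'I_n).

Definition spec_tuple i (c : K) : n.-tuple {mpoly K[n]} :=
  [tuple if j == i then c%:MP else 'X_j | j < n].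

Lemma blowup_chartE i :
  blowup_chart i =
  [tuple 'X_i * tnth (spec_tuple i 1) j | j < n] :> n.-tuple {mpoly K[n]}.
Proof.
apply: eq_from_tnth => j; rewrite !tnth_mktuple.
by case: eqP => // _; rewrite mpolyC1 mulr1.
Qed.

(** Setting X_i = 1 forgets the exponent of X_i in a monomial, which the total degree restores;
    distinct monomials of the same degree thus stay distinct. *)
Lemma specialize_inj d i p q : p \is d.-homog -> q \is d.-homog ->
  specialize i 1 p = specialize i 1 q -> p = q.
Proof.
move=> hp hq /eqP; rewrite -subr_eq0 /specialize -comp_mpolyB => /eqP E.
apply/eqP; rewrite -subr_eq0; have {hp hq} : p - q \is d.-homog by apply: rpredB.
move: (p - q) E => {}p E /dhomogP hp; apply/negPn/negP => p0.
have [m0 hm0] : exists m, m \in msupp p.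
  case: (msupp p) (msupp_eq0 p) => [|m s _]; first by rewrite eqxx (negPf p0).
  by exists m; rewrite inE eqxx.
pose drop (m : 'X_{1..n}) : 'X_{1..n} := [multinom if j == i then 0%N else m j | j < n].
have monE (m : 'X_{1..n}) : 'X_[m] \mPo spec_tuple i 1 = 'X_[drop m].
  rewrite comp_mpolyX [RHS]mpolyXE_id; apply: eq_bigr => j _.
  rewrite tnth_mktuple mnmE; case: eqP => // _.
  by rewrite mpolyC1 expr1n expr0.
have drop_inj m : m \in msupp p -> drop m = drop m0 -> m = m0.
  move=> hm /mnmP dm; have dj j : j != i -> m j = m0 j.
    by move=> ji; have := dm j; rewrite !mnmE (negPf ji).
  have : mdeg m = mdeg m0 by rewrite (hp m) // (hp m0).
  rewrite !mdegE (bigD1 i) //= [in RHS](bigD1 i) //= (eq_bigr _ dj) => /addIn mi.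
  by apply/mnmP => j; case: (eqVneq j i) => [->|/dj].
have := congr1 (mcoeff (drop m0)) E.
rewrite -[_ \mPo _]/(p \mPo spec_tuple i 1) mcoeff0 comp_mpolyEX
  (raddf_sum (mcoeff _)) /=.
rewrite (bigD1_seq m0) //= ?msupp_uniq // monE mcoeffZ mcoeffX eqxx mulr1.
rewrite big_seq_cond big1 ?addr0 => [/eqP|m /andP [hm mm0]].
  by rewrite mcoeff_eq0 hm0.
rewrite monE mcoeffZ mcoeffX; case: eqP => [/drop_inj|_]; last by rewrite mulr0.
by move=> /(_ hm) E'; rewrite E' eqxx in mm0.
Qed.

(* The strict transform restricts to the tangent cone on the exceptional
   divisor, and its normal derivative there is the next homogeneous part. *)
Lemma strict_transform_split d i f fd fd1 h g : strict_transform d f i g ->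
  f = fd + fd1 + h -> fd \is d.-homog -> fd1 \is d.+1.-homog -> order_ge d.+2 h ->
  exists r, g = (fd \mPo spec_tuple i 1) + 'X_i * (fd1 \mPo spec_tuple i 1)
    + 'X_i * 'X_i * r.
Proof.
move=> hg fE hd hd1 hh.
have [r hr] := @order_ge_comp _ _ n _ _ 'X_i (spec_tuple i 1) hh.
exists r; have X0 : ('X_i : {mpoly K[n]}) ^+ d != 0.
  by rewrite expf_neq0 // -msize_poly_eq0 msizeX.
apply: (mulfI X0); rewrite -hg fE !comp_mpolyD blowup_chartE hr.
by rewrite (homog_comp _ _ hd) (homog_comp _ _ hd1) !exprS; ring.
Qed.

Lemma spec_tuple_comp i c p :
  (p \mPo spec_tuple i 1) \mPo spec_tuple i c = p \mPo spec_tuple i 1.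
Proof.
rewrite comp_mpolyA; congr (p \mPo _); apply: eq_from_tnth => j.
rewrite !tnth_mktuple; case: eqP => [_|/eqP ji]; first exact: comp_mpolyC.
by rewrite comp_mpoly_tnth tnth_mktuple (negPf ji).
Qed.

Lemma tangent_cone d f fd fd1 h C (i : 'I_n) : exceptional_divisor d f C ->
  f = fd + fd1 + h -> fd \is d.-homog -> fd1 \is d.+1.-homog -> order_ge d.+2 h ->
  fd = C.
Proof.
move=> [hC exc] fE hd hd1 hh; apply: (specialize_inj (i := i) hd hC).
have [g hg gE] := exc i; have [r rE] := strict_transform_split hg fE hd hd1 hh.
rewrite -gE -[RHS]/(g \mPo spec_tuple i 0) rE !comp_mpolyD !comp_mpolyM.
rewrite comp_mpoly_tnth tnth_mktuple eqxx.
by rewrite mpolyC0 !mul0r !addr0 spec_tuple_comp.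
Qed.

Lemma spec_tuple_eval i (v : 'I_n -> K) p :
  (p \mPo spec_tuple i 1).@[v] = p.@[fun j => if j == i then 1 else v j].
Proof.
rewrite comp_mpoly_meval; apply: meval_eq => j; rewrite tnth_mktuple.
by case: eqP => _; rewrite ?mevalC ?mevalXU.
Qed.

(** At the point of the exceptional divisor given by a singular point of the tangent cone, the
    strict transform and its derivatives along the divisor vanish. Its gradient reduces to the
    normal derivative, the value of [fd1], which smoothness forces to be nonzero. *)
Lemma blowup_smooth_next d f fd fd1 h (v : 'rV[K]_n) : blowup_smooth d f ->
  f = fd + fd1 + h -> fd \is d.-homog -> fd1 \is d.+1.-homog -> order_ge d.+2 h ->
  v != 0 -> singular_at fd v -> fd1.@[v 0] != 0.
Proof.
move=> smooth fE hd hd1 hh v0 sv.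
have [i vi] : exists i, v 0 i != 0.
  apply: contrapT => H; case/eqP: v0; apply/rowP => i; rewrite mxE.
  by apply: contrapT => /eqP vi; apply: H; exists i.
pose w := (v 0 i)^-1 *: v.
have wi : w 0 i = 1 by rewrite mxE mulVf.
have [sw0 swd] : singular_at fd w by apply: singular_scale hd sv.
apply/negP => /eqP fd1v.
have fd1w : fd1.@[w 0] = 0.
  rewrite (@meval_eq _ _ _ (fun j => (v 0 i)^-1 * v 0 j)) => [|j]; last by rewrite mxE.
  by rewrite (meval_homog _ _ hd1) fd1v mulr0.
have [g hg sm] := smooth i; have [r rE] := strict_transform_split hg fE hd hd1 hh.
(* The point of the exceptional divisor in chart [i]: the coordinate normalized to 1 is replaced by
   0, the equation of the divisor in this chart. *)
pose z : 'rV[K]_n := \row_j if j == i then 0 else w 0 j.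
have zi : z 0 i = 0 by rewrite mxE eqxx.
apply: (sm z zi).
have ev p : (p \mPo spec_tuple i 1).@[z 0] = p.@[w 0].
  rewrite spec_tuple_eval; apply: meval_eq => j; rewrite mxE.
  by case: eqP => // ->; rewrite wi.
split; first by rewrite rE !mevalD !mevalM mevalXU zi !ev sw0 !mul0r !addr0.
move=> a; rewrite rE !mderivD !mderivM !mevalD !mevalM !mevalD !mevalM mevalXU zi.
rewrite !(mul0r, mulr0, addr0) ev fd1w mulr0 addr0 mderiv_comp (raddf_sum (meval _)).
by rewrite big1 // => j _; rewrite /= mevalM ev swd mul0r.
Qed.

End Charts.

(** * The triangle of lines and adapted coordinates *)

Section Lines.
Variable K : numClosedFieldType.

Lemma linear_form_eval n (l : {mpoly K[n]}) v : l \is 1.-homog ->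
  l.@[v] = \sum_k l@_(U_(k))%MM * v k.
Proof.
move=> hl; rewrite {1}(linear_form hl) (raddf_sum (meval v)).
by apply: eq_bigr => k _; rewrite /= mevalZ mevalXU.
Qed.

(* Dual basis: vertex i lies on every line but the i-th. *)
Lemma three_lines_vertices (C : {mpoly K[3]}) : three_lines_not_in_pencil C ->
  exists V : 'M[K]_3, [/\ V \in unitmx,
    forall i, singular_at C (row i V)
  & forall A : 'M[K]_3, (exists b : 'I_3 -> K, forall i, row i A = b i *: row i V) ->
    exists b : 'I_3 -> K, (forall i, row i A = b i *: row i V) /\
      C \mPo lin A = (b o0 * b o1 * b o2)%:MP * xyz K].
Proof.
move=> [l [hl CE l0]]; have hom i : l i \is 1.-homog by case: (hl i).
pose L : 'M[K]_3 := \matrix_(i, k) (l i)@_(U_(k))%MM.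
have lE i (q : 'rV[K]_3) : (l i).@[q 0] = (q *m L^T) 0 i.
  rewrite linear_form_eval // mxE; apply: eq_bigr => k _.
  by rewrite !mxE mulrC.
have uL : L^T \in unitmx.
  rewrite unitmxE unitfE; apply/det0P => -[q q0 qL].
  by have [j] := l0 q q0; rewrite lE qL mxE eqxx.
pose V := invmx L^T.
have VL : V *m L^T = 1%:M by rewrite mulVmx.
have lV i j : (l j).@[(row i V) 0] = (i == j)%:R.
  by rewrite lE -row_mul VL !mxE.
exists V; split; first by rewrite unitmx_inv.
  move=> i; have [a [b /and3P [ab ai bi]]] : exists a b, [&& a != b, a != i & b != i].
    by case: (I3P i) => ->; [exists o1, o2|exists o0, o2|exists o0, o1].
  have la : (l a).@[(row i V) 0] = 0 by rewrite lV eq_sym (negPf ai).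
  have lb : (l b).@[(row i V) 0] = 0 by rewrite lV eq_sym (negPf bi).
  have -> : C = l a * l b * \prod_(j | (j != a) && (j != b)) l j.
    rewrite CE (bigD1 a) //= (bigD1 b) /= ?[b == a]eq_sym ?ab //.
    by rewrite mulrA.
  split=> [|d]; first by rewrite !mevalM la !mul0r.
  by rewrite !mderivM !mevalD !mevalM !mevalD !mevalM la lb; ring.
move=> A [b Ab]; exists b; split=> //.
have lA j : l j \mPo lin A = (b j)%:MP * 'X_j.
  rewrite {1}(linear_form (hom j)) (raddf_sum (comp_mpoly _)) /=.
  under eq_bigr => k _ do rewrite comp_mpolyZ comp_mpoly_tnth tnth_mktuple scaler_sumr.
  rewrite exchange_big /= (eq_bigr (fun i => (A *m L^T) i j *: 'X_i)); last first.
    move=> i _; rewrite mxE scaler_suml; apply: eq_bigr => k _.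
    by rewrite scalerA !mxE mulrC.
  have AL i : (A *m L^T) i j = b i * (i == j)%:R.
    have -> : (A *m L^T) i j = (row i A *m L^T) 0 j by rewrite -row_mul [RHS]mxE.
    by rewrite Ab -scalemxAl -row_mul VL !mxE.
  rewrite (bigD1 j) //= AL eqxx mulr1 mul_mpolyC big1 ?addr0 // => i ij.
  by rewrite AL (negPf ij) mulr0 scale0r.
rewrite CE prod3 !comp_mpolyM !lA /xyz prod3 !rmorphM /=; ring.
Qed.

Lemma in_closure_scale n d V (F : {mpoly K[n.+1]}) c :
  in_closure d V F -> in_closure d V (c *: F).
Proof.
move=> clF d' H hH Hz.
rewrite (@meval_eq _ _ _ (fun i => c * (coefs d F) 0 i)) => [|i].
  by rewrite (meval_homog _ _ hH) (clF d') // mulr0.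
by rewrite !mxE mcoeffZ.
Qed.

(* Acts by A on the affine coordinates and fixes the origin of the chart. *)
Definition affine_change n (A : 'M[K]_n) : 'M[K]_n.+1 :=
  \matrix_(i, k) if unlift ord0 i is Some a then
      (if unlift ord0 k is Some b then A a b else 0)
    else (k == ord0)%:R.

Lemma affine_changeM n (A B : 'M[K]_n) :
  affine_change A *m affine_change B = affine_change (A *m B).
Proof.
apply/matrixP => i k; rewrite !mxE big_ord_recl !mxE unlift_none eqxx.
under eq_bigr => j _ do rewrite !mxE liftK.
case: (unliftP ord0 i) => [a _|_]; last first.
  by rewrite mul1r big1 ?addr0 // => j _; rewrite eq_sym (negPf (neq_lift _ _)) mul0r.
rewrite mul0r add0r; case: (unliftP ord0 k) => [b _|_].
  by rewrite mxE.
by rewrite big1 // => j _; rewrite mulr0.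
Qed.

Lemma affine_change_unit n (A : 'M[K]_n) : A \in unitmx -> affine_change A \in unitmx.
Proof.
move=> uA; have : affine_change A *m affine_change (invmx A) = 1%:M.
  rewrite affine_changeM mulmxV //; apply/matrixP => i k; rewrite !mxE.
  case: (unliftP ord0 i) => [a ->|->]; case: (unliftP ord0 k) => [b ->|->].
  - by rewrite mxE (inj_eq lift_inj).
  - by rewrite eq_sym (negPf (neq_lift _ _)).
  - by rewrite eq_sym.
  - by [].
by case/mulmx1_unit.
Qed.

Lemma dehomog_lin n (F : {mpoly K[n.+1]}) (A : 'M[K]_n) (M : 'M[K]_n.+1) :
  dehomog (F \mPo lin (affine_change A *m M)) = local_eq F M \mPo lin A.
Proof.
rewrite /dehomog /local_eq !comp_mpolyA; congr (F \mPo _).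
apply: eq_from_tnth => k; rewrite !tnth_mktuple (raddf_sum (comp_mpoly _)) /=.
rewrite comp_mpolyD comp_mpolyC (raddf_sum (comp_mpoly (lin A))) /= big_ord_recl.
rewrite comp_mpolyZ comp_mpoly_tnth tnth_mktuple affine_point0; congr (_ + _).
  rewrite -mul_mpolyC mulr1 mxE big_ord_recl mxE unlift_none eqxx mul1r.
  rewrite big1 ?addr0 // => j _.
  by rewrite mxE unlift_none eq_sym (negPf (neq_lift _ _)) mul0r.
under [RHS]eq_bigr => j _ do rewrite comp_mpolyZ comp_mpoly_tnth tnth_mktuple scaler_sumr.
rewrite exchange_big /=; apply: eq_bigr => i _.
rewrite comp_mpolyZ comp_mpoly_tnth tnth_mktuple affine_pointS mxE big_ord_recl mxE liftK.
rewrite unlift_none mul0r add0r scaler_suml; apply: eq_bigr => j _.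
by rewrite mxE !liftK scalerA mulrC.
Qed.

End Lines.

Theorem proposition3p11 (R : realType) (n : nat) (F : {mpoly (complex R)[4]})
    (p : 'rV[complex R]_4) (C : {mpoly (complex R)[3]}) :
  (4 <= n)%N ->
  hypersurface n F ->
  p != 0 ->
  (forall q : 'rV[complex R]_4, q != 0 -> (singular_at F q <-> (q == p)%MS)) ->
  quasi_ordinary F p 3 C ->
  has_nodes 3 C ->
  three_lines_not_in_pencil C ->
  in_closure n (severi n 7) F.
Proof.
move=> n4 [hF F0] p0 sing [_ [M [[uM rM] [low _] smooth exc _]]] _ lines.
set f := local_eq F M in low smooth exc.
have [V [uV sV CV]] := three_lines_vertices lines.
have [f3 [g [fE hf3 lowg]]] := homog_part_split (low : order_ge 3 f).
have [f4 [f5 [gE hf4 low5]]] := homog_part_split lowg.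
rewrite gE addrA in fE.
have f3C : f3 = C by exact: (tangent_cone (ord0 : 'I_3) exc fE hf3 hf4 low5).
have f4V i : f4.@[(row i V) 0] != 0.
  apply: (blowup_smooth_next smooth fE hf3 hf4 low5); last by rewrite f3C.
  apply/eqP => Vi; have := congr1 (fun B => B *m invmx V) (rowE i V).
  rewrite Vi mul0mx mulmxK // => /rowP /(_ i); rewrite !mxE !eqxx => /esym/eqP.
  by rewrite oner_eq0.
(* Scaling the vertex [i] by [b i] gives the quartic part the value 1 there. *)
pose b i := 4.-root (f4.@[(row i V) 0])^-1.
have b4 i : b i ^+ 4 * f4.@[(row i V) 0] = 1 by rewrite rootCK // mulVf.
have b0 i : b i != 0.
  by apply: contraTneq (oner_neq0 (complex R)) => E; rewrite -(b4 i) E expr0n mul0r eqxx.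
(* A further common factor t multiplies the quartic values by t^4 and the cubic by t^3. Since
   [b o0 * b o1 * b o2] = -2t, the cubic becomes -2 t^4 xyz, and one division by t^4 normalizes both
   parts. *)
pose t := - (b o0 * b o1 * b o2) / 2%:R.
have t0 : t != 0 by rewrite mulf_neq0 ?invr_eq0 ?pnatr_eq0 // oppr_eq0 !mulf_neq0.
pose A : 'M[complex R]_3 := diag_mx (\row_i (t * b i)) *m V.
have rowA i : row i A = (t * b i) *: row i V.
  by apply/rowP => k; rewrite /A mul_diag_mx !mxE.
have uA : A \in unitmx.
  rewrite unitmx_mul uV andbT unitmxE det_diag unitfE.
  by apply/prodf_neq0 => i _; rewrite mxE mulf_neq0.
have [b' [rowA' CA]] := CV A (ex_intro _ _ rowA).
have CA' : C \mPo lin A = (- (t ^+ 4 *+ 2))%:MP * xyz (complex R).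
  have bE i : b' i = t * b i.
    have /eqP := rowA' i; rewrite rowA -subr_eq0 -scalerBl scaler_eq0 subr_eq0.
    case/orP => /eqP // Vi; have := f4V i; rewrite Vi.
    rewrite (_ : f4.@[_] = 0) ?eqxx // (@meval_eq _ _ _ (fun=> 0 * 0)).
      by rewrite (meval_homog _ _ hf4) expr0n mul0r.
    by move=> j; rewrite mxE mul0r.
  rewrite CA !bE; congr (_%:MP * _).
  have -> : t * b o0 * (t * b o1) * (t * b o2) = t ^+ 3 * (b o0 * b o1 * b o2) by ring.
  have -> : b o0 * b o1 * b o2 = - (t *+ 2).
    by rewrite /t -mulr_natr mulfVK ?opprK // pnatr_eq0.
  by ring.
pose M' := affine_change A *m M.
have uM' : M' \in unitmx by rewrite unitmx_mul affine_change_unit.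
pose c := (t ^+ 4)^-1; have c0 : c != 0 by rewrite invr_eq0 expf_neq0.
have c4 : c * t ^+ 4 = 1 by rewrite mulVf // expf_neq0.
pose F' := c *: (F \mPo lin M').
have -> : F = c^-1 *: (F' \mPo lin (invmx M')).
  rewrite /F' comp_mpolyZ scalerA mulVf // scale1r lin_comp mulVmx //.
  by rewrite lin1.
apply: in_closure_scale.
apply: (@normal_form_closure R n F' (c *: (f4 \mPo lin A)) (c *: (f5 \mPo lin A))) => //.
- exact/rpredZ/lin_homog.
- rewrite scaler_eq0 negb_or c0; apply: contraNneq F0 => E.
  by rewrite -[F]lin1 -(mulVmx uM') -lin_comp E comp_mpoly0.
- by rewrite unitmx_inv.
(* The singular point p is row 0 of [M'], so in the new coordinates it is the first coordinate
   point. *)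
- move=> q q0 [v0 d0] j.
  have sq : singular_at (F \mPo lin M') q.
    split=> [|i]; apply: (mulfI c0); rewrite mulr0.
      by rewrite -mevalZ.
    by rewrite -mevalZ -mderivZ.
  have qM0 : q *m M' != 0.
    by apply: contraNneq q0 => E; rewrite -[q](mulmxK uM') E mul0mx.
  have /(sing _ qM0) /andP [/sub_rVP [a qa] _] := (singular_lin _ _ uM').1 sq.
  have pE : p = row 0 M'.
    rewrite /M' row_mul -rM; apply/rowP => k; rewrite !mxE big_ord_recl !mxE.
    rewrite unlift_none eqxx mul1r big1 ?addr0 // => i _.
    by rewrite !mxE unlift_none eq_sym (negPf (neq_lift _ _)) mul0r.
  have -> : q = a *: delta_mx 0 0.
    by rewrite -[q](mulmxK uM') qa pE rowE -scalemxAl mulmxK.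
  by rewrite !mxE eq_sym (negPf (neq_lift _ _)) andbF mulr0.
- rewrite /F' [dehomog _]comp_mpolyZ -[_ \mPo _]/(dehomog (F \mPo lin M')).
  rewrite dehomog_lin -/f fE f3C !comp_mpolyD CA' !scalerDr; congr (_ + _ + _).
  rewrite -mul_mpolyC mulrA -rmorphM mulrN mulrnAr c4 rmorphN rmorphMn rmorph1.
  by rewrite mulNr mulr2n mulrDl mul1r -mulr2n.
- exact/rpredZ/lin_homog.
- move=> a; rewrite mevalZ.
  rewrite (@meval_eq _ _ _ (fun k => (delta_mx 0 a : 'rV[complex R]_3) 0 k)); last first.
    by move=> k; rewrite mxE eqxx.
  rewrite lin_eval -rowE rowA (@meval_eq _ _ _ (fun k => (t * b a) * (row a V) 0 k)).
    rewrite (meval_homog _ _ hf4) exprMn.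
    transitivity ((c * t ^+ 4) * (b a ^+ 4 * f4.@[(row a V) 0])); first by ring.
    by rewrite c4 b4 mulr1.
  by move=> k; rewrite mxE.
by move=> m md; rewrite mcoeffZ (order_ge_lin A low5) // mulr0.
Qed.
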